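(* Fix integers $j \ge 1$, $k \ge 2$, $\ell \ge 3$. For any $\epsilon, C > 0$ there exist $n_0, \delta > 0$ such that for every integer $n \ge n_0$, every $p \ge n^{-1/2}$, and every $n$-vertex graph $G$ with at most $C p^4 n^4$ copies of $C_4$, the following hold. (i) If $G$ has at most $\delta p^{j} n^{j+1}$ copies of $P_j$, then $G$ has at most $\epsilon p n^2$ edges. (ii) If $G$ has at most $\delta p^{2\ell} n^{2\ell}$ copies of $C_{2\ell}$, then $G$ has at most $\epsilon p n^2$ edges. (iii) If $G$ has at most $\delta p^{2k+1} n^{2k+1}$ copies of $C_{2k+1}$ and every bipartite subgraph of $G$ has at most $\delta p^4 n^4$ copies of $C_4$, then $G$ can be made $\{C_3, C_5, \ldots, C_{2k+1}\}$-free by removing at most $\epsilon p n^2$ edges.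
   Context: Graphs are finite, unweighted, undirected and simple. $C_m$ ($m\ge3$) is the cycle of length $m$, and $P_j$ ($j \ge 1$) is the path of length $j$ (with $j+1$ vertices and $j$ edges). The number of copies of $H$ in $G$ is the number of subgraphs of $G$ isomorphic to $H$. A graph is $\mathcal{F}$-free if it contains no subgraph isomorphic to a member of $\mathcal{F}$. *)

(* Defs.v *)
From HB Require Import structures.
From mathcomp Require Import all_boot.

Set Implicit Arguments.
Unset Strict Implicit.
Unset Printing Implicit Defensive.

(** Finite simple graphs are pairs (vertex set, edge set) inside an ambient
    finite type [T], an edge being a two-element set of vertices.  Since the
    vertex set need not be all of [T], the subgraphs of a graph on [T] are again
    graphs on [T], and they form a finite type, so that they can be counted. *)
Definition graph_axiom (T : finType) (g : {set T} * {set {set T}}) : bool :=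
  [forall e in g.2, (e \subset g.1) && (#|e| == 2)].

Record graph (T : finType) : Type := Graph {
  graph_val : {set T} * {set {set T}};
  _ : graph_axiom graph_val }.

HB.instance Definition _ (T : finType) := [isSub for @graph_val T].
HB.instance Definition _ (T : finType) := [Finite of graph T by <:].

Definition vertices (T : finType) (G : graph T) : {set T} := (graph_val G).1.
Definition edges (T : finType) (G : graph T) : {set {set T}} := (graph_val G).2.

Definition adj (T : finType) (G : graph T) : rel T :=
  fun u v => [set u; v] \in edges G.

Definition subgraph (T : finType) (K G : graph T) : bool :=
  (vertices K \subset vertices G) && (edges K \subset edges G).

Definition isomorphic (S T : finType) (H : graph S) (K : graph T) : bool :=
  [exists f : {ffun {x : S | x \in vertices H} -> {y : T | y \in vertices K}},
    [&& injectiveb f,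
        [forall y, y \in codom f] &
        [forall u, forall v,
           adj H (val u) (val v) == adj K (val (f u)) (val (f v))]]].

Definition copies (S T : finType) (H : graph S) (G : graph T) : nat :=
  #|[set K : graph T | subgraph K G && isomorphic H K]|.

Definition is_free (S T : finType) (H : graph S) (G : graph T) : Prop :=
  forall K : graph T, subgraph K G -> ~~ isomorphic H K.

Definition bipartite (T : finType) (G : graph T) : Prop :=
  exists X Y : {set T},
    [/\ X :|: Y = vertices G, [disjoint X & Y] &
        forall e, e \in edges G ->
          exists x y : T, [/\ x \in X, y \in Y & e = [set x; y]]].

Lemma remove_edges_subproof (T : finType) (G : graph T) (F : {set {set T}}) :
  graph_axiom (vertices G, edges G :\: F).
Proof.
apply/forall_inP => e /= /setDP[eG _].
by have /forall_inP/(_ e eG) : graph_axiom (val G) := valP G.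
Qed.

Definition remove_edges (T : finType) (G : graph T) (F : {set {set T}}) :
  graph T := Graph (remove_edges_subproof G F).

(** [r] need not be symmetric: a pair of distinct vertices is an edge as soon as
    it is related by [r] in one direction. *)
Definition rel_edges (T : finType) (r : rel T) : {set {set T}} :=
  [set [set u.1; u.2] | u : T * T & (u.1 != u.2) && r u.1 u.2].

Lemma rel_graph_subproof (T : finType) (r : rel T) :
  graph_axiom ([set: T], rel_edges r).
Proof.
apply/forall_inP => e /= /imsetP[[u v]].
by rewrite inE /= => /andP[uv _] ->; rewrite subsetT cards2 uv.
Qed.

Definition rel_graph (T : finType) (r : rel T) : graph T :=
  Graph (rel_graph_subproof r).

(** [ordS] is the successor modulo [m]; [cycle_graph m] is the cycle [C_m] only
    for [3 <= m]. *)
Definition cycle_graph (m : nat) : graph 'I_m :=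
  rel_graph (fun a b : 'I_m => b == ordS a).

(** The path with [j] edges, hence [j.+1] vertices. *)
Definition path_graph (j : nat) : graph 'I_j.+1 :=
  rel_graph (fun a b : 'I_j.+1 => b == a.+1 :> nat).

(* Main.v *)
Require Import Defs.
From mathcomp Require Import all_boot all_order all_algebra.
From mathcomp Require Import reals exp.
From mathcomp Require Import ring lra zify.

Set Implicit Arguments.
Unset Strict Implicit.
Unset Printing Implicit Defensive.

Import Order.TTheory GRing.Theory Num.Theory.
Local Open Scope ring_scope.

(** Put [D = p * n], so that [n <= D^2].  In terms of [D] the statement compares
    the number of [m]-cycles with [D^m] and the number of edges with [n * D].  The
    bound on four-cycles says that the squares of the codegrees of pairs of
    distinct vertices add up to [O(D^4)].  Vertices of degree above a large
    multiple of [D] then carry few edges and can be ignored.  Once they are gone,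
    closed walks of length at least five with a repeated vertex are negligible
    against [D^m] ([few_degenerate_closed_walks]), so it is enough to count closed
    walks, which are traces of powers of the adjacency kernel.

    Parts (i) and (ii) are proved in the contrapositive form.  With at least
    [eps * n * D] edges there is a subgraph of minimum degree of order [D] that
    keeps half of them.  Paths are then built greedily ([many_paths]); closed walks
    of length [2l] are pairs of [l]-walks with common ends, and are bounded below
    by the Cauchy-Schwarz inequality ([many_even_cycles]).

    Part (iii).  Averaging over all bipartitions, [G] itself has at most a small
    multiple of [D^4] four-cycles ([bipartite_ncyc4]).  If [n] is small against
    [D^2], this alone forces the number of edges to be small ([mass_small]), and
    all the edges are removed.  Otherwise [n] and [D^2] are of the same order.  A
    weak regularity lemma ([regularity]) gives a partition into boundedly many
    parts such that the adjacency kernel is bounded below, in the cut norm, by its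
    average [W] over the cells, truncated at a constant.  Most pairs of vertices
    have at most one common neighbour, so the relation of being at distance two is
    a bounded and dense kernel close to the square of the adjacency kernel.  In a
    closed walk of length [L >= 5], four edges are replaced by two such pairs; all
    the factors but one edge at a time are then bounded, and they can be exchanged
    for [W] successively ([closed_walks_transfer]).  Hence few [L]-cycles in [G]
    mean few closed [L]-walks in the dense kernel [W].

    A removal lemma for odd closed walks in dense weighted graphs
    ([dense_removal]) now selects cells of small total volume meeting all short odd
    closed walks of the reduced graph.  One removes the edges that lie in these
    cells, in cells of low density, and in cells of high density.  The last ones
    contain few edges because of the lack of four-cycles: two vertices of one part
    have about one common neighbour, which bounds the mean square of the densities
    ([heavy_cells_mass]).  A short odd cycle among the remaining edges would project
    to a closed walk of the reduced graph that avoids the selected cells. *)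

(** * Sums over sequences and walks *)

(** Sign goals for expressions built from quantities of known sign. *)
Ltac pos := repeat match goal with
  | |- is_true (0 < _) => first [ assumption | exact: ltr01 | by rewrite ltr0n
      | apply: exprn_gt0 | apply: mulr_gt0 | rewrite invr_gt0 | apply: addr_gt0 ]
  | |- is_true (0 <= _) => first [ assumption | apply: ltW; assumption
      | exact: ler01 | exact: ler0n | exact: sqr_ge0 | exact: normr_ge0
      | apply: exprn_ge0 | apply: mulr_ge0 | rewrite invr_ge0 | apply: addr_ge0 ]
  end.

Section SumSeq.
Variables (R : realFieldType) (T : finType).
Implicit Types (F H : seq T -> R) (k : nat).

(** Recursion on the length, rather than a sum over tuples, makes splitting
    and rotating sequences a matter of induction. *)
Fixpoint sumseq k F : R :=
  if k is k'.+1 then \sum_z sumseq k' (fun p => F (z :: p)) else F [::].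

Lemma eq_sumseq k F H :
  (forall s, size s = k -> F s = H s) -> sumseq k F = sumseq k H.
Proof.
elim: k F H => [|k IH] F H FH /=; first exact: FH.
by apply: eq_bigr => z _; apply: IH => s sk; rewrite FH //= sk.
Qed.

Lemma ler_sumseq k F H :
  (forall s, size s = k -> F s <= H s) -> sumseq k F <= sumseq k H.
Proof.
elim: k F H => [|k IH] F H FH /=; first exact: FH.
by apply: ler_sum => z _; apply: IH => s sk; rewrite FH //= sk.
Qed.

Lemma sumseq_ge0 k F : (forall s, size s = k -> 0 <= F s) -> 0 <= sumseq k F.
Proof.
elim: k F => [|k IH] F F0 /=; first exact: F0.
by apply: sumr_ge0 => z _; apply: IH => s sk; rewrite F0 //= sk.
Qed.

Lemma sumseq_sum k (I : finType) (P : pred I) (F : I -> seq T -> R) :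
  sumseq k (fun s => \sum_(i | P i) F i s) = \sum_(i | P i) sumseq k (F i).
Proof.
elim: k F => [|k IH] F //=.
by rewrite exchange_big /=; apply: eq_bigr => z _; rewrite IH.
Qed.

Lemma sumseqD k F H : sumseq k (fun s => F s + H s) = sumseq k F + sumseq k H.
Proof.
elim: k F H => [|k IH] F H //=.
by rewrite -big_split /=; apply: eq_bigr => z _; rewrite IH.
Qed.

Lemma sumseqZ k c F : sumseq k (fun s => c * F s) = c * sumseq k F.
Proof.
elim: k F => [|k IH] F //=.
by rewrite mulr_sumr; apply: eq_bigr => z _; rewrite IH.
Qed.

Lemma sumseq_eq0 k F : (forall s, size s = k -> F s = 0) -> sumseq k F = 0.
Proof.
elim: k F => [|k IH] F F0 /=; first exact: F0.
by apply: big1 => z _; apply: IH => s sk; rewrite F0 //= sk.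
Qed.

Lemma sumseq_cat j k F :
  sumseq (j + k) F = sumseq j (fun p => sumseq k (fun q => F (p ++ q))).
Proof.
by elim: j F => [|j IH] F //=; apply: eq_bigr => z _; rewrite IH.
Qed.

Lemma exchange_sumseq j k (F : seq T -> seq T -> R) :
  sumseq j (fun p => sumseq k (F p)) = sumseq k (fun q => sumseq j (F^~ q)).
Proof.
elim: j F => [|j IH] F //=.
by rewrite sumseq_sum; apply: eq_bigr => z _; rewrite IH.
Qed.

(** A rotation exchanges the two halves of a concatenation, hence two
    independent summations. *)
Lemma sumseq_rot m i F :
  (i <= m)%N -> sumseq m (fun s => F (rot i s)) = sumseq m F.
Proof.
move=> im; rewrite -{1}(subnKC im) -{2}(subnK im) !sumseq_cat exchange_sumseq.
apply: eq_sumseq => q _; apply: eq_sumseq => p sp.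
by rewrite -sp rot_size_cat.
Qed.

Lemma sumseq_tuple k F : sumseq k F = \sum_(s : k.-tuple T) F s.
Proof.
elim: k F => [|k IH] F /=.
  by rewrite (big_pred1 [tuple]) // => t; apply/esym/eqP; exact: tuple0.
rewrite (reindex (fun u : T * k.-tuple T => [tuple of u.1 :: u.2])) /=; last first.
  exists (fun s : k.+1.-tuple T => (thead s, [tuple of behead s])) => [[z s]|s] _ /=.
    by congr pair; apply: val_inj.
  by rewrite -tuple_eta.
rewrite -(pair_bigA _ (fun z (s : k.-tuple T) => F (z :: s))) /=.
by apply: eq_bigr => z _; rewrite IH.
Qed.

Lemma sumseq_card k (P : pred (seq T)) :
  sumseq k (fun s => (P s)%:R) = #|[set s : k.-tuple T | P s]|%:R.
Proof.
rewrite sumseq_tuple -sum1_card natr_sum big_mkcond /=.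
rewrite [RHS]big_mkcond /=; apply: eq_bigr => s _.
by rewrite inE; case: (P s).
Qed.

End SumSeq.

Section Kernel.
Variables (R : realFieldType) (T : finType).
Implicit Types (A : T -> T -> R) (k : nat).

(** The powers of a matrix indexed by [T], that is, weighted walk counts. *)
Fixpoint kpow A k x y : R :=
  if k is k'.+1 then \sum_z A x z * kpow A k' z y else (x == y)%:R.

Lemma kpowS A k x y : kpow A k.+1 x y = \sum_z A x z * kpow A k z y.
Proof. by []. Qed.

Lemma sum_deltal (x : T) (F : T -> R) : \sum_z (x == z)%:R * F z = F x.
Proof.
rewrite (bigD1 x) //= eqxx mul1r big1 ?addr0 // => z zx.
by rewrite eq_sym (negbTE zx) mul0r.
Qed.

Lemma sum_deltar (x : T) (F : T -> R) : \sum_z F z * (z == x)%:R = F x.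
Proof.
rewrite -[RHS]sum_deltal; apply: eq_bigr => z _.
by rewrite mulrC eq_sym.
Qed.

Lemma kpow1 A x y : kpow A 1 x y = A x y.
Proof. exact: sum_deltar. Qed.

Lemma kpowD A i j x y :
  kpow A (i + j) x y = \sum_z kpow A i x z * kpow A j z y.
Proof.
elim: i x => [|i IH] x /=; first by rewrite sum_deltal.
transitivity (\sum_z \sum_w A x w * kpow A i w z * kpow A j z y).
  rewrite exchange_big /=; apply: eq_bigr => w _.
  rewrite IH mulr_sumr; apply: eq_bigr => z _; exact: mulrA.
by apply: eq_bigr => z _; rewrite mulr_suml.
Qed.

Lemma kpowSr A k x y : kpow A k.+1 x y = \sum_z kpow A k x z * A z y.
Proof. by rewrite -addn1 kpowD; apply: eq_bigr => z _; rewrite kpow1. Qed.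

Lemma kpow_sym A k x y : (forall u v, A u v = A v u) -> kpow A k x y = kpow A k y x.
Proof.
move=> sA; elim: k x y => [|k IH] x y; first by rewrite /= eq_sym.
by rewrite kpowSr /=; apply: eq_bigr => z _; rewrite mulrC sA IH.
Qed.

Lemma kpow_ge0 A k x y : (forall u v, 0 <= A u v) -> 0 <= kpow A k x y.
Proof.
move=> A0; elim: k x => [|k IH] x /=; first exact: ler0n.
by apply: sumr_ge0 => z _; rewrite mulr_ge0.
Qed.

Lemma kpow_row A t k x : (forall u v, 0 <= A u v) ->
  (forall u, \sum_v A u v <= t) -> \sum_y kpow A k x y <= t ^+ k.
Proof.
move=> A0 At; elim: k x => [|k IH] x /=.
  rewrite (bigD1 x) //= eqxx big1 ?addr0 // => z zx.
  by rewrite eq_sym (negbTE zx).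
have t0 : 0 <= t by apply: le_trans (At x); apply: sumr_ge0.
rewrite exchange_big /=.
apply: le_trans (_ : \sum_z A x z * t ^+ k <= _).
  apply: ler_sum => z _; rewrite -mulr_sumr; exact: ler_wpM2l.
by rewrite -mulr_suml exprS ler_wpM2r ?exprn_ge0.
Qed.

(** All steps but the last one are bounded by row sums, the last one by an
    entry; so one factor [t] is saved. *)
Lemma kpow_entry A b t k x y : (forall u v, 0 <= A u v) ->
  (forall u v, A u v <= b) ->
  (forall u, \sum_v A u v <= t) -> kpow A k.+1 x y <= b * t ^+ k.
Proof.
move=> A0 Ab At; rewrite kpowSr.
apply: le_trans (_ : \sum_z kpow A k x z * b <= _).
  by apply: ler_sum => z _; rewrite ler_wpM2l ?kpow_ge0.
have b0 : 0 <= b by apply: le_trans (Ab x x).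
by rewrite -mulr_suml mulrC ler_wpM2l // kpow_row.
Qed.

End Kernel.
#[global] Arguments kpow {R T} A k x y : simpl never.

Section Walks.
Variables (R : realFieldType) (T : finType).
Implicit Types (e : rel T).

Definition adjk e : T -> T -> R := fun x y => (e x y)%:R.

Lemma kpow_walks e k x y :
  kpow (adjk e) k.+1 x y = sumseq k (fun p => (path e x (rcons p y))%:R).
Proof.
elim: k x => [|k IH] x; first by rewrite kpow1 /= andbT.
rewrite kpowS; apply: eq_bigr => z _; rewrite IH -sumseqZ.
by apply: eq_sumseq => p _; rewrite /= /adjk -natrM mulnb.
Qed.

Lemma closed_walks e m :
  sumseq m.+1 (fun s => (cycle e s)%:R) = \sum_v kpow (adjk e) m.+1 v v.
Proof. by apply: eq_bigr => v _; rewrite kpow_walks. Qed.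

(** For [m >= 3] each [m]-cycle is counted once for every choice of a starting
    point and of a direction. *)
Definition ncyc e m : R := sumseq m (fun s => (uniq s && cycle e s)%:R).

(** A closed walk that comes back to its first vertex after [r.+1] steps: it
    is made of two closed walks through that vertex. *)
Definition pinched e r (s : seq T) : bool :=
  if s is v :: s' then cycle e s && (ohead (drop r s') == Some v) else false.

Lemma pinched_walks e r q :
  sumseq (r + q.+1).+1 (fun s => (pinched e r s)%:R) =
  \sum_v kpow (adjk e) r.+1 v v * kpow (adjk e) q.+1 v v.
Proof.
rewrite [LHS]/=; apply: eq_bigr => v _; rewrite sumseq_cat !kpow_walks.
rewrite mulrC -sumseqZ; apply: eq_sumseq => p sp.
rewrite [LHS]/= (bigD1 v) //= big1 ?addr0 => [|u uv].
  rewrite mulrC -sumseqZ; apply: eq_sumseq => w _.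
  rewrite drop_cat sp ltnn subnn /= eqxx andbT rcons_cat rcons_cons -cat_rcons.
  by rewrite cat_path last_rcons -natrM mulnb.
apply: sumseq_eq0 => w _; rewrite drop_cat sp ltnn subnn /=.
have /negbTE -> : Some u != Some v by apply: contraNneq uv => -[->].
by rewrite andbF.
Qed.

Lemma nonuniq_pinched e s : cycle e s -> ~~ uniq s ->
  exists i r q, [/\ (i < size s)%N, size s = (r + q.+1).+1 & pinched e r (rot i s)].
Proof.
move=> cs; case: s cs => [//|x0 s0]; move: (x0 :: s0) => s cs.
case/(uniqPn x0) => i [j [ij js eqij]].
have si : (i < size s)%N by apply: ltn_trans js.
exists i, (j - i.+1)%N, (size s - (j - i.+1).+2)%N; split => //; [move: ij js; move: (size s) => z; lia|].
have : cycle e (rot i s) by rewrite rot_cycle.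
rewrite /rot (drop_nth x0 si) /pinched cat_cons => -> /=.
rewrite drop_cat size_drop ifT; last by apply: ltn_sub2r => //; apply: leq_ltn_trans ij js.
rewrite drop_drop subnK // (drop_nth x0) //= eqij; exact: eqxx.
Qed.

(** A closed walk with a repeated vertex becomes pinched after a rotation, and
    there are at most [m] rotations and at most [m] places for the second
    visit. *)
Lemma nonuniq_bound e m b :
  (forall r q, m = (r + q.+1).+1 ->
     \sum_v kpow (adjk e) r.+1 v v * kpow (adjk e) q.+1 v v <= b) -> 0 <= b ->
  sumseq m (fun s => (cycle e s)%:R) <= ncyc e m + m%:R * m%:R * b.
Proof.
move=> hb b0.
pose Z (r : 'I_m) s := ((r.+2 <= m)%N && pinched e r s)%:R : R.
have hZ r : sumseq m (Z r) <= b.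
  case: (leqP r.+2 m) => rm; last first.
    by apply: le_trans b0; rewrite sumseq_eq0 // => s _; rewrite /Z leqNgt rm.
  have -> : sumseq m (Z r) = sumseq m (fun s => (pinched e r s)%:R).
    by apply: eq_sumseq => s _; rewrite /Z rm.
  have em : m = (r + (m - r.+2).+1).+1 by lia.
  rewrite {1}em pinched_walks; exact: hb.
apply: le_trans (_ : sumseq m (fun s => (uniq s && cycle e s)%:R +
   \sum_(i < m) \sum_(r < m) Z r (rot i s)) <= _).
  apply: ler_sumseq => s sm.
  have s0 : 0 <= \sum_(i < m) \sum_(r < m) Z r (rot i s).
    by apply: sumr_ge0 => i _; apply: sumr_ge0 => r _; rewrite ler0n.
  case: (boolP (cycle e s)) => cs; last by rewrite andbF addr_ge0.
  case: (boolP (uniq s)) => us /=; first by rewrite lerDl.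
  rewrite add0r; have [i [r [q [im er pr]]]] := nonuniq_pinched cs us.
  rewrite sm in im er; have rm : (r < m)%N by lia.
  rewrite (bigD1 (Ordinal im)) //= (bigD1 (Ordinal rm)) //= /Z /= pr andbT.
  rewrite (_ : (r.+1 < m)%N); last by lia.
  rewrite -addrA lerDl addr_ge0 //; apply: sumr_ge0 => *; rewrite ?ler0n //.
  by apply: sumr_ge0 => *; rewrite ?ler0n.
rewrite sumseqD lerD2l sumseq_sum.
apply: le_trans (_ : \sum_(i < m) \sum_(r < m) b <= _).
  apply: ler_sum => i _; rewrite sumseq_sum; apply: ler_sum => r _.
  by apply: le_trans (hZ r); rewrite (sumseq_rot (Z r) (ltnW (ltn_ord i))).
by rewrite !sumr_const !card_ord -mulrnA -natrM -(mulr_natl b).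
Qed.

End Walks.

(** * Closed walks that revisit a vertex *)

Section Degenerate.
Variables (R : realFieldType) (T : finType) (A : T -> T -> R) (t Q : R).
Hypothesis A_sym : forall x y, A x y = A y x.
Hypothesis A_ge0 : forall x y, 0 <= A x y.
Hypothesis A_le1 : forall x y, A x y <= 1.
Hypothesis A_row : forall x, \sum_y A x y <= t.
Hypothesis A_C4 : \sum_x \sum_y kpow A 2 x y ^+ 2 <= Q.

Hypothesis t0 : 0 <= t.

Lemma closed_step r v : kpow A r.+3 v v = \sum_x kpow A 2 v x * kpow A r.+1 x v.
Proof. by rewrite -kpowD. Qed.

(** Once its second vertex is chosen, the rest of a closed walk costs one
    factor [t] per step, except that the last step is forced. *)
Lemma weighted_codeg r v :
  \sum_x kpow A 2 v x ^+ 2 * kpow A r.+1 x v <= (\sum_x kpow A 2 v x ^+ 2) * t ^+ r.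
Proof.
rewrite mulr_suml; apply: ler_sum => x _; apply: ler_wpM2l; first exact: sqr_ge0.
by rewrite -[leRHS]mul1r; apply: kpow_entry.
Qed.

Lemma kpow_col s v : \sum_x kpow A s x v <= t ^+ s.
Proof.
rewrite (eq_bigr (fun x => kpow A s v x)) => [|x _]; first exact: kpow_row.
exact: kpow_sym.
Qed.

(** In two closed walks through [v], the first two steps of each contribute
    codegrees [c(v,x)] and [c(v,y)].  Bounding their product by the mean of
    the squares leaves a sum of squared codegrees, and the remaining steps
    cost a factor [t] each.  The total is smaller by a factor of order [t]
    than what free walks would give. *)
Lemma twin_closed_walks r s :
  \sum_v kpow A r.+3 v v * kpow A s.+3 v v <= Q * t ^+ (r + s).+1.
Proof.
pose c v := \sum_x kpow A 2 v x ^+ 2.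
suff H v : kpow A r.+3 v v * kpow A s.+3 v v <= c v * t ^+ (r + s).+1.
  apply: le_trans (ler_sum _ (fun v _ => H v)) _; rewrite -mulr_suml.
  by apply: ler_wpM2r => //; rewrite exprn_ge0.
pose a x := kpow A 2 v x; pose b x := kpow A r.+1 x v; pose d x := kpow A s.+1 x v.
have a0 x : 0 <= a x by apply: kpow_ge0.
have b0 x : 0 <= b x by apply: kpow_ge0.
have d0 x : 0 <= d x by apply: kpow_ge0.
have hb : \sum_x b x <= t ^+ r.+1 by apply: kpow_col.
have hd : \sum_x d x <= t ^+ s.+1 by apply: kpow_col.
have hab : \sum_x a x ^+ 2 * b x <= c v * t ^+ r by apply: weighted_codeg.
have had : \sum_x a x ^+ 2 * d x <= c v * t ^+ s by apply: weighted_codeg.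
have c0 : 0 <= c v by apply: sumr_ge0 => x _; apply: sqr_ge0.
rewrite !closed_step -/(a _) big_distrl /=.
apply: le_trans (_ : \sum_x \sum_y (2^-1 * (a x ^+ 2 * b x * d y)
                     + 2^-1 * (b x * (a y ^+ 2 * d y))) <= _).
  apply: ler_sum => x _; rewrite mulr_sumr; apply: ler_sum => y _.
  rewrite -/(b x) -/(a y) -/(d y) -/(a x).
  have -> : a x * b x * (a y * d y) = a x * a y * (b x * d y) by ring.
  have -> : 2^-1 * (a x ^+ 2 * b x * d y) + 2^-1 * (b x * (a y ^+ 2 * d y))
     = 2^-1 * (a x ^+ 2 + a y ^+ 2) * (b x * d y) by ring.
  apply: ler_wpM2r; first exact: mulr_ge0.
  by have := sqr_ge0 (a x - a y); lra.
have -> : \sum_x \sum_y (2^-1 * (a x ^+ 2 * b x * d y)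
                     + 2^-1 * (b x * (a y ^+ 2 * d y))) =
   2^-1 * ((\sum_x a x ^+ 2 * b x) * (\sum_y d y)
          + (\sum_x b x) * (\sum_y a y ^+ 2 * d y)).
  rewrite !big_distrl /= -big_split /= mulr_sumr; apply: eq_bigr => x _.
  rewrite !mulr_sumr -big_split /= mulr_sumr; apply: eq_bigr => y _; ring.
have h1 : (\sum_x a x ^+ 2 * b x) * (\sum_y d y) <= c v * t ^+ (r + s).+1.
  have -> : c v * t ^+ (r + s).+1 = (c v * t ^+ r) * t ^+ s.+1.
    by rewrite -mulrA -exprD addnS.
  by apply: ler_pM => //; apply: sumr_ge0 => x _; rewrite ?mulr_ge0 ?sqr_ge0.
have h2 : (\sum_x b x) * (\sum_y a y ^+ 2 * d y) <= c v * t ^+ (r + s).+1.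
  have -> : c v * t ^+ (r + s).+1 = t ^+ r.+1 * (c v * t ^+ s).
    by rewrite mulrCA -exprD addSn.
  by apply: ler_pM => //; apply: sumr_ge0 => x _; rewrite ?mulr_ge0 ?sqr_ge0.
lra.
Qed.

(** The inequality [c <= tau * c^2 + 1 / (4 * tau)] trades a codegree for its
    square.  The free parameter matters for closed walks of length three, for
    which the squares alone are not of smaller order. *)
Lemma closed_walks_le s tau : 0 < tau ->
  \sum_v kpow A s.+3 v v <= tau * Q * t ^+ s + #|T|%:R * t ^+ s.+1 / (4 * tau).
Proof.
move=> tau0.
apply: le_trans (_ : \sum_v (tau * (\sum_x kpow A 2 v x ^+ 2) * t ^+ s
    + t ^+ s.+1 / (4 * tau)) <= _).
  apply: ler_sum => v _; rewrite closed_step.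
  apply: le_trans (_ : \sum_x (tau * (kpow A 2 v x ^+ 2 * kpow A s.+1 x v)
     + (4 * tau)^-1 * kpow A s.+1 x v) <= _).
    apply: ler_sum => x _; rewrite mulrA -mulrDl ler_wpM2r ?kpow_ge0 //.
    set a := kpow A 2 v x.
    have -> : tau * a ^+ 2 + (4 * tau)^-1 = a + tau * (a - (2 * tau)^-1) ^+ 2.
      by field; rewrite gt_eqF //.
    by rewrite lerDl mulr_ge0 ?sqr_ge0 // ltW.
  rewrite big_split /= -!mulr_sumr -mulrA lerD //.
    by rewrite ler_wpM2l ?weighted_codeg // ltW.
  rewrite [leRHS]mulrC; apply: ler_wpM2l; last exact: kpow_col.
  by rewrite invr_ge0 mulr_ge0 // ltW.
rewrite big_split /= sumr_const -[X in _ + X]mulr_natl mulrA lerD2r.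
rewrite -mulr_suml -mulr_sumr -!mulrA ler_wpM2l ?(ltW tau0) //.
by rewrite ler_wpM2r ?exprn_ge0.
Qed.

End Degenerate.

Section DegenerateCycles.
Variable (R : realFieldType).

(** In the regime [n <= D^2], with degrees [O(D)] and squared codegrees
    summing to [O(D^4)], closed walks of length [m >= 5] with a repeated
    vertex are negligible against [D^m].  A repetition cuts the walk into
    closed walks of lengths [r] and [s] with [r + s = m].  If both are at
    least three there are [O(D^(m-1))] of them; if one is two, it is a
    backtracking step, and the bound on single closed walks applies. *)
Lemma few_degenerate_closed_walks (q : nat) (K C2 tau' : R) : 0 < K -> 0 < C2 -> 0 < tau' ->
  exists2 D0 : R, 0 < D0 & forall (T : finType) (e : rel T) (D : R),
    symmetric e -> irreflexive e -> D0 <= D -> #|T|%:R <= D ^+ 2 ->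
    (forall x, \sum_y adjk R e x y <= K * D) ->
    \sum_x \sum_y kpow (adjk R e) 2 x y ^+ 2 <= C2 * D ^+ 4 ->
    sumseq (q + 5) (fun s => (cycle e s)%:R) <= ncyc R e (q + 5) + tau' * D ^+ (q + 5).
Proof.
move=> K0 C0 t0; set m := (q + 5)%N.
have [M ME M0] : exists2 M : R, M = m%:R * m%:R & 0 < M.
  by exists (m%:R * m%:R) => //; rewrite -natrM ltr0n /m addnC.
pose tau := tau' / (2 * M * C2 * K ^+ q.+1).
have Kq j : 0 < K ^+ j by rewrite exprn_gt0.
have tau0 : 0 < tau by rewrite /tau; pos.
pose L := K ^+ q.+2 / (4 * tau) + C2 * K ^+ q.
have L0 : 0 < L by rewrite /L; pos.
have D00 : 0 < 2 * M * L / tau' by pos.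
exists (2 * M * L / tau') => // T e D sym irr DD0 nD row C4.
have D0 : 0 < D by apply: lt_le_trans DD0.
have Ds j : 0 < D ^+ j by rewrite exprn_gt0.
set A := adjk R e; pose t := K * D; have tt0 : 0 <= t by rewrite /t; pos.
have Asym x y : A x y = A y x by rewrite /A /adjk sym.
have A0 x y : 0 <= A x y by apply: ler0n.
have A1 x y : A x y <= 1 by rewrite /A /adjk lern1; case: (e x y).
pose b1 := t * (tau * (C2 * D ^+ 4) * t ^+ q + #|T|%:R * t ^+ q.+1 / (4 * tau)).
pose b2 := C2 * D ^+ 4 * t ^+ q.
have b10 : 0 <= b1 by rewrite /b1; pos.
have b20 : 0 <= b2 by rewrite /b2; pos.
have two s : \sum_v kpow A 2 v v * kpow A s v v <= t * \sum_v kpow A s v v.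
  rewrite mulr_sumr; apply: ler_sum => v _; apply: ler_wpM2r; first exact: kpow_ge0.
  by have := @kpow_entry _ _ A 1 t 1 v v A0 A1 row; rewrite expr1 mul1r.
have A_diag v : kpow A 1 v v = 0 by rewrite kpow1 /A /adjk irr.
apply: le_trans (@nonuniq_bound _ _ e m (b1 + b2) _ _) _.
- case=> [|[|r]] p mE.
  + rewrite big1 ?addr_ge0 // => v _; rewrite A_diag mul0r //.
  + have -> : p = q.+2 by move: mE; rewrite /m; clear; lia.
    apply: le_trans (two _) _; rewrite -[leLHS]addr0 lerD // /b1 ler_wpM2l //.
    exact: closed_walks_le.
  + case: p mE => [|[|p]] mE.
    * rewrite big1 ?addr_ge0 // => v _; rewrite A_diag mulr0 //.
    * have -> : r = q by move: mE; rewrite /m; clear; lia.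
      rewrite (eq_bigr (fun v => kpow A 2 v v * kpow A q.+3 v v)); last first.
        by move=> v _; rewrite mulrC.
      apply: le_trans (two _) _; rewrite -[leLHS]addr0 lerD // /b1 ler_wpM2l //.
      exact: closed_walks_le.
    * apply: le_trans (twin_closed_walks _ _ _ _ C4 _ _ _) _ => //.
      rewrite -[leLHS]add0r lerD // /b2.
      by have -> : (r + p).+1 = q by move: mE; rewrite /m; clear; lia.
- exact: addr_ge0.
rewrite lerD2l -ME.
have hb1 : b1 <= tau * C2 * K ^+ q.+1 * D ^+ m + K ^+ q.+2 / (4 * tau) * D ^+ (q + 4).
  have -> : b1 = tau * C2 * K ^+ q.+1 * D ^+ m + #|T|%:R * (K ^+ q.+2 / (4 * tau) * D ^+ q.+2).
    rewrite /b1 /t /m !exprS exprD !exprMn; field; rewrite gt_eqF //.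
  rewrite lerD2l; have -> : (q + 4 = 2 + q.+2)%N by rewrite addnC.
  by rewrite exprD [leRHS]mulrCA; apply: ler_wpM2r => //; pos.
have hb2 : b2 = C2 * K ^+ q * D ^+ (q + 4).
  rewrite /b2 /t exprMn exprD; ring.
have DL : 2 * M * L * D ^+ (q + 4) <= tau' * D ^+ m.
  have -> : D ^+ m = D * D ^+ (q + 4) by rewrite -exprS /m; congr (_ ^+ _); rewrite addnS.
  rewrite mulrA; apply: ler_wpM2r; first by pos.
  by move: DD0; rewrite ler_pdivrMr // (mulrC D).
have hB : M * (b1 + b2) <= M * (tau * C2 * K ^+ q.+1 * D ^+ m + L * D ^+ (q + 4)).
  apply: ler_wpM2l; first by pos.
  by rewrite hb2 [L * _]mulrDl [leRHS]addrA lerD2r.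
apply: le_trans hB _.
have -> : M * (tau * C2 * K ^+ q.+1 * D ^+ m + L * D ^+ (q + 4)) =
  2^-1 * (tau' * D ^+ m) + 2^-1 * (2 * M * L * D ^+ (q + 4)).
  rewrite /tau; field; rewrite ?expf_neq0 ?gt_eqF //.
lra.
Qed.
End DegenerateCycles.

(** * Degrees, codegrees and four-cycles *)

Section CauchySchwarz.
Variables (R : realFieldType) (I : finType).

Lemma sum_sqr_le (f : I -> R) : (\sum_i f i) ^+ 2 <= #|I|%:R * \sum_i f i ^+ 2.
Proof.
have : 0 <= \sum_i \sum_j (f i - f j) ^+ 2.
  by apply: sumr_ge0 => i _; apply: sumr_ge0 => j _; apply: sqr_ge0.
have -> : \sum_i \sum_j (f i - f j) ^+ 2 =
   2 * (#|I|%:R * \sum_i f i ^+ 2) - 2 * (\sum_i f i) ^+ 2.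
  transitivity (\sum_(i : I) \sum_(j : I) f i ^+ 2 + \sum_(i : I) \sum_(j : I) f j ^+ 2
                - 2 * \sum_i \sum_j f i * f j).
    rewrite mulr_sumr -sumrN -!big_split /=; apply: eq_bigr => i _.
    rewrite mulr_sumr -sumrN -!big_split /=; apply: eq_bigr => j _; ring.
  have -> : \sum_i \sum_j f i * f j = (\sum_i f i) ^+ 2.
    by rewrite expr2 big_distrl /=; apply: eq_bigr => i _; rewrite mulr_sumr.
  congr (_ - _); rewrite [X in _ + X]sumr_const -(mulr_natl (\sum_j _)).
  rewrite (eq_bigr (fun i => #|I|%:R * f i ^+ 2)) => [|i _]; last first.
    by rewrite sumr_const mulr_natl.
  by rewrite -mulr_sumr; ring.
lra.
Qed.
End CauchySchwarz.

Section Degrees.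
Variables (R : realFieldType) (T : finType) (e : rel T).
Hypothesis e_sym : symmetric e.
Hypothesis e_irr : irreflexive e.
Let A := adjk R e.
Let n : R := #|T|%:R.
Definition deg (x : T) : R := \sum_y adjk R e x y.
(** Twice the number of edges. *)
Definition mass : R := \sum_x deg x.

Lemma adjk_sym x y : A x y = A y x. Proof. by rewrite /A /adjk e_sym. Qed.
Lemma adjk_ge0 x y : 0 <= A x y. Proof. exact: ler0n. Qed.
Lemma adjk_idem x y : A x y * A x y = A x y.
Proof. by rewrite /A /adjk -natrM mulnb andbb. Qed.

Lemma deg_ge0 x : 0 <= deg x.
Proof. by apply: sumr_ge0 => y _; apply: adjk_ge0. Qed.

Lemma codegE x y : kpow A 2 x y = \sum_z A x z * A z y.
Proof. by rewrite kpowS; apply: eq_bigr => z _; rewrite kpow1. Qed.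

Lemma codeg_diag x : kpow A 2 x x = deg x.
Proof.
rewrite codegE; apply: eq_bigr => z _; rewrite (adjk_sym z x); exact: adjk_idem.
Qed.

Lemma sum_codeg : \sum_x \sum_y kpow A 2 x y = \sum_x deg x ^+ 2.
Proof.
transitivity (\sum_x \sum_z A x z * deg z).
  apply: eq_bigr => x _; transitivity (\sum_y \sum_z A x z * A z y).
    by apply: eq_bigr => y _; exact: codegE.
  by rewrite exchange_big /=; apply: eq_bigr => z _; rewrite mulr_sumr.
rewrite exchange_big /=; apply: eq_bigr => z _.
rewrite -mulr_suml expr2; congr (_ * _).
by apply: eq_bigr => x _; exact: adjk_sym.
Qed.

(** For a natural number [c], [c^2 - c] counts ordered pairs of distinct
    common neighbours. *)
Lemma codeg_pairs x y : kpow A 2 x y ^+ 2 - kpow A 2 x y =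
  \sum_b \sum_d (b != d)%:R * (A x b * A b y * (A x d * A d y)).
Proof.
rewrite codegE; set g := fun z => A x z * A z y.
have gg z : g z * g z = g z by rewrite /g mulrACA !adjk_idem.
transitivity (\sum_b \sum_d (g b * g d - (b == d)%:R * (g b * g d))).
  transitivity (\sum_b \sum_d g b * g d - \sum_b \sum_d (b == d)%:R * (g b * g d)).
    congr (_ - _); first by rewrite expr2 big_distrl /=; apply: eq_bigr => b _; rewrite mulr_sumr.
    by apply: eq_bigr => b _; rewrite (sum_deltal b (fun d => g b * g d)) gg.
  rewrite -sumrB; apply: eq_bigr => b _; rewrite -sumrB //.
apply: eq_bigr => b _; apply: eq_bigr => d _; rewrite /g.
by case: eqP => _ /=; ring.
Qed.

Lemma codeg_ncyc4 :
  \sum_x \sum_y (x != y)%:R * (kpow A 2 x y ^+ 2 - kpow A 2 x y) <= ncyc R e 4.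
Proof.
rewrite /ncyc /=; apply: ler_sum => x _.
rewrite [leRHS]exchange_big /=; apply: ler_sum => y _.
rewrite codeg_pairs mulr_sumr; apply: ler_sum => b _.
rewrite mulr_sumr; apply: ler_sum => d _.
rewrite /A /adjk -!natrM !mulnb ler_nat.
case: (x =P y) => [//|/eqP xy]; case: (b =P d) => [//|/eqP bd] /=.
case xb: (e x b) => //; case yb: (e b y) => //.
case xd: (e x d) => //; case yd: (e d y) => //=.
rewrite !in_cons !in_nil (e_sym y) (e_sym d x) yd xd andbT !orbF.
have neq u v : e u v -> u != v by move=> uv; apply: contraTneq uv => ->; rewrite e_irr.
by rewrite !negb_or (neq _ _ xb) xy (neq _ _ xd) (neq _ _ yb) bd eq_sym (neq _ _ yd).
Qed.

(** The inequality [c^2 <= 2 * (c^2 - c) + 1] charges codegrees above one to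
    four-cycles and leaves one unit per pair of vertices. *)
Lemma codeg_offdiag : \sum_x \sum_y (x != y)%:R * kpow A 2 x y ^+ 2
  <= 2 * ncyc R e 4 + n ^+ 2.
Proof.
have -> : n ^+ 2 = \sum_(x : T) \sum_(y : T) 1.
  by rewrite !sumr_const -[RHS]mulr_natr /n expr2.
apply: le_trans (_ : 2 * \sum_x \sum_y (x != y)%:R * (kpow A 2 x y ^+ 2 - kpow A 2 x y)
   + \sum_(x : T) \sum_(y : T) 1 <= _).
  rewrite mulr_sumr -big_split /=; apply: ler_sum => x _.
  rewrite mulr_sumr -big_split /=; apply: ler_sum => y _.
  case: (x != y); rewrite ?mul1r ?mul0r; last by lra.
  have := sqr_ge0 (kpow A 2 x y - 1); lra.
by rewrite lerD2r ler_wpM2l // codeg_ncyc4.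
Qed.

Lemma codeg_all b : (forall x, deg x <= b) -> 0 <= b ->
  \sum_x \sum_y kpow A 2 x y ^+ 2 <= 2 * ncyc R e 4 + n ^+ 2 + n * b ^+ 2.
Proof.
move=> degb b0.
apply: le_trans (_ : \sum_x \sum_y (x != y)%:R * kpow A 2 x y ^+ 2 + \sum_x deg x ^+ 2 <= _).
  rewrite -big_split /=; apply: ler_sum => x _.
  rewrite [leLHS](bigD1 x) //= codeg_diag addrC lerD2r.
  rewrite [leRHS](bigD1 x) //= eqxx mul0r add0r.
  by apply: ler_sum => y yx; rewrite eq_sym yx mul1r.
rewrite lerD ?codeg_offdiag //.
have -> : n * b ^+ 2 = \sum_(x : T) b ^+ 2 by rewrite sumr_const mulr_natl.
by apply: ler_sum => x _; rewrite lerXn2r ?nnegrE ?deg_ge0.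
Qed.

(** The sum of the squared degrees counts two-step walks.  Those with distinct
    ends form a sum of codegrees, which the weighted mean inequality compares
    with squared codegrees and with the number of pairs. *)
Lemma sum_deg_sqr theta : 0 < theta -> \sum_x deg x ^+ 2 <=
  mass + theta * (2 * ncyc R e 4 + n ^+ 2) + n ^+ 2 / (4 * theta).
Proof.
move=> th0; rewrite -sum_codeg.
apply: le_trans (_ : mass + theta * (\sum_x \sum_y (x != y)%:R * kpow A 2 x y ^+ 2)
   + \sum_(x : T) \sum_(y : T) (4 * theta)^-1 <= _); last first.
  rewrite lerD //; first by rewrite lerD2l ler_wpM2l ?codeg_offdiag // ltW.
  by rewrite !sumr_const -mulrnA -(mulr_natl (4 * theta)^-1) natrM /n expr2.
rewrite /mass mulr_sumr -!big_split /=; apply: ler_sum => x _.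
rewrite (bigD1 x) //= codeg_diag -addrA lerD2l.
rewrite mulr_sumr -big_split /= [leRHS](bigD1 x) //= eqxx mul0r mulr0 add0r.
rewrite -[leLHS]add0r; apply: lerD; first by pos.
apply: ler_sum => y yx; rewrite eq_sym yx mul1r.
set a := kpow A 2 x y.
have -> : theta * a ^+ 2 + (4 * theta)^-1 = a + theta * (a - (2 * theta)^-1) ^+ 2.
  by field; rewrite gt_eqF.
by rewrite lerDl; pos.
Qed.

Lemma mass_sqr_le : mass ^+ 2 <= n * \sum_x deg x ^+ 2.
Proof. exact: sum_sqr_le. Qed.

(** The weight [n / (2 * D^2)] balances the two terms of the preceding
    estimate. *)
Lemma sum_deg_sqr_le (C D : R) : 0 < n -> 1 <= D -> n <= D ^+ 2 -> 0 <= C ->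
  ncyc R e 4 <= C * D ^+ 4 -> \sum_x deg x ^+ 2 <= (2 * C + 3) * n * D ^+ 2.
Proof.
move=> n0 D1 nD C0 c4; have D0 : 0 < D by lra.
have D20 : 0 < D ^+ 2 by pos.
pose th := n / (2 * D ^+ 2).
have th0 : 0 < th by rewrite /th; pos.
have := sum_deg_sqr th0.
have n2 : n ^+ 2 <= D ^+ 4.
  rewrite (_ : 4 = 2 + 2)%N // exprD -expr2 lerXn2r ?nnegrE //; pos.
have h1 : th * (2 * ncyc R e 4 + n ^+ 2) <= th * ((2 * C + 1) * D ^+ 4).
  by rewrite ler_wpM2l ?(ltW th0) //; lra.
have h2 : th * ((2 * C + 1) * D ^+ 4) = (C + 2^-1) * n * D ^+ 2.
  by rewrite /th; field; rewrite gt_eqF.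
have h3 : n ^+ 2 / (4 * th) = 2^-1 * n * D ^+ 2.
  by rewrite /th; field; rewrite !gt_eqF.
have h4 : mass <= 2^-1 * \sum_x deg x ^+ 2 + 2^-1 * n.
  have -> : n = \sum_(x : T) 1 by rewrite sumr_const.
  rewrite /mass !mulr_sumr -big_split /=; apply: ler_sum => x _.
  have := sqr_ge0 (deg x - 1); lra.
have h5 : n <= n * D ^+ 2 by rewrite ler_peMr ?(ltW n0) // exprn_ege1.
rewrite h3; set S := \sum_x _ in h4 *; lra.
Qed.

(** Supersaturation read backwards: a graph with [eps * n * D] edges has at
    least [n * (eps * D)^2] two-step walks, and these produce about [eps^4 *
    D^4] four-cycles as soon as this exceeds [n^2], the contribution of pairs
    with a single common neighbour. *)
Lemma mass_small (eps D : R) : 0 < n -> 0 < eps -> 2 / eps <= D ->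
  n ^+ 2 + 2 * ncyc R e 4 <= (eps ^+ 2 / 4) ^+ 2 * D ^+ 4 -> mass <= eps * n * D.
Proof.
move=> n0 e0 De h; rewrite leNgt; apply/negP => hm.
have D0 : 0 < D by apply: lt_le_trans De; pos.
have D20 : 0 < D ^+ 2 by pos.
pose s := eps ^+ 2 / 4; have s0 : 0 < s by rewrite /s; pos.
(* [s] plays the part of the square root of the bound on the squared codegrees. *)
pose th := n / (2 * s * D ^+ 2).
have th0 : 0 < th by rewrite /th; pos.
have h1 := sum_deg_sqr th0.
have h2 : th * (2 * ncyc R e 4 + n ^+ 2) <= 2^-1 * s * n * D ^+ 2.
  have -> : 2^-1 * s * n * D ^+ 2 = th * (s ^+ 2 * D ^+ 4).
    by rewrite /th; field; rewrite !gt_eqF.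
  by rewrite ler_wpM2l ?(ltW th0) // addrC.
have h3 : n ^+ 2 / (4 * th) = 2^-1 * s * n * D ^+ 2.
  by rewrite /th; field; rewrite !gt_eqF.
have h4 : \sum_x deg x ^+ 2 <= mass + s * n * D ^+ 2.
  rewrite h3 in h1; set S := \sum_x _ in h1 *; lra.
have h5 := mass_sqr_le.
have h6 : mass ^+ 2 <= n * mass + s * n ^+ 2 * D ^+ 2.
  have -> : n * mass + s * n ^+ 2 * D ^+ 2 = n * (mass + s * n * D ^+ 2) by ring.
  by apply: le_trans h5 _; rewrite ler_wpM2l ?(ltW n0).
have h7 : n <= 2^-1 * (eps * n * D).
  have : 1 <= 2^-1 * (eps * D) by move: De; rewrite ler_pdivrMr //; lra.
  by rewrite -(ler_pM2l n0); lra.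
have m0 : 0 < mass by apply: lt_trans hm; pos.
have h8 : n * mass <= 2^-1 * mass ^+ 2.
  by rewrite expr2 mulrA ler_pM2r //; lra.
have h9 : (eps * n * D) ^+ 2 < mass ^+ 2.
  by rewrite ltrXn2r // ?nnegrE; pos.
have h10 : s * n ^+ 2 * D ^+ 2 = 4^-1 * (eps * n * D) ^+ 2 by rewrite /s; field.
have h11 : 0 < (eps * n * D) ^+ 2 by pos.
lra.
Qed.

Definition trunc (t : R) : rel T := [rel x y | [&& e x y, deg x <= t & deg y <= t]].

(** An edge at a vertex [x] of degree above [t] is charged to [deg x / t >=
    1]. *)
Lemma trunc_loss t : 0 < t ->
  mass - \sum_x \sum_y adjk R (trunc t) x y <= 2 * (\sum_x deg x ^+ 2) / t.
Proof.
move=> t0.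
have -> : 2 * (\sum_x deg x ^+ 2) / t =
   \sum_x \sum_y A x y * (deg x / t) + \sum_x \sum_y A x y * (deg y / t).
  have -> : \sum_x \sum_y A x y * (deg y / t) = \sum_x \sum_y A x y * (deg x / t).
    rewrite exchange_big /=; apply: eq_bigr => y _; apply: eq_bigr => x _.
    by rewrite adjk_sym.
  rewrite -[RHS]mulr2n -[RHS]mulr_natl -mulrA; congr (_ * _); rewrite mulr_suml.
  by apply: eq_bigr => x _; rewrite -mulr_suml expr2 mulrA.
rewrite /mass -sumrB -big_split /=; apply: ler_sum => x _.
rewrite /deg -sumrB -big_split /=; apply: ler_sum => y _.
rewrite -mulrDr -/(deg x) -/(deg y) /A /adjk /trunc /=.
case: (e x y) => /=; last by rewrite subrr mul0r.
have dx := deg_ge0 x; have dy := deg_ge0 y.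
have dx' : 0 <= deg x / t by apply: divr_ge0 => //; apply: ltW.
have dy' : 0 <= deg y / t by apply: divr_ge0 => //; apply: ltW.
rewrite mul1r; case: (lerP (deg x) t) => hx /=; last first.
  have : 1 <= deg x / t by rewrite ler_pdivlMr // mul1r ltW.
  lra.
case: (lerP (deg y) t) => hy /=; first by lra.
have : 1 <= deg y / t by rewrite ler_pdivlMr // mul1r ltW.
lra.
Qed.

Lemma trunc_deg t x : 0 <= t -> \sum_y adjk R (trunc t) x y <= t.
Proof.
move=> t0; case: (lerP (deg x) t) => hx.
  apply: le_trans hx; apply: ler_sum => y _; rewrite /adjk /trunc /= ler_nat.
  by case: (e x y) => //=; case: andP.
rewrite big1 // => y _; rewrite /adjk /trunc /= [deg x <= t]leNgt hx.
by rewrite andbF.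
Qed.

(** A subset maximizing [e(U,U) - 2 * t * #|U|] works: deleting a vertex of
    degree less than [t] inside [U] would increase this quantity. *)
Lemma min_degree_subset (t : R) : 0 <= t -> exists U : {set T},
  (forall x, x \in U -> t <= \sum_(y in U) A x y) /\
  mass - 2 * t * n <= \sum_(x in U) \sum_(y in U) A x y.
Proof.
move=> t0.
pose g (U : {set T}) : R := \sum_(x in U) \sum_(y in U) A x y - 2 * t * #|U|%:R.
have [U _ maxU] := @arg_maxP _ R _ (setT : {set T}) xpredT g isT.
have {maxU} maxU W : g W <= g U by exact: maxU.
exists U; split; last first.
  have := maxU setT; rewrite /g cardsT.
  rewrite (eq_bigl xpredT) => [|x]; last by rewrite in_setT.
  rewrite (eq_bigr deg) => [|x _]; last by apply: eq_bigl => y; rewrite in_setT.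
  rewrite -/n -/mass => /le_trans; apply.
  by rewrite lerBlDr lerDl; pos.
move=> x xU; have := maxU (U :\ x); rewrite /g.
rewrite (cardsD1 x U) xU natrD.
have -> : \sum_(v in U) \sum_(y in U) A v y = \sum_(y in U) A x y +
    (\sum_(v in U :\ x) A v x + \sum_(v in U :\ x) \sum_(y in U :\ x) A v y).
  rewrite (big_setD1 x) //= -big_split /=; congr (_ + _).
  by apply: eq_bigr => v _; rewrite (big_setD1 x).
have -> : \sum_(v in U :\ x) A v x = \sum_(y in U) A x y.
  rewrite [RHS](big_setD1 x) //= {2}/A /adjk e_irr add0r.
  by apply: eq_bigr => y _; rewrite adjk_sym.
rewrite mulr1n; lra.
Qed.

End Degrees.

(** * Paths and even cycles *)

Section Subgraphs.
Variables (R : realFieldType) (T : finType).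
Implicit Types (e f : rel T).

Lemma ncyc_sub e f m : subrel e f -> ncyc R e m <= ncyc R f m.
Proof.
move=> ef; apply: ler_sumseq => s _; rewrite ler_nat.
case: (uniq s) => //=; case: (boolP (cycle e s)) => //= ce.
by rewrite (sub_cycle ef ce).
Qed.

Lemma trunc_sym e t : symmetric e -> symmetric (trunc (R := R) e t).
Proof. by move=> se x y; rewrite /trunc /= se; congr (_ && _); exact: andbC. Qed.

(** Keeping [T] as the ambient type, the vertices outside of the subset become
    isolated; this is why the degree condition is a disjunction. *)
Lemma min_degree_subgraph e t : symmetric e -> irreflexive e -> 0 <= t ->
  exists f, [/\ symmetric f, irreflexive f, subrel f e,
    forall z, t <= deg R f z \/ forall w, f w z = false &
    mass R e - 2 * t * #|T|%:R <= mass R f].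
Proof.
move=> se ie t0; have [U [Ut UE]] := min_degree_subset se ie t0.
exists [rel x y | [&& e x y, x \in U & y \in U]]; split.
- by move=> x y /=; rewrite se; congr (_ && _); exact: andbC.
- by move=> x /=; rewrite ie.
- by move=> x y /and3P[].
- move=> z; case zU : (z \in U); last by right => w /=; rewrite zU !andbF.
  left; apply: le_trans (Ut z zU) _; rewrite big_mkcond; apply: ler_sum => y _.
  by rewrite /adjk /= zU /=; case: (y \in U); rewrite ?andbT ?andbF.
apply: le_trans UE _; rewrite /mass big_mkcond; apply: ler_sum => x _.
case xU : (x \in U); last exact: deg_ge0.
rewrite big_mkcond; apply: ler_sum => y _.
by rewrite /adjk /= xU /=; case: (y \in U); rewrite ?andbT ?andbF.
Qed.

(** With [K = 8 * (2 * C + 3) / eps], truncation at degree [K * D] loses a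
    quarter of [eps * n * D], and so does the passage to minimum degree [eps /
    8 * D]. *)
Lemma regular_subgraph e (eps C D : R) : symmetric e -> irreflexive e ->
  0 < eps -> 0 <= C -> 1 <= D -> (0 < #|T|)%N -> #|T|%:R <= D ^+ 2 ->
  ncyc R e 4 <= C * D ^+ 4 -> eps * #|T|%:R * D <= mass R e ->
  exists f, [/\ symmetric f, irreflexive f, subrel f e &
    [/\ forall x, deg R f x <= 8 * (2 * C + 3) / eps * D,
    forall z, eps / 8 * D <= deg R f z \/ forall w, f w z = false &
    eps / 2 * #|T|%:R * D <= mass R f]].
Proof.
move=> se ie e0 C0 D1 n0 nD c4 me; set n := #|T|%:R in nD me *.
have n0' : 0 < n by rewrite /n ltr0n.
have D0 : 0 < D by lra.
have K0 : 0 < 2 * C + 3 by lra.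
set t := 8 * (2 * C + 3) / eps * D.
have t0 : 0 < t by rewrite /t; pos.
have h1 := trunc_loss se t0.
have h2 := sum_deg_sqr_le se ie n0' D1 nD C0 c4.
have h3 : 2 * (\sum_x deg R e x ^+ 2) / t <= eps / 4 * n * D.
  rewrite ler_pdivrMr // (_ : eps / 4 * n * D * t = 2 * ((2 * C + 3) * n * D ^+ 2)).
    by rewrite ler_wpM2l.
  by rewrite /t; field; rewrite gt_eqF.
have h4 : 0 <= eps / 8 * D by pos.
have tsym := @trunc_sym e t se.
have tirr : irreflexive (trunc (R := R) e t) by move=> x; rewrite /trunc /= ie.
have [f [fs fi ft fd fm]] := min_degree_subgraph tsym tirr h4.
exists f; split=> //; first by move=> x y /ft /and3P[].
split=> //.
  move=> x; apply: le_trans (trunc_deg e x (ltW t0)); apply: ler_sum => y _.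
  by rewrite /adjk ler_nat; case fxy : (f x y) => //; rewrite ft.
apply: le_trans fm; rewrite -/n {1}/mass /deg.
have -> : 2 * (eps / 8 * D) * n = eps / 4 * n * D by field.
set m1 := \sum_x _ in h1 *.
have : m1 >= mass R e - eps / 4 * n * D by lra.
have : eps / 2 * n * D + eps / 4 * n * D + eps / 4 * n * D = eps * n * D by field.
move: me; set u := mass R e.
lra.
Qed.

Lemma walks_lower e t k : 0 <= t ->
  (forall z, t <= deg R e z \/ forall w, e w z = false) ->
  t ^+ k * mass R e <= \sum_x \sum_y kpow (adjk R e) k.+1 x y.
Proof.
move=> t0 dg; elim: k => [|k IH].
  rewrite mul1r; apply: ler_sum => x _; apply: ler_sum => y _.
  by rewrite kpow1.
rewrite exprS -mulrA; apply: le_trans (ler_wpM2l t0 IH) _.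
rewrite mulr_sumr; apply: ler_sum => x _.
rewrite [leRHS](eq_bigr (fun y => \sum_z kpow (adjk R e) k.+1 x z * adjk R e z y)); last first.
  by move=> y _; rewrite kpowSr.
rewrite [leRHS]exchange_big mulr_sumr /=; apply: ler_sum => z _; rewrite -[leRHS]mulr_sumr.
case: (dg z) => hz; first by rewrite mulrC ler_wpM2l // kpow_ge0 // => u v; apply: ler0n.
rewrite kpowSr big1 ?mulr0 ?mul0r // => w _.
by rewrite /adjk hz mulr0.
Qed.

(** A closed walk of length [2k] is a pair of [k]-walks with the same ends;
    two applications of the Cauchy-Schwarz inequality compare the sum of
    squares with the square of the sum. *)
Lemma closed_even_lower e k b : symmetric e -> (0 < #|T|)%N -> 0 <= b ->
  b * #|T|%:R <= \sum_x \sum_y kpow (adjk R e) k x y ->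
  b ^+ 2 <= \sum_x kpow (adjk R e) (k + k) x x.
Proof.
move=> se n0 b0; set n : R := #|T|%:R; have n0' : 0 < n by rewrite /n ltr0n.
set S := \sum_x _ => hS.
have -> : \sum_x kpow (adjk R e) (k + k) x x = \sum_x \sum_y kpow (adjk R e) k x y ^+ 2.
  apply: eq_bigr => x _; rewrite kpowD; apply: eq_bigr => y _.
  by rewrite [X in _ * X]kpow_sym // => u v; rewrite /adjk se.
set Q := \sum_x _.
have h : S ^+ 2 <= n ^+ 2 * Q.
  apply: le_trans (sum_sqr_le _) _; rewrite expr2 -mulrA; apply: ler_wpM2l.
    exact: ltW.
  rewrite mulr_sumr; apply: ler_sum => x _; exact: sum_sqr_le.
have : (b * n) ^+ 2 <= n ^+ 2 * Q.
  by apply: le_trans h; rewrite lerXn2r // nnegrE; pos; apply: le_trans hS; pos.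
by rewrite exprMn mulrC ler_pM2l // exprn_gt0.
Qed.

Definition npath e k : R := sumseq k.+1 (fun s => (uniq s && sorted e s)%:R).

Lemma npath1 e : irreflexive e -> npath e 1 = mass R e.
Proof.
move=> ie; apply: eq_bigr => x _; apply: eq_bigr => y _ /=.
rewrite !in_cons !in_nil orbF !andbT /adjk; congr (_%:R); congr nat_of_bool.
by case exy : (e x y); rewrite ?andbF // andbT; apply: contraTneq exy => ->; rewrite ie.
Qed.

Lemma sum_mem_le (s : seq T) : \sum_x (x \in s)%:R <= (size s)%:R :> R.
Proof.
rewrite -natr_sum ler_nat; apply: leq_trans (card_size s).
rewrite -sum1_card [leqRHS]big_mkcond; apply: leq_sum => x _.
by case: (x \in s).
Qed.

(** A path is extended at its first vertex, which has at least [t] neighbours,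
    of which at most [k.+2] are already used. *)
Lemma npath_step e t k : symmetric e ->
  (forall z, t <= deg R e z \/ forall w, e w z = false) ->
  (t - k.+2%:R) * npath e k.+1 <= npath e k.+2.
Proof.
move=> se dg; pose F s : R := (uniq s && sorted e s)%:R.
have -> : npath e k.+2 = \sum_z sumseq k.+2 (fun p => F (z :: p)) by [].
rewrite -sumseq_sum /npath -sumseqZ.
apply: ler_sumseq => -[|y [|z s]] // sk.
case vE : (uniq [:: y, z & s] && sorted e [:: y, z & s]); last first.
  by rewrite mulr0; apply: sumr_ge0 => *; apply: ler0n.
rewrite mulr1.
have [hy|hy] := dg y; last first.
  by move: vE; rewrite /= [e y z]se hy !andbF.
apply: le_trans (_ : \sum_x (adjk R e y x - (x \in [:: y, z & s])%:R) <= _).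
  by rewrite sumrB lerB // (le_trans (sum_mem_le _)) // sk.
apply: ler_sum => x _; rewrite /F /adjk.
have -> : uniq [:: x, y, z & s] && sorted e [:: x, y, z & s] =
   (x \notin [:: y, z & s]) && e y x.
  case/andP: vE => h1 h2; rewrite cons_uniq h1 andbT se.
  by move: h2; rewrite /= => ->; rewrite andbT.
by case: (x \in _); case: (e y x); rewrite //= ?subrr ?subr0 // lerBlDr add0r ler01.
Qed.
End Subgraphs.

Section MainEven.
Variable R : realFieldType.

(** In a subgraph of minimum degree of order [D] every path extends greedily
    in order [D] ways, because [D] is large against the length. *)
Lemma many_paths j (eps : R) : 0 < eps ->
  exists D0 c : R, [/\ 0 < D0, 0 < c & forall (T : finType) (e : rel T) (D : R),
    symmetric e -> irreflexive e -> D0 <= D ->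
    eps * #|T|%:R * D <= mass R e -> c * #|T|%:R * D ^+ j.+1 <= npath R e j.+1].
Proof.
move=> e0; exists (8 * j.+2%:R / eps), (eps / 2 * (eps / 8) ^+ j); split.
- by pos.
- by pos.
move=> T e D se ie DD me.
have D0 : 0 < D by apply: lt_le_trans DD; pos.
have [f [fs fi fe fd fm]] := @min_degree_subgraph R T e (eps / 4 * D) se ie ltac:(pos).
have {fm} fm : eps / 2 * #|T|%:R * D <= mass R f.
  apply: le_trans fm; have -> : 2 * (eps / 4 * D) * #|T|%:R = eps / 2 * #|T|%:R * D by field.
  rewrite lerBrDr; apply: le_trans me.
  by rewrite le_eqVlt; apply/orP; left; apply/eqP; field.
have step i : (i <= j)%N -> eps / 2 * (eps / 8) ^+ i * #|T|%:R * D ^+ i.+1 <= npath R f i.+1.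
  elim: i => [|i IH] ij; first by rewrite expr1 mulr1 npath1.
  apply: le_trans (npath_step _ fs fd).
  apply: le_trans (_ : eps / 8 * D * npath R f i.+1 <= _); last first.
    apply: ler_wpM2r; first by apply: sumseq_ge0 => s _; apply: ler0n.
    rewrite lerBrDr -lerBrDl.
    have -> : eps / 4 * D - eps / 8 * D = D * eps / 8 by field.
    rewrite ler_pdivlMr // mulrC -ler_pdivrMr //; apply: le_trans DD.
    by rewrite ler_pM2r ?invr_gt0 // ler_pM2l // ler_nat; lia.
  have -> : eps / 2 * (eps / 8) ^+ i.+1 * #|T|%:R * D ^+ i.+2 =
     eps / 8 * D * (eps / 2 * (eps / 8) ^+ i * #|T|%:R * D ^+ i.+1).
    by rewrite !exprS; ring.
  by apply: ler_wpM2l; [pos | apply: IH; exact: ltnW].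
apply: le_trans (step j (leqnn j)) _.
apply: ler_sumseq => s _; rewrite ler_nat.
case: (uniq s) => //=; case: (boolP (sorted f s)) => //= cf.
by rewrite (sub_sorted fe cf).
Qed.

(** Walks give the lower bound of order [D^(2q+6)] for closed walks of length
    [2q+6], and the closed walks with repetitions are negligible; the length
    is at least six, hence above five. *)
Lemma many_even_cycles q (eps C : R) : 0 < eps -> 0 < C ->
  exists D0 c : R, [/\ 0 < D0, 0 < c & forall (T : finType) (e : rel T) (D : R),
    symmetric e -> irreflexive e -> D0 <= D -> (0 < #|T|)%N -> #|T|%:R <= D ^+ 2 ->
    ncyc R e 4 <= C * D ^+ 4 ->
    eps * #|T|%:R * D <= mass R e -> c * D ^+ (2 * q.+3) <= ncyc R e (2 * q.+3)].
Proof.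
move=> e0 C0.
pose K := 8 * (2 * C + 3) / eps; have K0 : 0 < K by rewrite /K; pos.
pose b := (eps / 8) ^+ q.+2 * (eps / 2); have b0 : 0 < b by rewrite /b; pos.
pose C2 := 2 * C + 1 + K ^+ 2; have C20 : 0 < C2 by rewrite /C2; pos.
have hb : 0 < b ^+ 2 / 2 by pos.
have [D0 D00 deg_few] := @few_degenerate_closed_walks R (2 * q + 1) K C2 (b ^+ 2 / 2) K0 C20 hb.
exists (D0 + 1), (b ^+ 2 / 2); split=> //; first by pos.
move=> T e D se ie DD n0 nD c4 me.
have D1 : 1 <= D by lra.
have DD0 : 0 < D by lra.
have [f [fs fi fe [frow fd fm]]] := regular_subgraph se ie e0 (ltW C0) D1 n0 nD c4 me.
have f4 : ncyc R f 4 <= C * D ^+ 4 by apply: le_trans c4; exact: ncyc_sub.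
have fQ : \sum_x \sum_y kpow (adjk R f) 2 x y ^+ 2 <= C2 * D ^+ 4.
  apply: le_trans (codeg_all fs fi frow _) _; first by rewrite -/K; pos.
  have h1 : (#|T|%:R : R) ^+ 2 <= D ^+ 4.
    by rewrite (_ : 4 = 2 * 2)%N // exprM lerXn2r ?nnegrE; pos.
  have h2 : #|T|%:R * (K * D) ^+ 2 <= K ^+ 2 * D ^+ 4.
    have -> : K ^+ 2 * D ^+ 4 = D ^+ 2 * (K * D) ^+ 2 by ring.
    by apply: ler_wpM2r => //; pos.
  rewrite -/K /C2; lra.
have := deg_few T f D fs fi ltac:(lra) nD frow fQ.
have -> : (2 * q + 1 + 5 = 2 * q.+3)%N by clear; lia.
set m := (2 * q.+3)%N => h1.
have h2 : b ^+ 2 * D ^+ m <= sumseq m (fun s => (cycle f s)%:R).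
  have -> : m = (2 * q.+2 + 1).+1 by rewrite /m; clear; lia.
  rewrite closed_walks.
  have -> : (2 * q.+2 + 1).+1 = (q.+3 + q.+3)%N by clear; lia.
  rewrite addnn -muln2 exprM -exprMn muln2 -addnn.
  apply: closed_even_lower => //; first by pos.
  apply: le_trans (walks_lower (t := eps / 8 * D) _ _ fd); last by pos.
  have -> : b * D ^+ q.+3 * #|T|%:R = (eps / 8 * D) ^+ q.+2 * (eps / 2 * #|T|%:R * D).
    by rewrite /b [(eps / 8 * D) ^+ _]exprMn [D ^+ q.+3]exprS; ring.
  by apply: ler_wpM2l fm; pos.
have := @ncyc_sub R T f e m fe; lra.
Qed.
End MainEven.

(** * Energy and regular partitions *)

Section Rect.
Variables (R : realFieldType) (T : finType).
Implicit Types (k : T -> T -> R) (X Y : {set T}).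

Definition rect k X Y : R := \sum_(x in X) \sum_(y in Y) k x y.

Lemma rect_ge0 k X Y : (forall x y, 0 <= k x y) -> 0 <= rect k X Y.
Proof. by move=> k0; apply: sumr_ge0 => x _; apply: sumr_ge0. Qed.

Lemma rectE k X Y : rect k X Y = \sum_x \sum_y (x \in X)%:R * (y \in Y)%:R * k x y.
Proof.
rewrite /rect big_mkcond; apply: eq_bigr => x _.
case: (x \in X); last by rewrite big1 // => y _; rewrite !mul0r.
by rewrite big_mkcond; apply: eq_bigr => y _; case: (y \in Y); rewrite ?mul1r ?mulr0 ?mul0r.
Qed.

Lemma rect_sub k X Y X' Y' : (forall x y, 0 <= k x y) ->
  X \subset X' -> Y \subset Y' -> rect k X Y <= rect k X' Y'.
Proof.
move=> k0 /subsetP sX /subsetP sY; rewrite !rectE; apply: ler_sum => x _.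
apply: ler_sum => y _; apply: ler_wpM2r => //; rewrite -!natrM ler_nat !mulnb.
case xX : (x \in X) => //=; case yY : (y \in Y) => //.
by rewrite sX ?sY.
Qed.

Lemma rectD k l X Y : rect (fun x y => k x y + l x y) X Y = rect k X Y + rect l X Y.
Proof.
rewrite /rect -big_split /=; apply: eq_bigr => x _; exact: big_split.
Qed.

Lemma rectZ c k X Y : rect (fun x y => c * k x y) X Y = c * rect k X Y.
Proof.
rewrite /rect mulr_sumr; apply: eq_bigr => x _; by rewrite mulr_sumr.
Qed.

Lemma rectB k l X Y : rect (fun x y => k x y - l x y) X Y = rect k X Y - rect l X Y.
Proof.
rewrite /rect -sumrB; apply: eq_bigr => x _; exact: sumrB.
Qed.

Lemma eq_rect k l X Y : (forall x y, x \in X -> y \in Y -> k x y = l x y) ->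
  rect k X Y = rect l X Y.
Proof.
by move=> kl; apply: eq_bigr => x xX; apply: eq_bigr => y yY; apply: kl.
Qed.

Lemma ler_rect k l X Y : (forall x y, x \in X -> y \in Y -> k x y <= l x y) ->
  rect k X Y <= rect l X Y.
Proof.
by move=> kl; apply: ler_sum => x xX; apply: ler_sum => y yY; apply: kl.
Qed.

Definition fib (S : finType) (f : T -> S) s : {set T} := [set x | f x == s].

Lemma sum_cells (S : finType) (f : T -> S) k :
  \sum_x \sum_y k x y = \sum_s \sum_t rect k (fib f s) (fib f t).
Proof.
rewrite (partition_big f xpredT) //=; apply: eq_bigr => s _.
transitivity (\sum_(x | f x == s) \sum_t \sum_(y | f y == t) k x y).
  by apply: eq_bigr => x _; rewrite (partition_big f xpredT).
rewrite exchange_big /=; apply: eq_bigr => t _; apply: eq_big => [x|x _]; first by rewrite inE.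
by apply: eq_bigl => y; rewrite inE.
Qed.

End Rect.

Section Energy.
Variables (R : realFieldType) (T : finType) (v a : T -> T -> R).
Hypothesis v_ge0 : forall x y, 0 <= v x y.
Hypothesis a_ge0 : forall x y, 0 <= a x y.
Hypothesis v_null : forall x y, v x y = 0 -> a x y = 0.
Let w x y := v x y + a x y.

Lemma rect_null X Y : rect v X Y = 0 -> rect a X Y = 0.
Proof.
move=> /eqP; rewrite psumr_eq0 => [/allP h|x _]; last exact: sumr_ge0.
apply: big1 => x xX; have := h x (mem_index_enum x); rewrite xX implyTb.
rewrite psumr_eq0 // => /allP h'; apply: big1 => y yY; apply: v_null.
by have := h' y (mem_index_enum y); rewrite yY implyTb => /eqP.
Qed.

(** For a fixed [f] this is a concave quadratic functional of [c].  Its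
    maximum is the sum over the cells of [v^2 / (v + a)], that is, the average
    of the convex and bounded function [1 / (1 + x)] of the cell densities.
    Boundedness is what allows densities without an upper bound, and the
    variational form makes the growth under refinement a computation with test
    functions. *)
Definition energy (S : finType) (f : T -> S) (c : S -> S -> R) : R :=
  \sum_x \sum_y (2 * c (f x) (f y) * v x y - c (f x) (f y) ^+ 2 * w x y).

Definition cdens (S : finType) (f : T -> S) s t : R :=
  rect a (fib f s) (fib f t) / rect v (fib f s) (fib f t).

(** The maximizer of the energy for a given partition. *)
Definition copt (S : finType) (f : T -> S) s t : R := (1 + cdens f s t)^-1.

Lemma cdens_ge0 (S : finType) (f : T -> S) s t : 0 <= cdens f s t.
Proof. by apply: divr_ge0; apply: rect_ge0. Qed.

Lemma cdensE (S : finType) (f : T -> S) s t :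
  rect a (fib f s) (fib f t) = cdens f s t * rect v (fib f s) (fib f t).
Proof.
rewrite /cdens; have [v0|v0] := eqVneq (rect v (fib f s) (fib f t)) 0.
  by rewrite v0 mulr0 rect_null.
by rewrite divfK.
Qed.

Lemma energyE (S : finType) (f : T -> S) c : energy f c = \sum_s \sum_t
  (2 * c s t * rect v (fib f s) (fib f t) - c s t ^+ 2 * rect w (fib f s) (fib f t)).
Proof.
rewrite /energy (sum_cells f); apply: eq_bigr => s _; apply: eq_bigr => t _.
rewrite -mulNr -!rectZ -rectD; apply: eq_rect => x y.
by rewrite !inE => /eqP -> /eqP ->; rewrite mulNr.
Qed.

(** On each cell the difference is a square: it vanishes where [c] is the
    maximizer. *)
Lemma energy_opt (S : finType) (f : T -> S) c : energy f c <= energy f (copt f).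
Proof.
rewrite !energyE; apply: ler_sum => s _; apply: ler_sum => t _.
rewrite /w rectD cdensE /copt.
have := cdens_ge0 f s t; set x := cdens f s t => x0.
have : 0 <= rect v (fib f s) (fib f t) by apply: rect_ge0.
set l := rect v _ _ => l0; set d := c s t.
have x1 : 0 < 1 + x by lra.
have -> : 2 * (1 + x)^-1 * l - (1 + x)^-1 ^+ 2 * (l + x * l) =
  (2 * d * l - d ^+ 2 * (l + x * l)) + l * (1 + x) * (d - (1 + x)^-1) ^+ 2.
  by field; rewrite gt_eqF.
by rewrite lerDl; apply: mulr_ge0; [apply: mulr_ge0 => //; lra | exact: sqr_ge0].
Qed.

Lemma energy_le (S : finType) (f : T -> S) c : energy f c <= \sum_x \sum_y v x y.
Proof.
apply: ler_sum => x _; apply: ler_sum => y _; set d := c _ _.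
have := a_ge0 x y; have := v_ge0 x y; rewrite /w => v0 a0.
have : 0 <= d ^+ 2 * a x y by apply: mulr_ge0 => //; exact: sqr_ge0.
have : 0 <= (d - 1) ^+ 2 * v x y by apply: mulr_ge0 => //; exact: sqr_ge0.
lra.
Qed.

(** How much the mass of a subrectangle falls short of what the density of the
    cell, truncated at [B], predicts. *)
Definition deficit (B : R) (S : finType) (f : T -> S) s t X Y : R :=
  Num.max 0 (Num.min (cdens f s t) B * rect v (fib f s :&: X) (fib f t :&: Y)
             - rect a (fib f s :&: X) (fib f t :&: Y)).

(** The new label of a point records the old one and, for every [t], whether
    the point lies in the sets attached to the cells [(s, t)] and [(t, s)].
    The indicator functions of all the chosen subrectangles are then
    measurable with respect to the new labels. *)
Definition refine (S : finType) (f : T -> S) (U W : S -> S -> {set T}) x :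
  (S * {ffun S -> bool * bool})%type :=
  (f x, [ffun t => (x \in U (f x) t, x \in W t (f x))]).

(** The maximizer for [f] is perturbed by [theta] times the indicator of the
    subrectangles with a positive deficit.  The first-order term is at least
    the total deficit divided by [1 + B], since [(x * v - a) / (1 + x)]
    increases with [x]; the second-order term is at most [theta^2 * (1 + B)]
    times the total volume, since the mass of a deficient subrectangle is at
    most [B] times its volume. *)
Lemma energy_gain (B theta : R) (S : finType) (f : T -> S) U W :
  0 <= B -> 0 <= theta -> exists c,
  energy f (copt f) + 2 * theta / (1 + B) * (\sum_s \sum_t deficit B f s t (U s t) (W s t))
  - theta ^+ 2 * (1 + B) * (\sum_x \sum_y v x y) <= energy (refine f U W) c.
Proof.
move=> B0 th0.
pose P s t := rect a (fib f s :&: U s t) (fib f t :&: W s t) <=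
  Num.min (cdens f s t) B * rect v (fib f s :&: U s t) (fib f t :&: W s t).
pose g (p q : S * {ffun S -> bool * bool}) : R :=
  [&& P p.1 q.1, (p.2 q.1).1 & (q.2 p.1).2]%:R.
exists (fun p q => copt f p.1 q.1 + theta * g p q).
pose G x y : R := [&& P (f x) (f y), x \in U (f x) (f y) & y \in W (f x) (f y)]%:R.
have gE x y : g (refine f U W x) (refine f U W y) = G x y.
  by rewrite /g /G /refine /= !ffunE.
have GG x y : G x y ^+ 2 = G x y by rewrite /G expr2 -natrM mulnb andbb.
pose h x y := copt f (f x) (f y).
have -> : energy (refine f U W) (fun p q => copt f p.1 q.1 + theta * g p q) =
  energy f (copt f) + 2 * theta * (\sum_x \sum_y G x y * (v x y - h x y * w x y))
   - theta ^+ 2 * (\sum_x \sum_y G x y * w x y).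
  rewrite /energy !mulr_sumr -sumrN -!big_split /=; apply: eq_bigr => x _.
  rewrite !mulr_sumr -sumrN -!big_split /=; apply: eq_bigr => y _.
  rewrite gE -/(h x y).
  have -> : (h x y + theta * G x y) ^+ 2 =
    h x y ^+ 2 + 2 * theta * (h x y * G x y) + theta ^+ 2 * G x y.
    by rewrite -{3}(GG x y); ring.
  ring.
rewrite -!addrA lerD2l.
have cellE k : \sum_x \sum_y G x y * k x y =
   \sum_s \sum_t (P s t)%:R * rect k (fib f s :&: U s t) (fib f t :&: W s t).
  rewrite (sum_cells f); apply: eq_bigr => s _; apply: eq_bigr => t _.
  rewrite [in LHS]rectE [in RHS]rectE mulr_sumr; apply: eq_bigr => x _.
  rewrite mulr_sumr; apply: eq_bigr => y _; rewrite !in_setI ![_ \in fib _ _]inE.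
  case: eqP => [fx|_] /=; last by rewrite !mul0r mulr0.
  case: eqP => [fy|_] /=; last by rewrite !(mulr0, mul0r).
  rewrite !mul1r /G fx fy; case: (P s t) => /=; rewrite ?mul0r ?mul1r //.
  by rewrite -natrM mulnb.
apply: lerD.
  rewrite -[leLHS]mulrA; apply: ler_wpM2l; first by pos.
  rewrite cellE mulr_sumr; apply: ler_sum => s _.
  rewrite mulr_sumr; apply: ler_sum => t _.
  rewrite /deficit; set X := fib f s :&: _; set Y := fib f t :&: _.
  have -> : rect (fun x y => v x y - h x y * w x y) X Y = 
     rect v X Y - copt f s t * (rect v X Y + rect a X Y).
    rewrite -mulNr -/(rect w X Y) -rectD -rectZ -rectD; apply: eq_rect => x y.
    by rewrite !inE => /andP[/eqP fx _] /andP[/eqP fy _]; rewrite /h fx fy mulNr.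
  rewrite /P -/X -/Y /copt; have := cdens_ge0 f s t; set x := cdens f s t => x0.
  have l0 : 0 <= rect v X Y by apply: rect_ge0.
  have m0 : 0 <= rect a X Y by apply: rect_ge0.
  set l := rect v X Y in l0 *; set m := rect a X Y in m0 *.
  have [hm|hm] := lerP m (Num.min x B * l); last by rewrite max_l ?mulr0 ?mul0r //; lra.
  rewrite max_r; last by lra.
  rewrite mul1r.
  have x1 : 0 < 1 + x by lra.
  have B1 : 0 < 1 + B by lra.
  have -> : l - (1 + x)^-1 * (l + m) = (1 + x)^-1 * (x * l - m).
    by field; rewrite gt_eqF.
  rewrite ler_pdivrMl // mulrCA ler_pdivlMl // -subr_ge0.
  have [xB|Bx] := leP x B.
    rewrite min_l // in hm *.
    have -> : (1 + B) * (x * l - m) - (1 + x) * (x * l - m) = (B - x) * (x * l - m) by ring.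
    by apply: mulr_ge0; lra.
  rewrite min_r ?(ltW Bx) // in hm *.
  have -> : (1 + B) * (x * l - m) - (1 + x) * (B * l - m) = (x - B) * (l + m) by ring.
  by apply: mulr_ge0; lra.
rewrite lerNl opprK -mulrA; apply: ler_wpM2l; first exact: sqr_ge0.
rewrite cellE (sum_cells f) mulr_sumr; apply: ler_sum => s _.
rewrite mulr_sumr; apply: ler_sum => t _.
have v0 X Y : 0 <= rect v X Y by apply: rect_ge0.
have a0 X Y : 0 <= rect a X Y by apply: rect_ge0.
case: (boolP (P s t)) => hP; last by rewrite mul0r; apply: mulr_ge0 => //; lra.
rewrite mul1r; apply: le_trans (_ : (1 + B) * rect v (fib f s :&: U s t) (fib f t :&: W s t) <= _).
  rewrite /w rectD mulrDl mul1r lerD2l; apply: le_trans hP _.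
  by apply: ler_wpM2r => //; rewrite ge_min lexx orbT.
apply: ler_wpM2l; first by lra.
by apply: rect_sub => //; exact: subsetIl.
Qed.

End Energy.

Section Regularity.
Variables (R : archiRealFieldType).

(** The growth of the number of labels under iterated refinement. *)
Fixpoint tower (i : nat) : nat := if i is j.+1 then (tower j * 4 ^ tower j)%N else 1.

(** One subrectangle may be chosen in every cell.  With the same [U] and [W]
    in all cells this is a one-sided cut-norm approximation; with different
    ones it says that almost all cells are regular from below. *)
Definition cell_regular (B gamma N2 : R) (T : finType) (v a : T -> T -> R)
    (S : finType) (f : T -> S) := forall U W : S -> S -> {set T},
  \sum_s \sum_t deficit v a B f s t (U s t) (W s t) <= gamma * N2.

(** An irregular partition can be refined with an energy gain bounded below,
    while the energy never exceeds the total volume. *)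
Lemma regularity (B gamma : R) : 0 <= B -> 0 < gamma ->
  exists M : nat, forall (T : finType) (v a : T -> T -> R) (N2 : R),
    (forall x y, 0 <= v x y) -> (forall x y, 0 <= a x y) ->
    (forall x y, v x y = 0 -> a x y = 0) -> 0 < N2 -> \sum_x \sum_y v x y <= N2 ->
  exists (S : finType) (f : T -> S), (#|S| <= M)%N /\ cell_regular B gamma N2 v a f.
Proof.
move=> B0 g0.
pose gain := gamma ^+ 2 / (1 + B) ^+ 3.
have B1 : 0 < 1 + B by lra.
have gain0 : 0 < gain by rewrite /gain; pos.
exists (tower (Num.bound gain^-1)) => T v a N2 v0 a0 vn N0 vN.
set I := Num.bound _.
have gI : 1 < I%:R * gain.
  by rewrite -ltr_pdivrMr // div1r; apply: archi_boundP; pos.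
suff [//|[S [f [c [_ hc]]]]] : (exists (S : finType) (f : T -> S), (#|S| <= tower I)%N /\
    cell_regular B gamma N2 v a f) \/
  (exists (S : finType) (f : T -> S) c, (#|S| <= tower I)%N /\
    I%:R * gain * N2 <= energy v a f c).
  have := le_trans hc (le_trans (energy_le v0 a0 f c) vN).
  by rewrite -[leRHS]mul1r ler_pM2r // leNgt gI.
have tower_mono i : (tower i <= tower i.+1)%N by rewrite /= leq_pmulr // expn_gt0.
elim: I {gI} => [|i [[S [f [Sf reg]]]|[S [f [c [Sf hc]]]]]].
- right; exists unit, (fun=> tt), (fun _ _ => 0); split; first by rewrite card_unit.
  rewrite !mul0r; apply: sumr_ge0 => x _; apply: sumr_ge0 => y _.
  by rewrite mulr0 mul0r expr0n /= mul0r subrr.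
- by left; exists S, f; split => //; apply: leq_trans (tower_mono i).
pose X := {ffun S * S -> {set T}}.
pose bad (U W : X) := gamma * N2 <
   \sum_s \sum_t deficit v a B f s t (U (s, t)) (W (s, t)).
case: (boolP [exists U : X, exists W : X, bad U W]); last first.
  rewrite negb_exists => /forallP hU; left; exists S, f; split.
    exact: leq_trans (tower_mono i).
  move=> U W; have := hU [ffun p => U p.1 p.2]; rewrite negb_exists.
  move=> /forallP /(_ [ffun p => W p.1 p.2]); rewrite /bad -leNgt.
  under eq_bigr => s _ do under eq_bigr => t _ do rewrite !ffunE.
  by [].
case/existsP => U /existsP[W]; rewrite /bad => bUW; right.
pose theta := gamma / (1 + B) ^+ 2.
have th0 : 0 < theta by rewrite /theta; pos.
have [c' hc'] := energy_gain v0 a0 f (fun s t => U (s, t)) (fun s t => W (s, t))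
  B0 (ltW th0).
exists (S * {ffun S -> bool * bool})%type, (refine f (fun s t => U (s, t)) (fun s t => W (s, t))), c'.
split.
  rewrite card_prod card_ffun card_prod card_bool /=.
  apply: leq_mul => //; exact: leq_pexp2l.
apply: le_trans hc'.
set Delta := \sum_s \sum_t _ in bUW *; set V := \sum_x \sum_y v x y in vN *.
have h1 := le_trans hc (energy_opt v0 a0 vn f c).
have h2 : 2 * theta / (1 + B) * (gamma * N2) <= 2 * theta / (1 + B) * Delta.
  by apply: ler_wpM2l; [pos | exact: ltW].
have h3 : theta ^+ 2 * (1 + B) * V <= theta ^+ 2 * (1 + B) * N2.
  by apply: ler_wpM2l => //; pos.
have h4 : 2 * theta / (1 + B) * (gamma * N2) = 2 * (gain * N2).
  by rewrite /theta /gain; field; rewrite gt_eqF.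
have h5 : theta ^+ 2 * (1 + B) * N2 = gain * N2.
  by rewrite /theta /gain; field; rewrite gt_eqF.
rewrite -natr1 mulrDl mul1r mulrDl; lra.
Qed.

End Regularity.

(** * Dense removal of odd closed walks *)

Section DenseRegularPairs.
Variables (R : realFieldType) (S Q : finType) (mu : S -> R) (h : rel S) (q : S -> Q).
Variables (b tau N : R).
Hypothesis mu_ge0 : forall s, 0 <= mu s.
Hypothesis h_sym : symmetric h.
Hypothesis b_gt0 : 0 < b.
Hypothesis b_le : b <= 4^-1.
Hypothesis tau_gt0 : 0 < tau.
Hypothesis N_gt0 : 0 < N.

Lemma b_compl : b <= 1 - b. Proof. move: b_gt0 b_le; lra. Qed.

Definition wt (X : {set S}) : R := \sum_(s in X) mu s.
Definition wvol (s t : S) : R := mu s * mu t.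
Definition wadj (s t : S) : R := (h s t)%:R * (mu s * mu t).
Definition wker (s t : S) : R := (h s t)%:R * mu t.

Lemma wt_ge0 X : 0 <= wt X. Proof. exact: sumr_ge0. Qed.

Lemma wt_sub (X Y : {set S}) : X \subset Y -> wt X <= wt Y.
Proof.
move=> /subsetP XY; rewrite /wt big_mkcond [leRHS]big_mkcond; apply: ler_sum => s _.
by case sX : (s \in X); [rewrite XY | case: (s \in Y)].
Qed.

Lemma rect_wvol (X Y : {set S}) : rect wvol X Y = wt X * wt Y.
Proof. by rewrite /rect /wt mulr_suml; apply: eq_bigr => s _; rewrite mulr_sumr. Qed.

(** Only a lack of edges counts as irregular, because closed walks are only
    bounded from below. *)
Definition irregular i j : bool := [exists X : {set S}, exists Y : {set S},
  [&& X \subset fib q i, Y \subset fib q j, b * wt (fib q i) <= wt X,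
      b * wt (fib q j) <= wt Y & rect wadj X Y <= b * (wt X * wt Y)]].

Definition good_pair i j : bool := [&& ~~ irregular i j, ~~ irregular j i,
  tau * N <= wt (fib q i) & tau * N <= wt (fib q j)].

Lemma good_sym : symmetric good_pair.
Proof.
by move=> i j; apply/and4P/and4P => -[? ? ? ?]; split.
Qed.

Definition nbr (X : {set S}) (j : Q) : {set S} :=
  [set t in fib q j | b * wt X <= \sum_(s in X) (h s t)%:R * mu s].

(** The points of the part outside of [nbr X j] would span too few edges with
    [X]; if they had weight above [b] they would witness irregularity. *)
Lemma good_nbr i j (X : {set S}) : good_pair i j -> X \subset fib q i ->
  b * wt (fib q i) <= wt X -> (1 - b) * wt (fib q j) <= wt (nbr X j).
Proof.
case/and4P=> irr _ _ _ Xi bX; rewrite leNgt; apply/negP => lt.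
case/negP: irr; apply/existsP; exists X; apply/existsP; exists (fib q j :\: nbr X j).
have Wsplit : wt (fib q j) = wt (nbr X j) + wt (fib q j :\: nbr X j).
  rewrite /wt (big_setID (nbr X j)) /=; congr (_ + _); apply: eq_bigl => s.
  by rewrite !inE andbA andbb.
rewrite Xi bX subsetDl /=; apply/andP; split.
  by rewrite Wsplit in lt *; lra.
rewrite /rect exchange_big /= mulrA {2}/wt mulr_sumr; apply: ler_sum => t.
rewrite !inE negb_and => /andP[/orP[/negP//|ht] _]. 
rewrite (eq_bigr (fun s => (h s t)%:R * mu s * mu t)); last by move=> s _; rewrite /wadj mulrA.
by rewrite -mulr_suml; apply: ler_wpM2r => //; rewrite leNgt; apply: contra ht => /ltW.
Qed.

(** Along good pairs, the set of points reached by many walks always fills at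
    least a fraction [b] of the current part, so the next good pair can be
    used. *)
Lemma path_walks w k (kap : R) i p (X : {set S}) : path good_pair i p -> 0 <= kap ->
  X \subset fib q i -> b * wt (fib q i) <= wt X ->
  (forall s, s \in X -> kap * mu s <= kpow wker k w s) ->
  exists X' : {set S}, [/\ X' \subset fib q (last i p), b * wt (fib q (last i p)) <= wt X' &
    forall s, s \in X' -> kap * (b ^+ 2 * tau * N) ^+ size p * mu s <= kpow wker (k + size p) w s].
Proof.
elim: p i k kap X => [|j p IH] i k kap X /=.
  by move=> _ kap0 Xi bX hX; exists X; rewrite addn0; split => // s sX; rewrite mulr1 hX.
case/andP=> gij pp kap0 Xi bX hX.
have := good_nbr gij Xi bX => hn.
have sub : nbr X j \subset fib q j by apply/subsetP => s; rewrite inE => /andP[].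
have bn : b * wt (fib q j) <= wt (nbr X j).
  by apply: le_trans hn; apply: ler_wpM2r; [exact: wt_ge0 | exact: b_compl].
case/and4P: gij => _ _ ti _.
have K0 u v : 0 <= wker u v by apply: mulr_ge0 => //; apply: ler0n.
have := IH j k.+1 (kap * (b ^+ 2 * tau * N)) _ pp _ sub bn.
case=> [|t|X' [X'1 X'2 X'3]].
- by pos.
- rewrite inE => /andP[_ ht]; rewrite kpowSr.
  apply: le_trans (_ : \sum_(s in X) kap * mu s * ((h s t)%:R * mu t) <= _); last first.
    rewrite big_mkcond; apply: ler_sum => s _; case sX : (s \in X).
      by apply: ler_wpM2r; [exact: K0 | exact: hX].
    by apply: mulr_ge0 => //; exact: kpow_ge0.
  rewrite (eq_bigr (fun s => kap * ((h s t)%:R * mu s) * mu t)); last by move=> s _; ring.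
  rewrite -mulr_suml -mulr_sumr; apply: ler_wpM2r => //; apply: ler_wpM2l => //.
  apply: le_trans ht; have -> : b ^+ 2 * tau * N = b * (b * (tau * N)) by ring.
  apply: ler_wpM2l; first exact: ltW.
  by apply: le_trans bX; apply: ler_wpM2l => //; exact: ltW.
- exists X'; split => // s sX'; rewrite addnS exprS mulrA; exact: X'3.
Qed.

Lemma good_rect i j (X Y : {set S}) : good_pair i j -> X \subset fib q i -> Y \subset fib q j ->
  b * wt (fib q i) <= wt X -> b * wt (fib q j) <= wt Y ->
  b * (wt X * wt Y) <= rect wadj X Y.
Proof.
case/and4P=> irr _ _ _ Xi Yj bX bY; rewrite leNgt; apply: contra irr => lt.
by apply/existsP; exists X; apply/existsP; exists Y; rewrite Xi Yj bX bY ltW.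
Qed.

(** Starting from a typical point [w] of the part [i], one follows the parts
    from [j] onwards as far as the last but one; lower regularity between the
    set reached and the neighbours of [w] in the last part closes the walk. *)
Lemma cycle_walks i j p l : cycle good_pair (i :: j :: rcons p l) ->
  (b ^+ 2 * tau * N) ^+ size p * (b ^+ 3 * tau ^+ 3 / 2 * N ^+ 3) <=
  \sum_w kpow wker (size p).+3 w w.
Proof.
rewrite /= !rcons_path last_rcons => /and3P[gij /andP[gp gl] gli].
have K0 u v : 0 <= wker u v by apply: mulr_ge0 => //; apply: ler0n.
have h1 := @good_nbr j i (fib q j).
have h2 := @good_nbr l i (fib q l) gli.
have bw (X : {set S}) : b * wt X <= wt X.
  by rewrite ler_piMl ?wt_ge0 //; move: b_gt0 b_le; lra.
have {}h1 : (1 - b) * wt (fib q i) <= wt (nbr (fib q j) i).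
  by apply: h1 => //; rewrite good_sym.
have {}h2 : (1 - b) * wt (fib q i) <= wt (nbr (fib q l) i) by apply: h2.
set W1 := nbr _ i in h1; set W2 := nbr _ i in h2.
have W1i : W1 \subset fib q i by apply/subsetP => s; rewrite inE => /andP[].
have W2i : W2 \subset fib q i by apply/subsetP => s; rewrite inE => /andP[].
have ti : tau * N <= wt (fib q i) by case/and4P: gij.
have tj : tau * N <= wt (fib q j) by case/and4P: gij.
have tl : tau * N <= wt (fib q l) by case/and4P: gli.
have hW : tau * N / 2 <= wt (W1 :&: W2).
  have E1 : wt W1 = wt (W1 :&: W2) + wt (W1 :\: W2) by rewrite /wt (big_setID W2).
  have E2 : wt (fib q i) = wt W2 + wt (fib q i :\: W2).
    by rewrite /wt (big_setID W2) /= (setIidPr W2i).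
  have E3 : wt (W1 :\: W2) <= wt (fib q i :\: W2) by apply: wt_sub; exact: setSD.
  have E5 := b_gt0; have E6 := b_le.
  have E4 : b * wt (fib q i) <= 4^-1 * wt (fib q i) by apply: ler_wpM2r => //; exact: wt_ge0.
  lra.
have main w : w \in W1 :&: W2 -> (b ^+ 2 * tau * N) ^+ size p * (b ^+ 3 * (tau * N) ^+ 2) * mu w
   <= kpow wker (size p).+3 w w.
  rewrite !inE => /andP[/andP[_ wj] /andP[_ wl]].
  pose X1 : {set S} := [set s in fib q j | h w s]; pose Z : {set S} := [set t in fib q l | h t w].
  have X1j : X1 \subset fib q j by apply/subsetP => s; rewrite inE => /andP[].
  have Zl : Z \subset fib q l by apply/subsetP => s; rewrite inE => /andP[].
  have X1w : b * wt (fib q j) <= wt X1.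
    apply: le_trans wj _; rewrite /wt big_mkcond [leRHS]big_mkcond; apply: ler_sum => s _.
    rewrite [s \in X1]inE; case: (s \in _) => //=; rewrite h_sym.
    by case: (h w s); rewrite ?mul1r ?mul0r.
  have Zw : b * wt (fib q l) <= wt Z.
    apply: le_trans wl _; rewrite /wt big_mkcond [leRHS]big_mkcond; apply: ler_sum => s _.
    rewrite [s \in Z]inE; case: (s \in _) => //=.
    by case: (h s w); rewrite ?mul1r ?mul0r.
  have base s : s \in X1 -> 1 * mu s <= kpow wker 1 w s.
    by rewrite inE kpow1 /wker => /andP[_ ->].
  have [X' [X'1 X'2 X'3]] := path_walks gp ler01 X1j X1w base.
  set kap := (b ^+ 2 * tau * N) ^+ size p; have kap0 : 0 <= kap by rewrite /kap; pos.
  have tm : tau * N <= wt (fib q (last j p)) by case/and4P: gl.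
  have rc := good_rect gl X'1 Zl X'2 Zw.
  apply: le_trans (_ : kap * rect wadj X' Z * mu w <= _).
    apply: ler_wpM2r => //; apply: ler_wpM2l => //; apply: le_trans rc.
    have -> : b ^+ 3 * (tau * N) ^+ 2 = b * ((b * (tau * N)) * (b * (tau * N))) by ring.
    apply: ler_wpM2l; first exact: ltW.
    apply: ler_pM; try by pos.
      by apply: le_trans X'2; apply: ler_wpM2l => //; exact: ltW.
    by apply: le_trans Zw; apply: ler_wpM2l => //; exact: ltW.
  rewrite (_ : (size p).+3 = (1 + size p) + 2)%N; last by rewrite addn2 add1n.
  rewrite kpowD /rect mulr_sumr mulr_suml big_mkcond; apply: ler_sum => s _.
  case sX : (s \in X'); last by apply: mulr_ge0; exact: kpow_ge0.
  have hs := X'3 _ sX; rewrite mul1r in hs.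
  apply: le_trans (_ : kap * mu s * kpow wker 2 s w <= _); last first.
    by apply: ler_wpM2r => //; exact: kpow_ge0.
  rewrite -!mulrA; apply: ler_wpM2l => //.
  rewrite mulr_suml kpowS mulr_sumr big_mkcond; apply: ler_sum => t _.
  rewrite inE kpow1 /wadj /wker; case: (t \in _) => /=; last by do ?[apply: mulr_ge0 | exact: ler0n | exact: mu_ge0].
  case: (h t w); last by do ?[apply: mulr_ge0 | exact: ler0n | exact: mu_ge0].
  by rewrite mul1r le_eqVlt; apply/orP; left; apply/eqP; ring.
apply: le_trans (_ : \sum_(w in W1 :&: W2) kpow wker (size p).+3 w w <= _); last first.
  rewrite big_mkcond; apply: ler_sum => w _; case: (w \in _) => //; exact: kpow_ge0.
apply: le_trans (ler_sum _ main); rewrite -mulr_sumr -/(wt _) -[leRHS]mulrA.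
apply: ler_wpM2l; first by pos.
have -> : b ^+ 3 * tau ^+ 3 / 2 * N ^+ 3 = b ^+ 3 * (tau * N) ^+ 2 * (tau * N / 2) by field.
by apply: ler_wpM2l => //; pos.
Qed.

(** A cycle in a symmetric relation may go back and forth along its first
    edge. *)
Lemma cycle_lengthen (g : rel Q) (p : seq Q) m : symmetric g -> cycle g p -> (1 < size p)%N ->
  exists2 p', cycle g p' & size p' = (size p + m.*2)%N.
Proof.
move=> gs cp p1; elim: m => [|m [p' cp' sp']]; first by exists p; rewrite ?addn0.
case: p' cp' sp' => [|x [|y r]] /=; try by case: (size p) p1 => [|[|?]].
move=> cp' sp'; exists [:: x, y, x, y & r].
  by move: cp' => /= /andP[xy ->]; rewrite xy gs xy.
by rewrite /= sp' doubleS !addnS.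
Qed.

End DenseRegularPairs.

Section Blowup.
Variables (R : realFieldType) (T S : finType) (f : T -> S).

Definition fib_size (s : S) : R := #|fib f s|%:R.

Lemma fib_size_ge0 s : 0 <= fib_size s. Proof. exact: ler0n. Qed.

Lemma sum_blowup (G : S -> R) : \sum_x G (f x) = \sum_s fib_size s * G s.
Proof.
rewrite (partition_big f xpredT) //=; apply: eq_bigr => s _.
rewrite (eq_bigr (fun=> G s)) => [|x /eqP -> //].
rewrite sumr_const mulr_natl; congr (_ *+ _).
by apply: eq_card => x; rewrite inE.
Qed.

Lemma sum_fib_size : \sum_s fib_size s = #|T|%:R.
Proof.
have := sum_blowup (fun=> 1); rewrite sumr_const => ->.
by apply: eq_bigr => s _; rewrite mulr1.
Qed.

Variable h : rel S.
Let A (x y : T) : R := (h (f x) (f y))%:R.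

(** Replacing each point of [S] by its fibre turns the weights into cardinals. *)
Lemma kpow_blowup k x y :
  kpow A k.+1 x y * fib_size (f y) = kpow (wker fib_size h) k.+1 (f x) (f y).
Proof.
elim: k x => [|k IH] x; first by rewrite !kpow1.
rewrite kpowS mulr_suml [RHS]kpowS.
rewrite (eq_bigr (fun z => (h (f x) (f z))%:R * kpow (wker fib_size h) k.+1 (f z) (f y))).
  rewrite (sum_blowup (fun s => (h (f x) s)%:R * kpow (wker fib_size h) k.+1 s (f y))).
  by apply: eq_bigr => s _; rewrite /wker; ring.
by move=> z _; rewrite -IH mulrA.
Qed.

Lemma closed_blowup k :
  \sum_s kpow (wker fib_size h) k.+1 s s <= \sum_x kpow A k.+1 x x.
Proof.
rewrite [leRHS](partition_big f xpredT) //=; apply: ler_sum => s _.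
have [s0|s0] := eqVneq (fib_size s) 0.
  rewrite kpowSr big1 => [|z _]; last by rewrite /wker s0 !mulr0.
  by apply: sumr_ge0 => x _; apply: kpow_ge0 => u v; apply: ler0n.
rewrite (eq_bigr (fun x => (fib_size s)^-1 * kpow (wker fib_size h) k.+1 s s)); last first.
  by move=> x /eqP fx; rewrite -fx -kpow_blowup [RHS]mulrC mulfK // fx.
rewrite sumr_const -mulr_natl.
rewrite (_ : #|_| = #|fib f s|); last by apply: eq_card => x; rewrite inE.
by rewrite -/(fib_size s) mulrA mulfV // mul1r.
Qed.
End Blowup.

Section DenseRemoval.
Variable (R : archiRealFieldType).

(** Removal lemma for odd closed walks in a dense weighted graph.  On a
    regular partition of the weighted set [S], one discards the pairs that
    involve a small part, have a low density, or are irregular.  A short odd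
    closed walk surviving this runs along good pairs of parts; since the
    length is odd it extends to length [2k+1] exactly, and there are then many
    closed walks of that length. *)
Lemma dense_removal (k : nat) (alpha : R) : (0 < k)%N -> 0 < alpha ->
  exists2 c : R, 0 < c & forall (T S : finType) (f : T -> S) (h : rel S),
    symmetric h -> (0 < #|T|)%N ->
    c * #|T|%:R ^+ k.*2.+1 <= \sum_x kpow (fun x y : T => (h (f x) (f y))%:R) k.*2.+1 x x \/
    exists2 r : rel S,
      \sum_x \sum_y (h (f x) (f y) && r (f x) (f y))%:R <= alpha * #|T|%:R ^+ 2 &
      forall p : seq S, cycle [rel s t | h s t && ~~ r s t] p -> odd (size p) ->
        (2 < size p <= k.*2.+1)%N -> False.
Proof.
move=> k0 al0.
(* Small parts and low densities discard a quarter of [alpha] each, irregular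
   pairs a half; every contribution is doubled by symmetry. *)
pose b := Num.min (alpha / 16) 4^-1.
have b0 : 0 < b by rewrite lt_min; apply/andP; split; pos.
have b4 : b <= 4^-1 by rewrite ge_min lexx orbT.
have b16 : b <= alpha / 16 by rewrite ge_min lexx.
pose gamma := b ^+ 3 * alpha / 4.
have g0 : 0 < gamma by rewrite /gamma; pos.
have [M regM] := @regularity R (2 * b) gamma ltac:(pos) g0.
pose tau := alpha / (8 * M.+1%:R).
have tau0 : 0 < tau by rewrite /tau; pos.
exists ((b ^+ 2 * tau) ^+ (k.*2 - 2) * (b ^+ 3 * tau ^+ 3 / 2)); first by pos.
move=> T S f h hs n0; set N : R := #|T|%:R.
have N0 : 0 < N by rewrite /N ltr0n.
pose mu := fib_size R f.
have mu0 s : 0 <= mu s by apply: fib_size_ge0.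
have v0 s t : 0 <= wvol mu s t by apply: mulr_ge0.
have a0 s t : 0 <= wadj mu h s t by apply: mulr_ge0; [exact: ler0n | exact: mulr_ge0].
have vn s t : wvol mu s t = 0 -> wadj mu h s t = 0.
  by rewrite /wvol /wadj => ->; rewrite mulr0.
have vN : \sum_s \sum_t wvol mu s t = N ^+ 2.
  transitivity ((\sum_s mu s) * (\sum_t mu t)).
    by rewrite mulr_suml; apply: eq_bigr => s _; rewrite mulr_sumr.
  by rewrite sum_fib_size expr2.
have [Q [q [QM reg]]] := regM S (wvol mu) (wadj mu h) (N ^+ 2) v0 a0 vn ltac:(pos)
  ltac:(by rewrite vN).
pose good := good_pair mu h q b tau N.
pose dens := cdens (wvol mu) (wadj mu h) q.
pose G i j := [&& good i j, 2 * b <= dens i j & 2 * b <= dens j i].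
have Gsym : symmetric G.
  by move=> i j; rewrite /G /good good_sym //; congr (_ && _); exact: andbC.
pose r s t := ~~ G (q s) (q t).
case: (boolP [exists p : (k.*2.+1).-tuple Q, cycle G p]) => [/existsP[p cp]|nocyc].
  left; case: p cp => p0 sp /= cp; move/eqP: sp; case: p0 cp => [|i [|j p']] cp //.
    by case; case: (k) k0.
  case/lastP: p' cp => [|p' l] cp sp.
    by case: sp; case: (k) k0.
  have cg : cycle good (i :: j :: rcons p' l).
    by apply: sub_cycle cp => u w /and3P[].
  have := cycle_walks mu0 hs b0 b4 tau0 N0 cg.
  have {}sp : ((size p').+3 = k.*2.+1)%N by move: sp; rewrite /= size_rcons.
  have sp' : size p' = (k.*2 - 2)%N by move: sp; clear; lia.
  rewrite sp => /le_trans /(_ (closed_blowup _ _ _ _)); apply: le_trans.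
  rewrite -sp -sp' le_eqVlt; apply/orP; left; apply/eqP.
  by rewrite -(addn3 (size p')) exprD [(b ^+ 2 * tau * N) ^+ _]exprMn; ring.
right; exists r; last first.
  move=> p cp op /andP[p2 pk]; case/negP: nocyc.
  have cG : cycle G (map q p).
    rewrite cycle_map; apply: sub_cycle cp => s t /=.
    by rewrite /r negbK => /andP[].
  have [] := @cycle_lengthen Q G (map q p) (k - (size p)./2)%N Gsym cG.
    by rewrite size_map; exact: ltnW.
  rewrite size_map => p' cp' sp'.
  have {}sp' : size p' == k.*2.+1.
    rewrite {}sp'; move: (odd_double_half (size p)) pk; rewrite op; clear.
    by move: (size p) => m hm pk; apply/eqP; lia.
  by apply/existsP; exists (Tuple sp').
pose tiny i := wt mu (fib q i) < tau * N.
pose irr i j := irregular mu h q b i j && (2 * b <= dens i j).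
pose low i j := dens i j < 2 * b.
have -> : \sum_x \sum_y (h (f x) (f y) && r (f x) (f y))%:R =
   \sum_s \sum_t (h s t && r s t)%:R * wvol mu s t.
  rewrite (eq_bigr (fun x => \sum_t mu t * (h (f x) t && r (f x) t)%:R)); last first.
    by move=> x _; rewrite -(sum_blowup f (fun t => (h (f x) t && r (f x) t)%:R)).
  rewrite (sum_blowup f (fun s => \sum_t mu t * (h s t && r s t)%:R)).
  by apply: eq_bigr => s _; rewrite mulr_sumr; apply: eq_bigr => t _; rewrite /wvol -/mu; ring.
pose F (P : Q -> Q -> bool) := \sum_s \sum_t (P (q s) (q t))%:R * wvol mu s t.
have F_sym P : F (fun i j => P j i) = F P.
  rewrite /F exchange_big; apply: eq_bigr => s _; apply: eq_bigr => t _.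
  by rewrite /wvol [mu t * _]mulrC.
have FE P : F P = \sum_i \sum_j (P i j)%:R * rect (wvol mu) (fib q i) (fib q j).
  rewrite /F (sum_cells q); apply: eq_bigr => i _; apply: eq_bigr => j _.
  by rewrite -rectZ; apply: eq_rect => s t; rewrite !inE => /eqP -> /eqP ->.
have tinyF : F (fun i _ => tiny i) <= alpha / 8 * N ^+ 2.
  rewrite FE; apply: le_trans (_ : \sum_(i : Q) tau * N * N <= _).
    apply: ler_sum => i _; case ti : (tiny i); last first.
      by rewrite big1 => [|j _]; rewrite ?mul0r //; pos.
    rewrite (eq_bigr (fun j => wt mu (fib q i) * wt mu (fib q j))); last first.
      by move=> j _; rewrite mul1r rect_wvol.
    have -> : \sum_j wt mu (fib q i) * wt mu (fib q j) = wt mu (fib q i) * N.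
      rewrite -mulr_sumr /N -(sum_fib_size R f) -/mu; congr (_ * _).
      rewrite [RHS](partition_big q xpredT) //=; apply: eq_bigr => j _.
      by apply: eq_bigl => s; rewrite inE.
    by apply: ler_wpM2r; [exact: ltW | exact: ltW].
  rewrite sumr_const -[_ *+ _]mulr_natl.
  have -> : alpha / 8 * N ^+ 2 = M.+1%:R * (tau * N * N).
    have : 0 < M.+1%:R :> R by rewrite ltr0n.
    by rewrite /tau; move: (M.+1%:R : R) => m m0; field; rewrite gt_eqF.
  by apply: ler_wpM2r; [pos | rewrite ler_nat; exact: leqW].
have lowF : \sum_s \sum_t (low (q s) (q t))%:R * wadj mu h s t <= alpha / 8 * N ^+ 2.
  rewrite (sum_cells q); apply: le_trans (_ : \sum_i \sum_j 2 * b * rect (wvol mu) (fib q i) (fib q j) <= _).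
    apply: ler_sum => i _; apply: ler_sum => j _.
    rewrite (eq_rect (l := fun s t => (low i j)%:R * wadj mu h s t)); last first.
      by move=> s t; rewrite !inE => /eqP -> /eqP ->.
    have r0 : 0 <= rect (wvol mu) (fib q i) (fib q j) by apply: rect_ge0.
    rewrite rectZ; case hl : (low i j); last by rewrite mul0r; pos.
    by rewrite mul1r (cdensE v0 vn); apply: ler_wpM2r => //; exact: ltW.
  under eq_bigr do rewrite -mulr_sumr.
  rewrite -mulr_sumr -sum_cells vN.
  by apply: ler_wpM2r; [pos | lra].
have lowF' : \sum_s \sum_t (low (q t) (q s))%:R * wadj mu h s t <= alpha / 8 * N ^+ 2.
  rewrite exchange_big; apply: le_trans lowF; apply: ler_sum => s _; apply: ler_sum => t _.
  by rewrite /wadj hs [mu t * _]mulrC.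
have irrF : F irr <= alpha / 4 * N ^+ 2.
  pose bad i j (Z : {set S} * {set S}) := [&& Z.1 \subset fib q i, Z.2 \subset fib q j,
    b * wt mu (fib q i) <= wt mu Z.1, b * wt mu (fib q j) <= wt mu Z.2 &
    rect (wadj mu h) Z.1 Z.2 <= b * (wt mu Z.1 * wt mu Z.2)].
  pose Z i j := odflt (set0, set0) [pick Z | bad i j Z].
  have ZP i j : irregular mu h q b i j -> bad i j (Z i j).
    case/existsP => X /existsP[Y XY]; rewrite /Z; case: pickP => [//|/(_ (X, Y))].
    by rewrite /bad XY.
  have := reg (fun i j => (Z i j).1) (fun i j => (Z i j).2).
  set defs := \sum_i _ => hdef.
  have : b ^+ 3 * F irr <= defs.
    rewrite FE mulr_sumr; apply: ler_sum => i _; rewrite mulr_sumr; apply: ler_sum => j _.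
    case hi : (irr i j); last by rewrite mul0r mulr0 /deficit le_max lexx.
    case/andP: hi => /ZP; case: (Z i j) => X Y /and5P[/= Xi Yj bX bY XY] hd.
    rewrite mul1r /deficit (setIidPr Xi) (setIidPr Yj) min_r // !rect_wvol le_max; apply/orP; right.
    have h1 : b * wt mu (fib q i) * (b * wt mu (fib q j)) <= wt mu X * wt mu Y.
      by apply: ler_pM => //; apply: mulr_ge0; rewrite ?wt_ge0 // ltW.
    have h2 := ler_wpM2l (ltW b0) h1.
    have h3 : b ^+ 3 * (wt mu (fib q i) * wt mu (fib q j)) =
      b * (b * wt mu (fib q i) * (b * wt mu (fib q j))) by ring.
    rewrite h3; lra.
  have -> : alpha / 4 * N ^+ 2 = (b ^+ 3)^-1 * (gamma * N ^+ 2).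
    by rewrite /gamma; field; rewrite gt_eqF.
  by rewrite ler_pdivlMl; [move/le_trans; apply | pos].
apply: le_trans (_ : F (fun i _ => tiny i) + F (fun _ j => tiny j) +
   (\sum_s \sum_t (low (q s) (q t))%:R * wadj mu h s t) +
   (\sum_s \sum_t (low (q t) (q s))%:R * wadj mu h s t) +
   F irr + F (fun i j => irr j i) <= _); last first.
  rewrite (F_sym (fun i _ => tiny i)) (F_sym irr); lra.
rewrite /F -!big_split /=; apply: ler_sum => s _; rewrite -!big_split /=.
apply: ler_sum => t _; have := v0 s t; set w := wvol mu s t => w0.
have -> : wadj mu h s t = (h s t)%:R * w by [].
have key : r s t -> [|| tiny (q s), tiny (q t), low (q s) (q t), low (q t) (q s),
    irr (q s) (q t) | irr (q t) (q s)].
  apply: contraLR; rewrite !negb_or => /and5P[t1 t2 l1 l2 /andP[i1 i2]].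
  rewrite /r negbK /G /good /good_pair.
  move: t1 t2 l1 l2; rewrite /tiny /low -!leNgt => -> -> l1 l2.
  move: i1 i2; rewrite /irr /dens l1 l2 !andbT => -> ->.
  by [].
clearbody w; rewrite !mulrA -!natrM -!mulrDl.
apply: ler_wpM2r => //; rewrite -!natrD ler_nat.
case: (h s t) => //; case: (r s t) key => // /(_ isT).
by do 2!case: (tiny _); do 2!case: (low _ _); do 2!case: (irr _ _).
Qed.
End DenseRemoval.

(** * Counting closed walks through a dense model *)

Section Bilinear.
Variables (R : realFieldType) (T : finType).
Implicit Types (k l : T -> T -> R) (u v : T -> R).

Definition form k u v : R := \sum_x \sum_y u x * v y * k x y.

Lemma formB k l u v : form (fun x y => k x y - l x y) u v = form k u v - form l u v.
Proof.
rewrite /form -sumrB; apply: eq_bigr => x _; rewrite -sumrB; apply: eq_bigr => y _.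
ring.
Qed.

(** A bilinear form on functions with values between zero and a bound is
    minimal at indicator functions: first in [u] for a fixed [v], and then in
    [v]. *)
Lemma form_cut k beta u v b1 b2 : (forall X Y, - beta <= rect k X Y) ->
  (forall x, 0 <= u x <= b1) -> (forall x, 0 <= v x <= b2) -> 0 <= b1 -> 0 <= b2 ->
  - (beta * b1 * b2) <= form k u v.
Proof.
move=> hk hu hv b10 b20.
pose X := [set x | \sum_y v y * k x y < 0].
pose Y := [set y | \sum_(x in X) k x y < 0].
apply: le_trans (_ : b1 * b2 * rect k X Y <= _).
  by rewrite -mulrA mulrC -mulrN; apply: ler_wpM2l => //; apply: mulr_ge0.
apply: le_trans (_ : b1 * \sum_(x in X) \sum_y v y * k x y <= _).
  rewrite -mulrA; apply: ler_wpM2l => //.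
  rewrite /rect exchange_big [leRHS]exchange_big mulr_sumr big_mkcond /=.
  apply: ler_sum => y _; rewrite -mulr_sumr inE; case/andP: (hv y) => v0 vb.
  case: ltP => hy; last exact: mulr_ge0.
  by apply: ler_wnM2r => //; exact: ltW.
rewrite /form mulr_sumr big_mkcond; apply: ler_sum => x _; rewrite inE.
under [leRHS]eq_bigr do rewrite -mulrA.
rewrite -mulr_sumr; case/andP: (hu x) => u0 ub.
case: ltP => hx; last exact: mulr_ge0.
by apply: ler_wnM2r => //; exact: ltW.
Qed.

Lemma form_act k u v : form k u v = \sum_x u x * \sum_y k x y * v y.
Proof.
apply: eq_bigr => x _; rewrite mulr_sumr; apply: eq_bigr => y _; ring.
Qed.

Lemma form_coact k u v : form k u v = \sum_y (\sum_x u x * k x y) * v y.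
Proof.
rewrite /form exchange_big; apply: eq_bigr => y _; rewrite mulr_suml.
apply: eq_bigr => x _; ring.
Qed.

Lemma form_compose k i u v : form (kpow k i.+1) u v =
  form k u (fun z => \sum_y kpow k i z y * v y).
Proof.
rewrite !form_act; apply: eq_bigr => x _; congr (_ * _).
under eq_bigr do rewrite kpowS mulr_suml.
rewrite exchange_big; apply: eq_bigr => z _; rewrite mulr_sumr.
by apply: eq_bigr => y _; rewrite mulrA.
Qed.

Lemma form_shift k l u v : form k u (fun z => \sum_y l z y * v y) =
  form l (fun z => \sum_x u x * k x z) v.
Proof. by rewrite form_coact form_act. Qed.

End Bilinear.

Section Transference.
Variables (R : realFieldType) (T : finType) (e : rel T).
Variables (n D K B kappa eps2 eps3 : R) (Wb : T -> T -> R).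
Hypothesis e_sym : symmetric e.
Hypothesis e_irr : irreflexive e.
Hypothesis nE : n = #|T|%:R.
Hypothesis n0 : 0 < n.
Hypothesis D0 : 0 < D.
Hypothesis K0 : 0 < K.
Hypothesis B0 : 0 < B.
Hypothesis kappa0 : 0 < kappa.
Hypothesis eps20 : 0 <= eps2.
Hypothesis nD : n <= D ^+ 2.
Hypothesis Dn : kappa * D ^+ 2 <= n.
Hypothesis row : forall x, deg R e x <= K * D.
Hypothesis few4 : ncyc R e 4 + mass R e <= eps3 * n ^+ 2.
Hypothesis W_ge0 : forall x y, 0 <= Wb x y.
Hypothesis W_le : forall x y, Wb x y <= B.
Let A := adjk R e.
Let A' x y := n / D * A x y.
Hypothesis cut : forall X Y, rect Wb X Y - eps2 * n ^+ 2 <= rect A' X Y.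

Lemma sum_le_card (F : T -> R) b : (forall x, F x <= b) -> \sum_x F x <= b * n.
Proof.
move=> Fb; apply: le_trans (ler_sum _ (fun x _ => Fb x)) _.
by rewrite sumr_const nE mulr_natr.
Qed.

Lemma A'_ge0 x y : 0 <= A' x y.
Proof. by apply: mulr_ge0; [pos | exact: ler0n]. Qed.

Lemma A'_row x : \sum_y A' x y <= K * n.
Proof.
rewrite -mulr_sumr; have -> : K * n = n / D * (K * D) by field; rewrite gt_eqF.
by apply: ler_wpM2l; [pos | exact: row].
Qed.

Lemma W_row x : \sum_y Wb x y <= B * n.
Proof. exact: sum_le_card. Qed.

Lemma W_pow_entry i x y : kpow Wb i.+1 x y <= B * (B * n) ^+ i.
Proof. by apply: kpow_entry => //; exact: W_row. Qed.

Lemma form_cutA u v b1 b2 : (forall x, 0 <= u x <= b1) -> (forall x, 0 <= v x <= b2) ->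
  0 <= b1 -> 0 <= b2 -> form Wb u v - eps2 * n ^+ 2 * b1 * b2 <= form A' u v.
Proof.
move=> hu hv b10 b20.
have hr X Y : - (eps2 * n ^+ 2) <= rect (fun x y => A' x y - Wb x y) X Y.
  by rewrite rectB; have := cut X Y; lra.
by have := form_cut hr hu hv b10 b20; rewrite formB; lra.
Qed.

(** The accumulated error when the factors of a power are replaced one at a
    time. *)
Fixpoint chain_err i : R := if i is j.+1 then K ^+ j + B * chain_err j else 0.

Lemma chain_err_ge0 i : 0 <= chain_err i.
Proof. by elim: i => //= i IH; pos. Qed.

(** The leftmost factor [A'] is replaced by [Wb] at the price of a cut-norm
    error: the function on its right, obtained from [v] by [i] steps, is
    bounded because the degrees are.  The factor [Wb] is then absorbed into
    [u], which stays bounded because [Wb] is. *)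
Lemma walk_form_lower i u v b1 b2 : (forall x, 0 <= u x <= b1) -> (forall x, 0 <= v x <= b2) ->
  0 <= b1 -> 0 <= b2 ->
  form (kpow Wb i) u v - eps2 * chain_err i * n ^+ i.+1 * b1 * b2 <= form (kpow A' i) u v.
Proof.
elim: i u v b1 b2 => [|i IH] u v b1 b2 hu hv b10 b20.
  by rewrite mulr0 !mul0r subr0.
pose phi z := \sum_y kpow A' i z y * v y.
pose psi z := \sum_x u x * Wb x z.
have phib z : 0 <= phi z <= (K * n) ^+ i * b2.
  apply/andP; split.
    apply: sumr_ge0 => y _; apply: mulr_ge0; [apply: kpow_ge0; exact: A'_ge0 | by case/andP: (hv y)].
  apply: le_trans (_ : \sum_y kpow A' i z y * b2 <= _).
    apply: ler_sum => y _; apply: ler_wpM2l; last by case/andP: (hv y).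
    by apply: kpow_ge0; exact: A'_ge0.
  rewrite -mulr_suml; apply: ler_wpM2r => //; apply: kpow_row; [exact: A'_ge0 | exact: A'_row].
have psib z : 0 <= psi z <= b1 * B * n.
  apply/andP; split.
    by apply: sumr_ge0 => x _; apply: mulr_ge0 => //; case/andP: (hu x).
  apply: sum_le_card => x; case/andP: (hu x) => ? ?; exact: ler_pM.
have h1 := form_cutA hu phib b10 ltac:(pos).
have h2 := IH psi v (b1 * B * n) b2 psib hv ltac:(pos) b20.
rewrite [leRHS]form_compose -/phi; apply: le_trans h1.
rewrite [X in _ <= X - _](form_shift _ (kpow A' i)) -/psi.
have -> : form (kpow Wb i.+1) u v = form (kpow Wb i) psi v.
  by rewrite form_compose form_shift.
apply: le_trans (_ : form (kpow Wb i) psi v - eps2 * chain_err i * n ^+ i.+1 * (b1 * B * n) * b2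
   - eps2 * n ^+ 2 * b1 * ((K * n) ^+ i * b2) <= _); last by rewrite lerD2r.
rewrite le_eqVlt; apply/orP; left; apply/eqP; rewrite /= exprMn !exprS; ring.
Qed.

(** Since the graph has few four-cycles and [n] is comparable to [D^2], two
    vertices rarely have more than one common neighbour, so this 0/1 kernel
    stands for the square of [A].  Unlike that square it is bounded, and it is
    dense although the graph is sparse. *)
Definition dist2 x y : R := ((x != y) && (0 < kpow A 2 x y))%:R.

Lemma codeg_nat x y : exists m : nat, kpow A 2 x y = m%:R.
Proof.
exists (\sum_z (e x z : nat) * e z y)%N; rewrite natr_sum codegE.
by apply: eq_bigr => z _; rewrite natrM.
Qed.

Lemma dist2_bound x y : 0 <= dist2 x y <= 1.
Proof. by rewrite /dist2 ler0n /= lern1; case: (_ && _). Qed.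

Lemma dist2_le x y : dist2 x y <= kpow A 2 x y.
Proof.
rewrite /dist2; have [m ->] := codeg_nat x y; rewrite ler_nat ltr0n.
by case: m; case: (x != y).
Qed.

Definition dist2_err : R := eps2 * (K + B) / kappa + eps3.

(** With integral codegrees, [c - 1 <= c^2 - c] for [c >= 1], so that passing
    from the square of [A] to [dist2] costs at most the number of four-cycles
    and the diagonal. *)
Lemma dist2_form u v b1 b2 : (forall x, 0 <= u x <= b1) -> (forall x, 0 <= v x <= b2) ->
  0 <= b1 -> 0 <= b2 ->
  form (kpow Wb 2) u v / n - dist2_err * n ^+ 2 * b1 * b2 <= form dist2 u v.
Proof.
move=> hu hv b10 b20.
have h1 : form (kpow A 2) u v - eps3 * n ^+ 2 * b1 * b2 <= form dist2 u v.
  rewrite lerBlDr -lerBlDl -formB; apply: le_trans (_ : (ncyc R e 4 + mass R e) * (b1 * b2) <= _); last first.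
    by rewrite -mulrA; apply: ler_wpM2r => //; exact: mulr_ge0.
  apply: le_trans (_ : (\sum_x \sum_y (x != y)%:R * (kpow A 2 x y ^+ 2 - kpow A 2 x y)
     + \sum_x kpow A 2 x x) * (b1 * b2) <= _); last first.
    apply: ler_wpM2r; first exact: mulr_ge0.
    apply: lerD; first exact: codeg_ncyc4.
    by rewrite /mass; apply: ler_sum => x _; rewrite codeg_diag.
  rewrite -big_split mulr_suml; apply: ler_sum => x _.
  rewrite (bigD1 x) //= [in leRHS](bigD1 x) //= eqxx mul0r add0r addrC mulrDl.
  case/andP: (hu x) => u0 ub; apply: lerD.
    rewrite mulr_suml; apply: ler_sum => y yx; rewrite eq_sym yx mul1r.
    case/andP: (hv y) => w0 wb; rewrite mulrC.
    have uv : u x * v y <= b1 * b2 by apply: ler_pM.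
    rewrite /dist2 eq_sym yx /=; have [m ->] := codeg_nat x y; rewrite ltr0n.
    have m0 : 0 <= m%:R ^+ 2 - m%:R :> R.
      by rewrite subr_ge0 -natrX ler_nat; case: m => // m; rewrite -mulnn leq_pmulr.
    apply: le_trans (_ : (m%:R ^+ 2 - m%:R) * (u x * v y) <= _); last exact: ler_wpM2l.
    apply: ler_wpM2r; first exact: mulr_ge0.
    case: m m0 => [|m] _ /=; first by rewrite expr0n /= subrr.
    have := sqr_ge0 (m.+1%:R - 1 : R); rewrite mulr1n; lra.
  case/andP: (hv x) => w0 wb.
  rewrite /dist2 eqxx /= subr0 mulrC; apply: ler_wpM2l; last exact: ler_pM.
  by apply: kpow_ge0 => *; exact: ler0n.
have A2E : form (kpow A' 2) u v = (n / D) ^+ 2 * form (kpow A 2) u v.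
  rewrite /form mulr_sumr; apply: eq_bigr => x _; rewrite mulr_sumr; apply: eq_bigr => y _.
  rewrite !kpowS !mulr_sumr; apply: eq_bigr => z _; rewrite !kpow1 /A'; ring.
have h2 := walk_form_lower 2 hu hv b10 b20.
rewrite A2E in h2.
have W0 : 0 <= form (kpow Wb 2) u v.
  apply: sumr_ge0 => x _; apply: sumr_ge0 => y _; apply: mulr_ge0; last exact: kpow_ge0.
  by apply: mulr_ge0; [case/andP: (hu x) | case/andP: (hv y)].
apply: le_trans h1; rewrite /dist2_err.
have -> : (eps2 * (K + B) / kappa + eps3) * n ^+ 2 * b1 * b2 =
   eps2 * (K + B) * n ^+ 2 * b1 * b2 / kappa + eps3 * n ^+ 2 * b1 * b2.
  by field; rewrite gt_eqF.
rewrite opprD addrA lerD2r.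
have -> : form (kpow A 2) u v = (D / n) ^+ 2 * ((n / D) ^+ 2 * form (kpow A 2) u v).
  by field; rewrite !gt_eqF.
apply: le_trans (ler_wpM2l _ h2); last by exact: sqr_ge0.
rewrite mulrBr; apply: lerB.
  rewrite mulrC; apply: ler_wpM2r => //.
  have -> : (D / n) ^+ 2 = D ^+ 2 * (n ^+ 2)^-1 by field; rewrite gt_eqF.
  have -> : n^-1 = n * (n ^+ 2)^-1 by field; rewrite gt_eqF.
  by apply: ler_wpM2r => //; pos.
rewrite /= expr0 mulr0 addr0 mulr1 expr1.
have -> : (D / n) ^+ 2 * (eps2 * (K + B) * n ^+ 3 * b1 * b2) =
   eps2 * (K + B) * b1 * b2 * n * D ^+ 2 by field; rewrite gt_eqF.
have -> : eps2 * (K + B) * n ^+ 2 * b1 * b2 / kappa =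
   eps2 * (K + B) * b1 * b2 * n * (n / kappa) by field; rewrite gt_eqF.
apply: ler_wpM2l; first by pos.
by rewrite ler_pdivlMr // mulrC.
Qed.

(** Four of the steps of a closed walk are grouped into two pairs, each of
    which is bounded below by [dist2].  The remaining [r.+1] steps are
    replaced by [Wb] between bounded functions; then each [dist2] is replaced
    by the square of [Wb], the other factors being fixed by one vertex at a
    time so that they form a product of a function of each end. *)
Lemma closed_walks_transfer r : 
  (D / n) ^+ r.+1 * (n ^- 2 * (\sum_x kpow Wb (r + 5) x x)
     - (eps2 * chain_err r.+1 + dist2_err * B ^+ r.+1 + dist2_err * B ^+ r.+3) * n ^+ r.+3)
  <= \sum_x kpow A (r + 5) x x.
Proof.
have A0 x y : 0 <= A x y by exact: ler0n.
pose N' := \sum_w form (kpow A' r.+1) (dist2 w) (fun y => dist2 y w).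
have hA : (D / n) ^+ r.+1 * N' <= \sum_x kpow A (r + 5) x x.
  rewrite mulr_sumr; apply: ler_sum => w _.
  have -> : (r + 5 = 2 + (r.+1 + 2))%N by rewrite add2n !addnS !addn0.
  rewrite kpowD /form mulr_sumr; apply: ler_sum => x _.
  rewrite kpowD mulr_sumr mulr_sumr; apply: ler_sum => y _.
  have -> : (D / n) ^+ r.+1 * (dist2 w x * dist2 y w * kpow A' r.+1 x y) =
     dist2 w x * ((D / n) ^+ r.+1 * kpow A' r.+1 x y * dist2 y w) by ring.
  have E i u v : (D / n) ^+ i * kpow A' i u v = kpow A i u v.
    elim: i u => [|i IH] u; first by rewrite expr0 mul1r.
    rewrite !kpowS mulr_sumr; apply: eq_bigr => z _; rewrite -IH /A' exprS.
    by field; rewrite !gt_eqF.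
  rewrite E; have k0 := @kpow_ge0 _ _ A r.+1 x y A0.
  have /andP[d10 _] := dist2_bound w x; have /andP[d20 _] := dist2_bound y w.
  apply: ler_pM => //; first exact: mulr_ge0; first exact: dist2_le.
  by apply: ler_wpM2l => //; exact: dist2_le.
apply: le_trans hA; apply: ler_wpM2l; first by pos.
have b1 w x : 0 <= dist2 w x <= 1 by exact: dist2_bound.
have s1 : \sum_w form (kpow Wb r.+1) (dist2 w) (fun y => dist2 y w)
    - eps2 * chain_err r.+1 * n ^+ r.+3 <= N'.
  have -> : eps2 * chain_err r.+1 * n ^+ r.+3 = \sum_(w : T) eps2 * chain_err r.+1 * n ^+ r.+2 * 1 * 1.
    by rewrite sumr_const -mulr_natr -nE (exprSr n r.+2); ring.
  rewrite -sumrB; apply: ler_sum => w _.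
  exact: walk_form_lower (b1 w) (fun y => b1 y w) ler01 ler01.
apply: le_trans s1.
have Wk0 i x y : 0 <= kpow Wb i x y by apply: kpow_ge0.
have Wkb i x y : 0 <= kpow Wb i.+1 x y <= B * (B * n) ^+ i.
  by rewrite Wk0 W_pow_entry.
have s2 : \sum_y (form (kpow Wb 2) (dist2 y) (fun x => kpow Wb r.+1 x y) / n
    - dist2_err * n ^+ 2 * 1 * (B * (B * n) ^+ r)) <=
   \sum_w form (kpow Wb r.+1) (dist2 w) (fun y => dist2 y w).
  apply: le_trans (_ : \sum_y form dist2 (dist2 y) (fun x => kpow Wb r.+1 x y) <= _).
    apply: ler_sum => y _; apply: dist2_form => //; by pos.
  rewrite le_eqVlt; apply/orP; left; apply/eqP; rewrite /form.
  rewrite exchange_big; apply: eq_bigr => w _; rewrite exchange_big.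
  by apply: eq_bigr => x _; apply: eq_bigr => y _; ring.
apply: le_trans (lerB s2 (lexx _)).
have s3 : \sum_z (form (kpow Wb 2) (fun y => kpow Wb r.+2 z y) (fun w => Wb w z) / n
    - dist2_err * n ^+ 2 * (B * (B * n) ^+ r.+1) * B) <=
   \sum_y form (kpow Wb 2) (dist2 y) (fun x => kpow Wb r.+1 x y).
  apply: le_trans (_ : \sum_z form dist2 (fun y => kpow Wb r.+2 z y) (fun w => Wb w z) <= _).
    apply: ler_sum => z _; apply: dist2_form => //; try by pos.
    by move=> w; rewrite W_ge0 W_le.
  rewrite le_eqVlt; apply/orP; left; apply/eqP; rewrite /form.
  rewrite exchange_big; apply: eq_bigr => y _; rewrite exchange_big.
  apply: eq_bigr => w _.
  transitivity (dist2 y w * kpow Wb r.+3 w y).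
    by rewrite kpowS mulr_sumr; apply: eq_bigr => z _; ring.
  have -> : kpow Wb r.+3 w y = \sum_x kpow Wb 2 w x * kpow Wb r.+1 x y by rewrite -kpowD.
  by rewrite mulr_sumr; apply: eq_bigr => x _; ring.
set F2 := \sum_y form _ _ _ in s3.
set F3 := \sum_x kpow Wb (r + 5) x x.
have E3 : \sum_z (form (kpow Wb 2) (fun y => kpow Wb r.+2 z y) (fun w => Wb w z) / n
    - dist2_err * n ^+ 2 * (B * (B * n) ^+ r.+1) * B) = F3 / n - dist2_err * B ^+ r.+3 * n ^+ r.+4.
  rewrite sumrB sumr_const -mulr_natl -nE -mulr_suml; congr (_ / _ - _); last first.
    by rewrite exprMn !exprS; ring.
  apply: eq_bigr => z _; have -> : (r + 5 = r.+2 + 3)%N by rewrite !addnS !addn0.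
  rewrite kpowD; apply: eq_bigr => y _; rewrite (kpowSr Wb 2 y z) mulr_sumr.
  by apply: eq_bigr => w _; ring.
have E2 : \sum_y (form (kpow Wb 2) (dist2 y) (fun x => kpow Wb r.+1 x y) / n
    - dist2_err * n ^+ 2 * 1 * (B * (B * n) ^+ r)) = F2 / n - dist2_err * B ^+ r.+1 * n ^+ r.+3.
  rewrite sumrB sumr_const -mulr_natl -nE -mulr_suml; congr (_ - _).
  by rewrite exprMn !exprS; ring.
rewrite E2; rewrite E3 in s3.
have ni : 0 <= n^-1 by pos.
have := ler_wpM2r ni s3.
have -> : (F3 / n - dist2_err * B ^+ r.+3 * n ^+ r.+4) / n = n ^- 2 * F3 - dist2_err * B ^+ r.+3 * n ^+ r.+3.
  by rewrite (exprS n r.+3); field; rewrite gt_eqF.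
lra.
Qed.

End Transference.

(** * Edges lying in discarded cells *)

Section HeavyCells.
Variables (R : realFieldType) (T S : finType) (e : rel T) (f : T -> S).
Hypothesis e_sym : symmetric e.
Hypothesis e_irr : irreflexive e.
Let A := adjk R e.
Let n : R := #|T|%:R.
Variable t : R.
Hypothesis row : forall x, deg R e x <= t.

Lemma sum_sqr_set (X : {set T}) (g : T -> R) :
  (\sum_(u in X) g u) ^+ 2 / #|X|%:R <= \sum_(u in X) g u ^+ 2.
Proof.
have [->|X0] := eqVneq X set0.
  by rewrite cards0 invr0 mulr0; apply: sumr_ge0 => *; exact: sqr_ge0.
set s := \sum_(u in X) g u; set m : R := #|X|%:R.
have m0 : 0 < m by rewrite ltr0n card_gt0.
have : 0 <= \sum_(u in X) (g u - s / m) ^+ 2 by apply: sumr_ge0 => *; exact: sqr_ge0.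
have -> : \sum_(u in X) (g u - s / m) ^+ 2 =
   \sum_(u in X) g u ^+ 2 - 2 * (s / m) * s + m * (s / m) ^+ 2.
  have -> : m * (s / m) ^+ 2 = \sum_(u in X) (s / m) ^+ 2.
    by rewrite sumr_const mulr_natl.
  have -> : 2 * (s / m) * s = \sum_(u in X) 2 * (s / m) * g u by rewrite -mulr_sumr.
  by rewrite -sumrN -!big_split; apply: eq_bigr => u _ /=; ring.
have -> : 2 * (s / m) * s = 2 * (s ^+ 2 / m) by ring.
have -> : m * (s / m) ^+ 2 = s ^+ 2 / m by field; rewrite gt_eqF.
lra.
Qed.

(** Two-step walks between points of [Y]: those with equal ends are bounded by
    the degrees, and each pair of distinct ends has one common neighbour up to
    the number of four-cycles. *)
Lemma column_energy (Y : {set T}) : \sum_u (\sum_(y in Y) A u y) ^+ 2 <=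
  t * #|Y|%:R + #|Y|%:R ^+ 2 + ncyc R e 4.
Proof.
have -> : \sum_u (\sum_(y in Y) A u y) ^+ 2 = \sum_(x in Y) \sum_(y in Y) kpow A 2 x y.
  transitivity (\sum_u \sum_(x in Y) \sum_(y in Y) A x u * A u y).
    apply: eq_bigr => u _; rewrite expr2 mulr_suml; apply: eq_bigr => x _.
    by rewrite mulr_sumr /A adjk_sym.
  rewrite exchange_big; apply: eq_bigr => x _; rewrite exchange_big.
  by apply: eq_bigr => y _; rewrite codegE.
apply: le_trans (_ : \sum_(x in Y) (t + #|Y|%:R +
    \sum_y (x != y)%:R * (kpow A 2 x y ^+ 2 - kpow A 2 x y)) <= _); last first.
  rewrite big_split /= sumr_const -[_ *+ #|Y|]mulr_natr mulrDl -expr2 lerD2l.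
  apply: le_trans (codeg_ncyc4 R e_sym e_irr).
  rewrite big_mkcond; apply: ler_sum => x _; case: (x \in Y) => //.
  apply: sumr_ge0 => y _; apply: mulr_ge0 => //.
  have [m ->] := codeg_nat R e x y.
  by rewrite subr_ge0 -natrX ler_nat; case: m => // m; rewrite -mulnn leq_pmulr.
apply: ler_sum => x xY; rewrite (bigD1 x) //= codeg_diag // -addrA; apply: lerD => //.
have -> : #|Y|%:R = \sum_y (y \in Y)%:R :> R.
  by rewrite -natr_sum -sum1_card big_mkcond; congr (_%:R); apply: eq_bigr => y _; case: (y \in Y).
rewrite -big_split [leLHS]big_mkcond; apply: ler_sum => y _ /=.
have [m mE] := codeg_nat R e x y; rewrite -/A in mE *; rewrite mE.
have h1 : 0 <= m%:R ^+ 2 - m%:R :> R.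
  by rewrite subr_ge0 -natrX ler_nat; case: (m) => // m'; rewrite -mulnn leq_pmulr.
have h2 := sqr_ge0 (m%:R - 1 : R).
case: (y \in Y) => /=; last by rewrite add0r; apply: mulr_ge0.
rewrite mulr1n eq_sym; case: (x == y) => /=; rewrite ?mul0r ?mul1r; lra.
Qed.

Variables (D B eta : R) (M : nat).
Hypothesis D0 : 0 < D.
Hypothesis B0 : 0 < B.
Hypothesis eta0 : 0 < eta.
Hypothesis n0 : 0 < n.
Hypothesis SM : (#|S| <= M)%N.

Let W s s' := cdens (fun _ _ => 1) (fun x y => n / D * A x y) f s s'.

Lemma rect_one (X Y : {set T}) : rect (fun _ _ => 1 : R) X Y = #|X|%:R * #|Y|%:R.
Proof.
by rewrite /rect !sumr_const -mulrnA mulnC natrM.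
Qed.

Lemma tiny_cells_mass : 0 <= t ->
  \sum_x \sum_y ((#|fib f (f x)|%:R < eta * n)%R)%:R * A x y <= M%:R * eta * t * n.
Proof.
move=> t0.
apply: le_trans (_ : \sum_x ((#|fib f (f x)|%:R < eta * n)%R)%:R * t <= _).
  by apply: ler_sum => x _; rewrite -mulr_sumr; apply: ler_wpM2l; [exact: ler0n | exact: row].
rewrite -mulr_suml (sum_blowup f (fun s => ((#|fib f s|%:R < eta * n)%R)%:R)).
rewrite [leRHS](_ : _ = M%:R * (eta * n) * t); last by ring.
apply: ler_wpM2r => //; apply: le_trans (_ : \sum_(s : S) eta * n <= _).
  apply: ler_sum => s _; rewrite /fib_size; case: ltP => h; first by rewrite mulr1 ltW.
  by rewrite mulr0; pos.
rewrite sumr_const -[_ *+ _]mulr_natl; apply: ler_wpM2r; first by pos.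
by rewrite ler_nat.
Qed.

(** For a cell of normalized density above [B], the number of edges is at most
    [n / (B * D)] times its square divided by the volume.  The sum of these
    normalized squares is controlled part by part by two-step walks between
    points of one part, and the parts that are not tiny make the contribution
    of the four-cycles harmless. *)
Lemma heavy_cells_mass :
  \sum_x \sum_y [&& B < W (f x) (f y), eta * n <= #|fib f (f x)|%:R
       & eta * n <= #|fib f (f y)|%:R]%R%:R * A x y <=
  n / (B * D) * (M%:R * t + n + M%:R * ncyc R e 4 / (eta * n)).
Proof.
rewrite (sum_cells f).
pose E s s' := rect A (fib f s) (fib f s').
have A0 x y : 0 <= A x y by exact: ler0n.
apply: le_trans (_ : \sum_s' ((eta * n <= #|fib f s'|%:R)%R)%:R *
   (n / (B * D) * ((\sum_s E s s' ^+ 2 / #|fib f s|%:R) / #|fib f s'|%:R)) <= _).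
  rewrite exchange_big; apply: ler_sum => s' _.
  rewrite mulr_suml !mulr_sumr; apply: ler_sum => s _.
  rewrite (eq_rect (l := fun x y => [&& B < W s s', eta * n <= #|fib f s|%:R
       & eta * n <= #|fib f s'|%:R]%R%:R * A x y)); last first.
    by move=> x y; rewrite !inE => /eqP -> /eqP ->.
  rewrite rectZ -/(E s s').
  have E0 : 0 <= E s s' by apply: rect_ge0.
  have bd0 : 0 <= n / (B * D) by pos.
  case: ltP => [hB|_]; last by rewrite mul0r; pos.
  case: (leP (eta * n) #|fib f s|%:R) => [hs|_]; last by rewrite mul0r; pos.
  case: (leP (eta * n) #|fib f s'|%:R) => [hs'|_]; last by rewrite mul0r; pos.
  have en0 : 0 < eta * n by pos.
  have s0 : 0 < #|fib f s|%:R :> R by apply: lt_le_trans hs.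
  have s'0 : 0 < #|fib f s'|%:R :> R by apply: lt_le_trans hs'.
  rewrite !mul1r.
  have WE : W s s' = n / D * E s s' / (#|fib f s|%:R * #|fib f s'|%:R).
    by rewrite /W /cdens rect_one rectZ.
  have -> : n / (B * D) * (E s s' ^+ 2 / #|fib f s|%:R / #|fib f s'|%:R) = E s s' * (W s s' / B).
    by rewrite WE; field; rewrite !gt_eqF.
  by apply: ler_peMr => //; rewrite ler_pdivlMr // mul1r ltW.
have n4 : 0 <= ncyc R e 4 by apply: sumseq_ge0 => *; exact: ler0n.
apply: le_trans (_ : \sum_s' n / (B * D) * (t + #|fib f s'|%:R + ncyc R e 4 / (eta * n)) <= _).
  apply: ler_sum => s' _.
  have bd0 : 0 <= n / (B * D) by pos.
  have t0 : 0 <= t.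
    move: n0; rewrite /n ltr0n => /card_gt0P[x _].
    by apply: le_trans (row x); exact: deg_ge0.
  case: (leP (eta * n) #|fib f s'|%:R) => [hs'|_]; last by rewrite mul0r; pos.
  rewrite mul1r; apply: ler_wpM2l => //.
  have en0 : 0 < eta * n by pos.
  have s'0 : 0 < #|fib f s'|%:R :> R by apply: lt_le_trans hs'.
  rewrite ler_pdivrMr // !mulrDl -expr2.
  apply: le_trans (_ : t * #|fib f s'|%:R + #|fib f s'|%:R ^+ 2 + ncyc R e 4 <= _); last first.
    by rewrite lerD2l -mulrA; apply: ler_peMr => //; rewrite ler_pdivlMl // mulr1.
  apply: le_trans (column_energy (fib f s')).
  rewrite [leRHS](partition_big f xpredT) //=; apply: ler_sum => s _.
  apply: le_trans (sum_sqr_set _ _) _.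
  rewrite le_eqVlt; apply/orP; left; apply/eqP.
  by apply: eq_bigl => x; rewrite inE.
rewrite -mulr_sumr; apply: ler_wpM2l; first by pos.
have t0 : 0 <= t.
  move: n0; rewrite /n ltr0n => /card_gt0P[x _].
  by apply: le_trans (row x); exact: deg_ge0.
have const b : 0 <= b -> \sum_(s : S) b <= M%:R * b :> R.
  move=> b0; rewrite sumr_const -[leLHS]mulr_natl; apply: ler_wpM2r => //.
  by rewrite ler_nat.
rewrite !big_split /= (sum_fib_size R f) -/n; apply: lerD; first by rewrite lerD2r const.
by rewrite -mulrA; apply: const; pos.
Qed.

End HeavyCells.

Section RemovedMass.
Variables (R : realFieldType) (T S : finType) (e : rel T) (f : T -> S) (r : rel S).
Hypothesis e_sym : symmetric e.
Hypothesis e_irr : irreflexive e.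
Let A := adjk R e.
Let n : R := #|T|%:R.
Variables (t D B eta rho : R) (M : nat).
Hypothesis row : forall x, deg R e x <= t.
Hypothesis t0 : 0 <= t.
Hypothesis D0 : 0 < D.
Hypothesis B0 : 0 < B.
Hypothesis eta0 : 0 < eta.
Hypothesis rho0 : 0 <= rho.
Hypothesis n0 : 0 < n.
Hypothesis SM : (#|S| <= M)%N.

Let W s s' := cdens (fun _ _ => 1) (fun x y => n / D * A x y) f s s'.

Definition discarded (s s' : S) : bool := [|| W s s' < rho, B < W s s' | r s s'].

Lemma density_mass (P : rel S) b : 0 <= b -> (forall s s', P s s' -> W s s' <= b) ->
  \sum_x \sum_y (P (f x) (f y))%:R * A x y <=
  D / n * (b * \sum_x \sum_y (P (f x) (f y))%:R).
Proof.
move=> b0 Pb; rewrite [leLHS](sum_cells f) (sum_cells f) !mulr_sumr.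
apply: ler_sum => s _; rewrite !mulr_sumr; apply: ler_sum => s' _.
rewrite (eq_rect (l := fun x y => (P s s')%:R * A x y)); last first.
  by move=> x y; rewrite !inE => /eqP -> /eqP ->.
rewrite [rect (fun x y => (P (f x) (f y))%:R) _ _](eq_rect (l := fun x y => (P s s')%:R * 1)); last first.
  by move=> x y; rewrite !inE => /eqP -> /eqP ->; rewrite mulr1.
rewrite !rectZ; case: (boolP (P s s')) => h; last by rewrite !mul0r !mulr0.
rewrite !mul1r.
have -> : rect A (fib f s) (fib f s') = D / n * (W s s' * rect (fun _ _ => 1) (fib f s) (fib f s')).
  rewrite -cdensE => [|//|x y /eqP]; last by rewrite oner_eq0.
  by rewrite rectZ; field; rewrite !gt_eqF.
apply: ler_wpM2l; first by pos.
by apply: ler_wpM2r; [apply: rect_ge0 | exact: Pb].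
Qed.

(** The discarded cells of bounded density have a small mass because their
    density is low or because their volume is small; those of high density
    either involve a tiny part or are heavy. *)
Lemma removed_mass :
  \sum_x \sum_y (discarded (f x) (f y))%:R * A x y <=
  D / n * (rho * n ^+ 2) +
  D / n * (B * \sum_x \sum_y ((rho <= W (f x) (f y))%R && r (f x) (f y))%:R)
  + 2 * (M%:R * eta * t * n)
  + n / (B * D) * (M%:R * t + n + M%:R * ncyc R e 4 / (eta * n)).
Proof.
pose P1 s s' := W s s' < rho.
pose P2 s s' := [&& rho <= W s s', W s s' <= B & r s s'].
have A0 x y : 0 <= A x y by exact: ler0n.
have h1 : \sum_x \sum_y (P1 (f x) (f y))%:R * A x y <= D / n * (rho * n ^+ 2).
  apply: le_trans (density_mass rho0 _) _; first by move=> s s' /ltW.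
  apply: ler_wpM2l; first by pos.
  apply: ler_wpM2l => //.
  have -> : n ^+ 2 = \sum_(x : T) \sum_(y : T) 1.
    by rewrite !sumr_const /n expr2 -[RHS]mulr_natr.
  by apply: ler_sum => x _; apply: ler_sum => y _; rewrite lern1; case: (P1 _ _).
have h2 : \sum_x \sum_y (P2 (f x) (f y))%:R * A x y <=
   D / n * (B * \sum_x \sum_y ((rho <= W (f x) (f y))%R && r (f x) (f y))%:R).
  apply: le_trans (density_mass (ltW B0) _) _; first by move=> s s' /and3P[].
  apply: ler_wpM2l; first by pos.
  apply: ler_wpM2l; first exact: ltW.
  apply: ler_sum => x _; apply: ler_sum => y _; rewrite ler_nat /P2.
  by case: (rho <= _); case: (_ <= B) => //=; case: (r _ _).
have h3 : \sum_x \sum_y ((#|fib f (f x)|%:R < eta * n)%R)%:R * A x y <= M%:R * eta * t * n.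
  exact: tiny_cells_mass.
have h4 : \sum_x \sum_y ((#|fib f (f y)|%:R < eta * n)%R)%:R * A x y <= M%:R * eta * t * n.
  apply: le_trans h3; rewrite exchange_big; apply: ler_sum => x _; apply: ler_sum => y _.
  by rewrite /A adjk_sym.
apply: le_trans (_ : \sum_x \sum_y (P1 (f x) (f y))%:R * A x y +
  \sum_x \sum_y (P2 (f x) (f y))%:R * A x y +
  (\sum_x \sum_y ((#|fib f (f x)|%:R < eta * n)%R)%:R * A x y +
  \sum_x \sum_y ((#|fib f (f y)|%:R < eta * n)%R)%:R * A x y) +
  \sum_x \sum_y [&& B < W (f x) (f y), eta * n <= #|fib f (f x)|%:R
       & eta * n <= #|fib f (f y)|%:R]%R%:R * A x y <= _); last first.
  apply: lerD; last exact: heavy_cells_mass.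
  apply: lerD; first exact: lerD.
  by rewrite mulr2n mulrDl mul1r; apply: lerD.
rewrite -!big_split /=; apply: ler_sum => x _; rewrite -!big_split /=.
apply: ler_sum => y _; rewrite -!mulrDl; apply: ler_wpM2r => //.
rewrite -!natrD ler_nat.
have cover (b b1 b2 b3 b4 b5 : bool) : b ==> [|| b1, b2, b3, b4 | b5] ->
    (b <= b1 + b2 + (b3 + b4) + b5)%N.
  by case: b; case: b1; case: b2; case: b3; case: b4; case: b5.
apply: cover; rewrite /discarded /P1 /P2 -/n -/(W _ _).
case: (ltP (W _ _) rho) => //= _; case: (ltP B (W _ _)) => //= _.
  by do 2!case: ltP.
by case: (r _ _).
Qed.

End RemovedMass.

(** * Removal of short odd cycles *)

Section CutFromRegularity.
Variables (R : archiRealFieldType) (T S : finType) (f : T -> S).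
Implicit Types (k v a : T -> T -> R) (X Y : {set T}).

Lemma rect_cells k X Y :
  rect k X Y = \sum_s \sum_t rect k (fib f s :&: X) (fib f t :&: Y).
Proof.
rewrite rectE (sum_cells f); apply: eq_bigr => s _; apply: eq_bigr => t _.
rewrite [LHS]rectE [RHS]rectE; apply: eq_bigr => x _; apply: eq_bigr => y _.
rewrite !in_setI; case: (x \in fib f s); case: (y \in fib f t) => /=;
  rewrite ?mul0r ?mulr0 ?mul0r ?mul1r //.
Qed.

Lemma rect_sym k X Y : (forall x y, k x y = k y x) -> rect k X Y = rect k Y X.
Proof.
by move=> ks; rewrite /rect exchange_big; apply: eq_bigr => x _; apply: eq_bigr => y _.
Qed.

Lemma cdens_sym v a s t : (forall x y, v x y = v y x) -> (forall x y, a x y = a y x) ->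
  cdens v a f s t = cdens v a f t s.
Proof. by move=> vs as_; rewrite /cdens (rect_sym _ _ vs) (rect_sym _ _ as_). Qed.

(** The same rectangle is used in all the cells, and the deficits add up. *)
Lemma regular_cut B gamma N2 v a : cell_regular B gamma N2 v a f ->
  forall X Y, rect (fun x y => Num.min (cdens v a f (f x) (f y)) B * v x y) X Y - gamma * N2
   <= rect a X Y.
Proof.
move=> reg X Y; rewrite lerBlDr -lerBlDl; apply: le_trans (reg (fun _ _ => X) (fun _ _ => Y)).
rewrite !(rect_cells _ X Y) -sumrB; apply: ler_sum => s _.
rewrite -sumrB; apply: ler_sum => t _.
rewrite (eq_rect (l := fun x y => Num.min (cdens v a f s t) B * v x y)); last first.
  by move=> x y; rewrite !inE => /andP[/eqP -> _] /andP[/eqP -> _].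
by rewrite rectZ /deficit le_max lexx orbT.
Qed.
End CutFromRegularity.

Section OddRemoval.
Variable R : archiRealFieldType.

Lemma kpow_le (T : finType) (A1 A2 : T -> T -> R) k x y : (forall u v, 0 <= A1 u v) ->
  (forall u v, A1 u v <= A2 u v) -> kpow A1 k x y <= kpow A2 k x y.
Proof.
move=> A0 A12; elim: k x => [|k IH] x //; rewrite !kpowS; apply: ler_sum => z _.
by apply: ler_pM => //; exact: kpow_ge0.
Qed.

Lemma kpowZ (T : finType) (A : T -> T -> R) c k x y :
  kpow (fun u v => c * A u v) k x y = c ^+ k * kpow A k x y.
Proof.
elim: k x => [|k IH] x; first by rewrite expr0 mul1r.
rewrite !kpowS mulr_sumr; apply: eq_bigr => z _; rewrite IH exprS; ring.
Qed.

(** If [n] is small against [D^2] there are few edges altogether.  Otherwise a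
    weakly regular partition gives a step kernel [Wb], and the reduced
    relation [h] on its labels has density at least [rho].  If [h] had many
    closed walks of length [L], so would [Wb], hence so would the graph, and
    almost all of them would be cycles.  Therefore [h] falls under the removal
    lemma for dense weighted graphs, and the edges lying in discarded cells
    are removed. *)
Lemma odd_cycle_removal (j : nat) (eps : R) : 0 < eps ->
  exists D0 delta : R, [/\ 0 < D0, 0 < delta &
   forall (T : finType) (e : rel T) (D : R),
     symmetric e -> irreflexive e -> D0 <= D -> (0 < #|T|)%N -> #|T|%:R <= D ^+ 2 ->
     ncyc R e 4 <= delta * D ^+ 4 -> ncyc R e j.+2.*2.+1 <= delta * D ^+ j.+2.*2.+1 ->
   exists2 F : rel T, \sum_x \sum_y (e x y && F x y)%:R <= eps * #|T|%:R * D &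
     forall p : seq T, cycle [rel x y | e x y && ~~ F x y] p -> odd (size p) ->
       (2 < size p <= j.+2.*2.+1)%N -> False].
Proof.
move=> e0; set L := j.+2.*2.+1.
have LE : L = (j.*2 + 5)%N by rewrite /L !doubleS !addnS addn0.
(* Below [kappa * D^2] vertices there are few edges; [K * D] is the degree cut-off,
   the density of the kept cells lies between [rho] and [B], and [al] is the volume
   that the dense removal lemma may discard. *)
pose kappa := eps ^+ 2 / 8; have kappa0 : 0 < kappa by rewrite /kappa; pos.
pose K := 40 / eps; have K0 : 0 < K by rewrite /K; pos.
pose rho := eps / 16; have rho0 : 0 < rho by rewrite /rho; pos.
pose B := 24 / eps + rho; have B0 : 0 < B by rewrite /B; pos.
have rhoB : rho <= B by rewrite /B lerDr; pos.
pose al := eps / (16 * B); have al0 : 0 < al by rewrite /al; pos.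
have [c c0 dense] := @dense_removal R j.+2 al isT al0.
pose c' := rho ^+ L * c; have c'0 : 0 < c' by rewrite /c'; pos.
(* The errors [eps2] and [eps3] make the loss in the transfer of closed walks
   equal to half of the main term, which is [c'] after normalization. *)
pose r := j.*2.
pose BB := B ^+ r.+1 + B ^+ r.+3; have BB0 : 0 < BB by rewrite /BB; pos.
have er0 := @chain_err_ge0 R K B K0 B0 r.+1.
pose E2 := chain_err K B r.+1 + (K + B) / kappa * BB.
have E20 : 0 < E2.
  by rewrite /E2; apply: ltr_wpDl => //; pos.
pose eps2 := c' / (4 * E2); have eps20 : 0 < eps2 by rewrite /eps2; pos.
pose eps3 := c' / (4 * BB); have eps30 : 0 < eps3 by rewrite /eps3; pos.
have [M regM] := @regularity R B eps2 (ltW B0) eps20.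
(* The number [M] of parts depends on [eps2]; parts with less than [eta * n] points
   are tiny, and [delta] is chosen after [M] and [eta]. *)
pose eta := eps / (32 * K * M.+1%:R); have eta0 : 0 < eta by rewrite /eta; pos.
pose tau' := kappa ^+ 2 * c' / 8; have tau'0 : 0 < tau' by rewrite /tau'; pos.
pose C2 := 3 + K ^+ 2; have C20 : 0 < C2 by rewrite /C2; pos.
have [D1 D10 degen] := @few_degenerate_closed_walks R r K C2 tau' K0 C20 tau'0.
have [delta [delta0 d1 d2 d3 [d4 d5]]] : exists delta : R, [/\ 0 < delta, delta <= 1,
    delta <= kappa ^+ 2, delta <= kappa ^+ 2 * eps3 / 2 &
    delta <= eta * kappa ^+ 2 / M.+1%:R /\ delta <= tau'].
  exists (Num.min (Num.min 1 (kappa ^+ 2)) (Num.min (kappa ^+ 2 * eps3 / 2)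
     (Num.min (eta * kappa ^+ 2 / M.+1%:R) tau'))).
  rewrite !lt_min !ge_min !lexx !orbT /=; split => //.
  by rewrite ltr01 tau'0 /= andbT; apply/and3P; split; pos.
pose D0 := 1 + 2 / eps + D1 + 2 * K / (eps3 * kappa) + M.+1%:R * K / kappa.
exists D0, delta; split => //; first by rewrite /D0; pos.
move=> T e D es ei DD n0 nD c4 cL.
have Dge : [/\ 1 <= D, 2 / eps <= D, D1 <= D, 2 * K / (eps3 * kappa) <= D & M.+1%:R * K / kappa <= D].
  have a1 : 0 <= 2 / eps by pos.
  have a2 : 0 <= 2 * K / (eps3 * kappa) by pos.
  have a3 : 0 <= M.+1%:R * K / kappa by pos.
  rewrite /D0 in DD; split; move: DD; move: a1 a2 a3 D10; clear; lra.
case: Dge => D_1 D_eps D_D1 D_eps3 D_M.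
have Dpos : 0 < D by apply: lt_le_trans D_1.
set n : R := #|T|%:R in nD *; have n0' : 0 < n by rewrite ltr0n.
have D20 : 0 < D ^+ 2 by pos.
case: (lerP n (kappa * D ^+ 2)) => [n_small|/ltW n_large].
  exists (fun _ _ => true).
    under eq_bigr do under eq_bigr do rewrite andbT.
    apply: (mass_small es ei n0' e0 D_eps).
    have h1 : n ^+ 2 <= kappa ^+ 2 * D ^+ 4.
      have -> : kappa ^+ 2 * D ^+ 4 = (kappa * D ^+ 2) ^+ 2 by ring.
      by rewrite lerXn2r // nnegrE; pos.
    have h2 : delta * D ^+ 4 <= kappa ^+ 2 * D ^+ 4 by apply: ler_wpM2r => //; pos.
    have h3 : (eps ^+ 2 / 4) ^+ 2 * D ^+ 4 = 4 * (kappa ^+ 2 * D ^+ 4) by rewrite /kappa; field.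
    have h4 : 0 <= kappa ^+ 2 * D ^+ 4 by pos.
    rewrite h3 -/n; move: h1 h2 h4 c4; clear; lra.
  move=> [|x [|y p]] //= /andP[]; by rewrite andbF.
have D4n : kappa ^+ 2 * D ^+ 4 <= n ^+ 2.
  have -> : kappa ^+ 2 * D ^+ 4 = (kappa * D ^+ 2) ^+ 2 by ring.
  by rewrite lerXn2r // nnegrE; pos.
have D40 : 0 < D ^+ 4 by pos.
pose t := K * D; have t0 : 0 < t by rewrite /t; pos.
pose e1 := trunc (R := R) e t.
have e1s : symmetric e1 by exact: trunc_sym.
have e1i : irreflexive e1 by move=> x; rewrite /e1 /trunc /= ei.
have e1e : subrel e1 e by move=> x y /and3P[].
have row x : deg R e1 x <= t by apply: trunc_deg; exact: ltW.
have c4' : ncyc R e 4 <= 1 * D ^+ 4.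
  by apply: le_trans c4 _; apply: ler_wpM2r => //; exact: ltW.
have c41 : ncyc R e1 4 <= delta * D ^+ 4 by apply: le_trans c4; exact: ncyc_sub.
have loss : mass R e - mass R e1 <= eps / 4 * n * D.
  apply: le_trans (trunc_loss es t0) _; rewrite ler_pdivrMr //.
  have -> : eps / 4 * n * D * t = 2 * ((2 * 1 + 3) * n * D ^+ 2).
    by rewrite /t /K; field; rewrite gt_eqF.
  apply: ler_wpM2l => //.
  exact: sum_deg_sqr_le.
pose a x y : R := n / D * adjk R e1 x y.
have a0 x y : 0 <= a x y by apply: mulr_ge0; [pos | exact: ler0n].
have as_ x y : a x y = a y x by rewrite /a adjk_sym.
have one0 : 1 != 0 :> R := oner_neq0 R.
have [S [f [SM reg]]] := regM T (fun _ _ => 1) a (n ^+ 2) (fun _ _ => ler01) a0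
  (fun x y h => False_ind _ (elimN eqP one0 h)) ltac:(pos)
  ltac:(by rewrite !sumr_const expr2 -[leLHS]mulr_natr).
pose W s s' := cdens (fun _ _ : T => 1) a f s s'.
have Ws s s' : W s s' = W s' s by apply: cdens_sym.
have W0 s s' : 0 <= W s s' by apply: cdens_ge0 => // *; exact: ler01.
pose Wb x y := Num.min (W (f x) (f y)) B.
have cut X Y : rect Wb X Y - eps2 * n ^+ 2 <= rect a X Y.
  apply: le_trans (regular_cut reg X Y); rewrite lerD2r.
  by apply: ler_rect => x y _ _; rewrite mulr1.
have Wb0 x y : 0 <= Wb x y by rewrite /Wb le_min W0 ltW.
have WbB x y : Wb x y <= B by rewrite /Wb ge_min lexx orbT.
have Wbs x y : Wb x y = Wb y x by rewrite /Wb Ws.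
have few4 : ncyc R e1 4 + mass R e1 <= eps3 * n ^+ 2.
  have h1 : delta * D ^+ 4 <= eps3 / 2 * n ^+ 2.
    apply: le_trans (_ : eps3 / 2 * (kappa ^+ 2 * D ^+ 4) <= _); last first.
      by apply: ler_wpM2l => //; pos.
    have -> : eps3 / 2 * (kappa ^+ 2 * D ^+ 4) = kappa ^+ 2 * eps3 / 2 * D ^+ 4 by ring.
    by apply: ler_wpM2r => //; pos.
  have h2 : mass R e1 <= t * n.
    apply: le_trans (ler_sum _ (fun x _ => row x)) _.
    by rewrite sumr_const mulr_natr.
  have h3 : t * n <= eps3 / 2 * n ^+ 2.
    rewrite expr2 mulrA; apply: ler_wpM2r; first exact: ltW.
    apply: le_trans (_ : eps3 / 2 * (kappa * D ^+ 2) <= _); last first.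
      by apply: ler_wpM2l => //; pos.
    have -> : eps3 / 2 * (kappa * D ^+ 2) = (D * (eps3 * kappa)) / 2 * D by ring.
    apply: ler_wpM2r; first exact: ltW.
    rewrite ler_pdivlMr // mulrC -ler_pdivrMr //; pos.
  have h4 : eps3 * n ^+ 2 = eps3 / 2 * n ^+ 2 + eps3 / 2 * n ^+ 2 by field.
  by rewrite h4; apply: lerD; [exact: le_trans c41 h1 | exact: le_trans h2 h3].
have transfer := closed_walks_transfer e1s e1i erefl n0' Dpos K0 B0 kappa0 (ltW eps20) nD n_large
   row few4 Wb0 WbB cut r.
pose h s s' := rho <= W s s'.
have hs : symmetric h by move=> s s'; rewrite /h Ws.
have [many|[r' r'mass r'cyc]] := dense T S f h hs n0.
  exfalso.
  have many' : c' * n ^+ L <= \sum_x kpow Wb L x x.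
    apply: le_trans (_ : rho ^+ L * (c * n ^+ L) <= _); first by rewrite mulrA.
    apply: le_trans (ler_wpM2l _ many) _; first by pos.
    rewrite mulr_sumr; apply: ler_sum => x _; rewrite -kpowZ; apply: kpow_le => u v.
      by apply: mulr_ge0; [exact: ltW | exact: ler0n].
    rewrite /h /Wb; case: (lerP rho (W (f u) (f v))) => hW; last by rewrite mulr0 // Wb0.
    by rewrite mulr1 le_min hW rhoB.
  have LE' : (r + 5)%N = L by rewrite LE.
  (* The two error terms contribute a quarter of [c'] each. *)
  have errE : eps2 * chain_err K B r.+1 + dist2_err K B kappa eps2 eps3 * B ^+ r.+1 +
     dist2_err K B kappa eps2 eps3 * B ^+ r.+3 = c' / 2.
    transitivity (eps2 * E2 + eps3 * BB); first by rewrite /dist2_err /E2 /BB; ring.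
    have -> : eps2 * E2 = c' / 4 by rewrite /eps2; move: (E2) E20 => z z0; field; rewrite gt_eqF.
    have -> : eps3 * BB = c' / 4 by rewrite /eps3; move: (BB) BB0 => z z0; field; rewrite gt_eqF.
    by field.
  rewrite errE LE' in transfer.
  have low : 4 * tau' * D ^+ L <= \sum_x kpow (adjk R e1) L x x.
    apply: le_trans transfer.
    apply: le_trans (_ : (D / n) ^+ r.+1 * (c' / 2 * n ^+ r.+3) <= _); last first.
      apply: ler_wpM2l; first by pos.
      have nL : n ^+ L = n ^+ 2 * n ^+ r.+3 by rewrite -exprD -LE' add2n !addnS addn0.
      have : c' * n ^+ r.+3 <= n ^- 2 * \sum_x kpow Wb L x x.
        rewrite ler_pdivlMl; last by pos.
        by rewrite mulrCA -nL.
      set Z := n ^- 2 * _; have -> : c' * n ^+ r.+3 = c' / 2 * n ^+ r.+3 + c' / 2 * n ^+ r.+3 by field.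
      set Y := c' / 2 * _; clear; lra.
    have -> : (D / n) ^+ r.+1 * (c' / 2 * n ^+ r.+3) = c' / 2 * D ^+ r.+1 * n ^+ 2.
      rewrite expr_div_n (_ : n ^+ r.+3 = n ^+ r.+1 * n ^+ 2); last by rewrite -exprD addn2.
      have : n ^+ r.+1 != 0 by rewrite expf_neq0 // gt_eqF.
      by move: (n ^+ r.+1) (D ^+ r.+1) => z w z0; field.
    apply: le_trans (_ : c' / 2 * D ^+ r.+1 * (kappa ^+ 2 * D ^+ 4) <= _); last first.
      by apply: ler_wpM2l => //; pos.
    have -> : D ^+ L = D ^+ r.+1 * D ^+ 4 by rewrite -exprD -LE' !addnS !addn0.
    by rewrite le_eqVlt; apply/orP; left; apply/eqP; rewrite /tau'; field.
  have C4sum : \sum_x \sum_y kpow (adjk R e1) 2 x y ^+ 2 <= C2 * D ^+ 4.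
    apply: le_trans (codeg_all e1s e1i row (ltW t0)) _.
    have h1 : n ^+ 2 <= D ^+ 4.
      by rewrite (_ : 4 = 2 * 2)%N // exprM lerXn2r ?nnegrE; pos.
    have h2 : n * t ^+ 2 <= K ^+ 2 * D ^+ 4.
      have -> : K ^+ 2 * D ^+ 4 = D ^+ 2 * t ^+ 2 by rewrite /t; ring.
      by apply: ler_wpM2r => //; pos.
    have h3 : ncyc R e1 4 <= 1 * D ^+ 4 by apply: le_trans c4'; exact: ncyc_sub.
    rewrite -/n /C2; move: h1 h2 h3; clear; lra.
  have := degen T e1 D e1s e1i D_D1 nD row C4sum.
  rewrite LE'; have -> : sumseq L (fun s => (cycle e1 s)%:R) = \sum_x kpow (adjk R e1) L x x.
    by rewrite /L closed_walks.
  have h1 : ncyc R e1 L <= tau' * D ^+ L.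
    apply: le_trans (_ : delta * D ^+ L <= _).
      by apply: le_trans cL; exact: ncyc_sub.
    by apply: ler_wpM2r => //; pos.
  have h2 : 0 < tau' * D ^+ L by pos.
  move: h1 h2 low; clear; set u := \sum_x _; lra.
exists (fun x y => ~~ e1 x y || discarded e1 f r' D B rho (f x) (f y)); last first.
  move=> p cp op szp; apply: (r'cyc (map f p)); rewrite ?size_map //.
  rewrite cycle_map; apply: sub_cycle cp => x y /= /andP[_].
  rewrite negb_or => /andP[_]; rewrite /discarded !negb_or -leNgt -/a -/(W _ _) => /and3P[h1 _ h2].
  by rewrite /h h1.
have rm := @removed_mass R T S e1 f r' e1s e1i t D B eta rho M row (ltW t0) Dpos B0 eta0
  (ltW rho0) n0' SM.
apply: le_trans (_ : (mass R e - mass R e1) + \sum_x \sum_y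
  (discarded e1 f r' D B rho (f x) (f y))%:R * adjk R e1 x y <= _).
  rewrite /mass /deg -sumrB -big_split /=; apply: ler_sum => x _.
  rewrite -sumrB -big_split /=; apply: ler_sum => y _; rewrite /adjk.
  have := @e1e x y; case: (e1 x y) => [->|_] //=; first by rewrite subrr add0r mulr1.
  by case: (e x y) => //=; rewrite subr0 mulr0 addr0.
have -> : eps * n * D = eps / 4 * n * D + (eps / 16 * n * D + eps / 16 * n * D
   + eps / 16 * n * D + eps / 8 * n * D) + 7 / 16 * (eps * n * D) by field.
rewrite -[leLHS]addr0; apply: lerD; last by pos.
apply: lerD => //; apply: le_trans rm _.
have Mle : M%:R <= M.+1%:R :> R by rewrite ler_nat.
have M0 : 0 < M.+1%:R :> R by rewrite ltr0n.
apply: lerD; first (apply: lerD; first apply: lerD).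
- by rewrite le_eqVlt -/n /rho; apply/orP; left; apply/eqP; field; rewrite gt_eqF.
- apply: le_trans (_ : D / n * (B * (al * n ^+ 2)) <= _).
    apply: ler_wpM2l; first by pos.
    by apply: ler_wpM2l; [exact: ltW | exact: r'mass].
  rewrite le_eqVlt /al; apply/orP; left; apply/eqP; field.
  by rewrite !gt_eqF.
- apply: le_trans (_ : 2 * (M.+1%:R * eta * t * n) <= _).
    apply: ler_wpM2l => //; rewrite -/n.
    by do 3!(apply: ler_wpM2r; first by pos).
  rewrite le_eqVlt /eta /t; apply/orP; left; apply/eqP.
  by move: (M.+1%:R : R) M0 => m m0; field; rewrite !gt_eqF.
rewrite -/n; have i1 : M%:R * t <= n.
  apply: le_trans n_large; rewrite /t expr2 [leLHS]mulrA [leRHS]mulrA; apply: ler_wpM2r; first exact: ltW.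
  apply: le_trans (_ : M.+1%:R * K <= _); first by apply: ler_wpM2r => //; exact: ltW.
  by rewrite (mulrC kappa) -ler_pdivrMr.
have i2 : M%:R * ncyc R e1 4 / (eta * n) <= n.
  rewrite ler_pdivrMr; last by pos.
  apply: le_trans (_ : M.+1%:R * (eta * kappa ^+ 2 / M.+1%:R * D ^+ 4) <= _).
    apply: ler_pM => //; first by apply: sumseq_ge0 => *; exact: ler0n.
    by apply: le_trans c41 _; apply: ler_wpM2r => //; exact: ltW.
  have -> : M.+1%:R * (eta * kappa ^+ 2 / M.+1%:R * D ^+ 4) = eta * (kappa ^+ 2 * D ^+ 4).
    by move: (M.+1%:R : R) M0 => m m0; field; rewrite !gt_eqF.
  have -> : n * (eta * n) = eta * n ^+ 2 by ring.
  by apply: ler_wpM2l => //; exact: ltW.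
apply: le_trans (_ : n / (B * D) * (3 * n) <= _).
  apply: ler_wpM2l; first by pos.
  by move: i1 i2; clear; lra.
have -> : n / (B * D) * (3 * n) = n * (3 * n / (B * D)) by ring.
have -> : eps / 8 * n * D = n * (eps / 8 * D) by ring.
apply: ler_wpM2l; first exact: ltW.
rewrite ler_pdivrMr; last by pos.
apply: le_trans (_ : 3 * D ^+ 2 <= _); first by apply: ler_wpM2l.
have -> : eps / 8 * D * (B * D) = eps / 8 * B * D ^+ 2 by ring.
apply: ler_wpM2r; first exact: ltW.
have -> : 3 = eps / 8 * (24 / eps) by field; rewrite gt_eqF.
by apply: ler_wpM2l; [pos | rewrite /B lerDl ltW].
Qed.
End OddRemoval.

(** * Copies of a graph and injective homomorphisms *)

Section GraphBasics.
Variables (T : finType) (G : graph T).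

Lemma edge_axiom E : E \in edges G -> (E \subset vertices G) && (#|E| == 2).
Proof. by move=> EG; have /forall_inP/(_ E EG) : graph_axiom (val G) := valP G. Qed.

Lemma adj_sym : symmetric (adj G).
Proof. by move=> x y; rewrite /adj setUC. Qed.

Lemma adj_irr : irreflexive (adj G).
Proof.
by move=> x; apply/negP => /edge_axiom; rewrite setUid cards1 andbF.
Qed.

Lemma adj_vertex x y : adj G x y -> x \in vertices G.
Proof. by case/edge_axiom/andP => /subsetP -> //; rewrite !inE eqxx. Qed.

Lemma edge_pair E : E \in edges G -> exists x y, E = [set x; y] /\ adj G x y.
Proof.
move=> EG; case/andP: (edge_axiom EG) => _ /cards2P[x [y [xy EE]]].
by exists x, y; rewrite /adj -EE.
Qed.

Definition vadj : rel {x : T | x \in vertices G} := fun x y => adj G (val x) (val y).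

Lemma vadj_sym : symmetric vadj. Proof. by move=> x y; exact: adj_sym. Qed.
Lemma vadj_irr : irreflexive vadj. Proof. by move=> x; exact: adj_irr. Qed.

(** A relation on vertices selects unordered edges: one direction is enough. *)
Definition pair_edges (F : rel {x : T | x \in vertices G}) : {set {set T}} :=
  [set [set val u.1; val u.2] | u : {x : T | x \in vertices G} * {x : T | x \in vertices G}
     & vadj u.1 u.2 && F u.1 u.2].

Lemma pair_edges_card (R : realFieldType) F :
  #|pair_edges F|%:R <= \sum_x \sum_y (vadj x y && F x y)%:R :> R.
Proof.
rewrite pair_bigA /= -natr_sum ler_nat.
apply: leq_trans (leq_imset_card _ _) _; rewrite -sum1_card big_mkcond.
by apply: leq_sum => -[x y] _; rewrite inE /=; case: (_ && _).
Qed.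

Lemma pair_edges_sub F : pair_edges F \subset edges G.
Proof. by apply/subsetP => E /imsetP[u]; rewrite inE => /andP[uv _] ->. Qed.

Lemma edges_mass (R : realFieldType) : #|edges G|%:R <= mass R vadj.
Proof.
apply: le_trans (_ : #|pair_edges (fun _ _ => true)|%:R <= _).
  rewrite ler_nat; apply: subset_leq_card; apply/subsetP => E /edge_pair[x [y [-> xy]]].
  have xV := adj_vertex xy; have yV : y \in vertices G by apply: (@adj_vertex y x); rewrite adj_sym.
  by apply/imsetP; exists (exist _ x xV, exist _ y yV); rewrite // inE /= andbT.
apply: le_trans (pair_edges_card _ _) _.
by apply: ler_sum => x _; apply: ler_sum => y _; rewrite andbT.
Qed.

End GraphBasics.

Section Copies.
Variables (S T : finType) (r : rel S) (G : graph T).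

Definition embeds (phi : {ffun S -> T}) : bool := [&& injectiveb phi,
  [forall u, phi u \in vertices G] &
  [forall u, forall v, (u != v) && r u v ==> adj G (phi u) (phi v)]].

Lemma image_graph_subproof (phi : {ffun S -> T}) :
  graph_axiom (if injectiveb phi then
     (phi @: [set: S], [set phi @: (E : {set S}) | E in rel_edges r]) else (set0, set0)).
Proof.
case: (boolP (injectiveb phi)) => [/injectiveP inj|_]; last first.
  by apply/forall_inP => E; rewrite inE.
apply/forall_inP => _ /imsetP[E EH ->] /=.
rewrite imsetS ?subsetT //= card_imset //.
by case/imsetP: EH => -[u v]; rewrite inE /= => /andP[uv _] ->; rewrite cards2 uv.
Qed.

(** The image of the graph of [r] under an injective map; any default will do
    for the other maps. *)
Definition image_graph phi : graph T := Graph (image_graph_subproof phi).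

Lemma image_vertices (phi : {ffun S -> T}) : injectiveb phi ->
  vertices (image_graph phi) = phi @: [set: S].
Proof. by rewrite /vertices /= => ->. Qed.

Lemma image_edges (phi : {ffun S -> T}) : injectiveb phi ->
  edges (image_graph phi) = [set phi @: (E : {set S}) | E in rel_edges r].
Proof. by rewrite /edges /= => ->. Qed.

Lemma image_graph_copy (phi : {ffun S -> T}) : embeds phi ->
  subgraph (image_graph phi) G && isomorphic (rel_graph r) (image_graph phi).
Proof.
case/and3P => iphi /forallP vphi /forallP ephi; apply/andP; split.
  rewrite /subgraph image_vertices // image_edges //; apply/andP; split.
    by apply/subsetP => _ /imsetP[u _ ->].
  apply/subsetP => _ /imsetP[_ /imsetP[[u v] uv ->] ->].
  have /forallP/(_ v)/implyP := ephi u; move: uv; rewrite inE /= => uv /(_ uv).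
  by rewrite imsetU !imset_set1.
have inj := injectiveP _ iphi.
have vP (u : {x : S | x \in vertices (rel_graph r)}) :
    phi (val u) \in vertices (image_graph phi).
  by rewrite image_vertices // imset_f // inE.
apply/existsP; exists [ffun u => exist _ (phi (val u)) (vP u)]; apply/and3P; split.
- by apply/injectiveP => u v; rewrite !ffunE => -[/inj /val_inj].
- apply/forallP => -[y yP]; have := yP; rewrite {1}image_vertices // => /imsetP[u _ yE].
  have uP : u \in vertices (rel_graph r) by rewrite /vertices /= inE.
  apply/codomP; exists (exist _ u uP); rewrite ffunE; apply: val_inj; exact: yE.
apply/forallP => u; apply/forallP => v; rewrite !ffunE /= /adj image_edges //.
have -> : [set phi (val u); phi (val v)] = phi @: [set val u; val v].
  by rewrite imsetU !imset_set1.
apply/eqP; apply/idP/idP => [uv|/imsetP[E EH /(imset_inj inj) ->] //].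
by apply/imsetP; exists [set val u; val v].
Qed.

(** An embedding is a map into the vertex set of its image, which has [#|S|]
    points; so at most [#|S| ^ #|S|] embeddings share an image. *)
Lemma embeddings_le_copies : (#|[set phi | embeds phi]| <=
   #|S| ^ #|S| * copies (rel_graph r) G)%N.
Proof.
pose CP := [set K : graph T | subgraph K G && isomorphic (rel_graph r) K].
rewrite -sum1_card (partition_big image_graph [in CP]) /=; last first.
  by move=> phi; rewrite !inE => /image_graph_copy.
rewrite mulnC /copies -/CP -sum_nat_const; apply: leq_sum => K _; rewrite sum1_card.
apply: leq_trans (_ : #|[set phi in ffun_on (mem (vertices K)) | #|vertices K| == #|S|]| <= _)%N.
  apply: subset_leq_card; apply/subsetP => phi; rewrite unfold_in inE.
  case/andP; rewrite inE => he /eqP <-; have iphi : injectiveb phi by case/and3P: he.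
  rewrite inE.
  rewrite image_vertices // card_imset ?cardsT ?eqxx ?andbT; last by apply/injectiveP.
  by apply/ffun_onP => u; rewrite imset_f // inE.
case: (#|vertices K| =P #|S|) => [vS|_]; last first.
  by rewrite (_ : [set _ in _ | _] = set0) ?cards0 //; apply/setP => phi; rewrite !inE andbF.
rewrite -{1}vS -(card_ffun_on S [in vertices K]).
by apply: subset_leq_card; apply/subsetP => phi; rewrite inE andbT.
Qed.

End Copies.

(** * Cycles, paths and bipartite subgraphs *)

Section CycleCopies.
Variables (T : finType).

Lemma cycle_nthP (U : eqType) (e : rel U) (x0 : U) s :
  reflect (forall i, (i < size s)%N -> e (nth x0 s i) (nth x0 s (i.+1 %% size s)))
          (cycle e s).
Proof.
case: s => [|x p]; first by apply: ReflectT.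
rewrite [cycle e _]/=; apply: (iffP (pathP x0)) => H i.
  move=> /= im; have := H i; rewrite size_rcons => /(_ im).
  have -> : nth x0 (x :: rcons p x) i = nth x0 (x :: p) i.
    by rewrite -rcons_cons nth_rcons /= im.
  rewrite nth_rcons; move: im; rewrite ltnS leq_eqVlt => /orP[/eqP ->|ip].
    by rewrite ltnn eqxx modnn.
  by rewrite ip modn_small.
rewrite size_rcons => im; have := H i im.
have -> : nth x0 (x :: rcons p x) i = nth x0 (x :: p) i.
  by rewrite -rcons_cons nth_rcons /= im.
rewrite nth_rcons /=; move: im; rewrite ltnS leq_eqVlt => /orP[/eqP ->|ip].
  by rewrite ltnn eqxx modnn.
by rewrite ip modn_small.
Qed.

Lemma tuple_embeds (R : realFieldType) (G : graph T) m (r : rel 'I_m)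
    (P : pred (seq {x : T | x \in vertices G})) :
  (forall s : m.-tuple {x : T | x \in vertices G}, P s -> uniq s /\
    forall a b : 'I_m, r a b -> vadj (tnth s a) (tnth s b)) ->
  sumseq m (fun s => (P s)%:R) <= (m ^ m)%:R * (copies (rel_graph r) G)%:R :> R.
Proof.
move=> HP; rewrite sumseq_card -natrM ler_nat.
have := embeddings_le_copies r G; rewrite card_ord; apply: leq_trans.
pose F (s : m.-tuple {x : T | x \in vertices G}) : {ffun 'I_m -> T} :=
  [ffun i => val (tnth s i)].
have Finj : injective F.
  move=> s s' /ffunP FF; apply: eq_from_tnth => i; have := FF i; rewrite !ffunE.
  exact: val_inj.
rewrite -(card_imset _ Finj); apply: subset_leq_card; apply/subsetP => phi /imsetP[s sA ->].
move: sA; rewrite inE => /HP[us es]; rewrite inE.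
have sinj : injective (tnth s) by apply/tuple_uniqP.
apply/and3P; split.
- by apply/injectiveP => i i'; rewrite !ffunE => eq_ii; apply: sinj; exact: val_inj.
- by apply/forallP => i; rewrite ffunE; exact: valP.
- by apply/forallP => a; apply/forallP => b; apply/implyP => /andP[_ rab]; rewrite !ffunE; exact: es.
Qed.

Lemma ncyc_le_copies (R : realFieldType) (G : graph T) m :
  ncyc R (vadj (G := G)) m <= (m ^ m)%:R * (copies (cycle_graph m) G)%:R.
Proof.
apply: tuple_embeds => s /andP[us cs]; split => // a b /eqP ->.
have x0 : {x : T | x \in vertices G} by exact: (tnth s a).
have := cycle_nthP _ x0 _ cs => /(_ a); rewrite size_tuple ltn_ord => /(_ isT).
by rewrite (tnth_nth x0) (tnth_nth x0).
Qed.

Lemma npath_le_copies (R : realFieldType) (G : graph T) j :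
  npath R (vadj (G := G)) j <= (j.+1 ^ j.+1)%:R * (copies (path_graph j) G)%:R.
Proof.
apply: tuple_embeds => s /andP[us cs]; split => // a b /eqP ab.
have x0 : {x : T | x \in vertices G} by exact: (tnth s a).
rewrite (tnth_nth x0) (tnth_nth x0) ab.
by apply: (sortedP x0 cs); rewrite size_tuple -ab.
Qed.

(** A copy of the cycle in the remaining graph lists its vertices along a
    closed walk none of whose steps is selected by [F]. *)
Lemma odd_free (G : graph T) (F : rel {x : T | x \in vertices G}) m : (2 < m)%N ->
  (forall p, cycle [rel x y | vadj x y && ~~ F x y] p -> size p <> m) ->
  is_free (cycle_graph m) (remove_edges G (pair_edges F)).
Proof.
move=> m2 H K /andP[/subsetP KV /subsetP KE]; apply/negP => /existsP[f /and3P[_ _ /forallP fe]].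
have aP (a : 'I_m) : a \in vertices (cycle_graph m) by rewrite inE.
pose g (a : 'I_m) : T := val (f (exist _ a (aP a))).
have gV a : g a \in vertices G by apply: (KV); exact: valP.
pose g' a : {x : T | x \in vertices G} := exist _ (g a) (gV a).
apply: (H [tuple g' i | i < m]); last by rewrite size_tuple.
have m0 : (0 < m)%N by apply: leq_trans m2.
pose x0 := g' (Ordinal m0).
apply/(cycle_nthP _ x0) => i; rewrite size_tuple => im.
have i1m : (i.+1 %% m < m)%N by rewrite ltn_mod.
have E (a : 'I_m) : nth x0 [tuple g' i | i < m] a = g' a by rewrite -tnth_nth tnth_mktuple.
rewrite (E (Ordinal im)) (E (Ordinal i1m)).
have e1 : adj (cycle_graph m) (Ordinal im) (Ordinal i1m).
  apply/imsetP; exists (Ordinal im, Ordinal i1m) => //; rewrite inE /=; apply/andP; split.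
    rewrite -val_eqE /=; move: (im); rewrite leq_eqVlt => /orP[/eqP Em|im'].
      by rewrite -Em modnn; apply: contraTneq m2; rewrite -Em => ->.
    by rewrite modn_small // neq_ltn ltnSn.
  by apply/eqP; apply: val_inj.
have /forallP/(_ (exist _ (Ordinal i1m) (aP _)))/eqP := fe (exist _ (Ordinal im) (aP _)).
rewrite /= e1 => /esym e2; have := KE _ e2; rewrite inE => /andP[nF e3] /=.
apply/andP; split; first exact: e3.
apply: contra nF => Fg; apply/imsetP; exists (g' (Ordinal im), g' (Ordinal i1m)) => //.
by rewrite inE /= Fg andbT.
Qed.

End CycleCopies.

Section Bipartite.
Variables (T : finType) (G : graph T).
Notation V := {x : T | x \in vertices G}.

Definition crossing (X : {set V}) (E : {set T}) : bool :=
  [exists x in val @: X, exists y in val @: (~: X), E == [set x; y]].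

Definition cut_graph (X : {set V}) : graph T := remove_edges G [set E | ~~ crossing X E].

Lemma cut_graph_sub (X : {set V}) : subgraph (cut_graph X) G.
Proof. by rewrite /subgraph /=; apply/andP; split => //; exact: subsetDl. Qed.

Lemma cut_graph_bipartite (X : {set V}) : bipartite (cut_graph X).
Proof.
exists (val @: X), (val @: (~: X)); split.
- apply/setP => x; apply/idP/idP.
    by rewrite inE => /orP[] /imsetP[y _ ->]; exact: valP.
  move=> xV; rewrite inE; case: (boolP (exist _ x xV \in X)) => xX; apply/orP; [left|right].
    by apply/imsetP; exists (exist _ x xV).
  by apply/imsetP; exists (exist _ x xV); rewrite ?inE.
- rewrite -setI_eq0; apply/eqP/setP => x; rewrite !inE; apply/negP => /andP[/imsetP[y yX ->]].
  by rewrite mem_imset ?inE ?yX //; exact: val_inj.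
- move=> E; rewrite inE => /andP[]; rewrite inE negbK => /existsP[x /andP[xX /existsP[y /andP[yX /eqP ->]]]] _.
  by exists x, y.
Qed.

Lemma cut_graph_adj (X : {set V}) (x y : V) : vadj x y -> (x \in X) != (y \in X) ->
  adj (cut_graph X) (val x) (val y).
Proof.
move=> xy; rewrite /adj /cut_graph /= inE => hX; apply/andP; split; last exact: xy.
rewrite inE negbK; case xX : (x \in X) hX => /=; case yX : (y \in X) => // _.
  apply/existsP; exists (val x); rewrite mem_imset ?xX //=; last exact: val_inj.
  apply/existsP; exists (val y); rewrite mem_imset ?inE ?yX ?eqxx //; exact: val_inj.
apply/existsP; exists (val y); rewrite mem_imset ?yX //=; last exact: val_inj.
apply/existsP; exists (val x); rewrite mem_imset ?inE ?xX //=; last exact: val_inj.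
by rewrite setUC.
Qed.

(** A set with prescribed membership of four points is determined by its trace
    on the others, which is arbitrary. *)
Lemma count_cuts (U : finType) (a b c d : U) : uniq [:: a; b; c; d] ->
  (2 ^ #|U| <= 16 * #|[set X : {set U} | [&& a \in X, b \notin X, c \in X & d \notin X]]|)%N.
Proof.
move=> us; pose Q : {set U} := [set x in [:: a; b; c; d]].
have cQ : #|Q| = 4 by rewrite cardsE; exact: (card_uniqP us).
have <- : (16 * 2 ^ #|~: Q|)%N = (2 ^ #|U|)%N.
  by rewrite -(cardsC Q) cQ expnD.
rewrite leq_mul2l /= -card_powerset.
pose F (Z : {set U}) := Z :|: [set a; c].
have Finj : {in powerset (~: Q) &, injective F}.
  move=> Z Z' hZ hZ' FF; apply/setP => x.
  have := congr1 (fun Y : {set U} => x \in Y) FF; rewrite /F !inE.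
  move: hZ hZ'; rewrite !inE => /subsetP/(_ x) h /subsetP/(_ x) h'.
  case xa : (x == a); case xc : (x == c) => //=; rewrite ?orbF // => _;
   move: h h'; rewrite !inE xa ?xc ?orbT /=; by case: (x \in Z); case: (x \in Z') => // A B; 
   try (by have := A isT); try (by have := B isT).
rewrite -(card_in_imset Finj); apply: subset_leq_card; apply/subsetP => _ /imsetP[Z hZ ->].
move: us; rewrite /= !in_cons !in_nil !negb_or !andbT.
case/and3P=> /and3P[ab ac ad] /andP[bc bd] cd.
have hQ x : x \in [:: a; b; c; d] -> x \notin Z.
  move=> xQ; apply/negP => xZ; move: hZ; rewrite powersetE => /subsetP/(_ x xZ).
  by rewrite inE [x \in Q]inE xQ.
rewrite inE /F !in_setU !in_set1 !eqxx !orbT /= (eq_sym b a) (negbTE ab) (negbTE bc).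
rewrite (eq_sym d a) (negbTE ad) (eq_sym d c) (negbTE cd) !orbF.
by rewrite !hQ // !in_cons eqxx !orbT.
Qed.

(** A four-cycle has its alternate vertices on the two sides of at least one
    cut out of sixteen, and four-cycles in a cut graph are bounded by
    hypothesis; it remains to average over all cuts. *)
Lemma bipartite_ncyc4 (R : realFieldType) (beta : R) :
  (forall B : graph T, subgraph B G -> bipartite B ->
     (copies (cycle_graph 4) B)%:R <= beta) ->
  ncyc R (vadj (G := G)) 4 <= 16 * ((4 ^ 4)%:R * beta).
Proof.
move=> hB; pose eX (X : {set V}) : rel V := fun x y => adj (cut_graph X) (val x) (val y).
set bound := (4 ^ 4)%:R * beta.
have bX X : ncyc R (eX X) 4 <= bound.
  apply: le_trans (@ncyc_le_copies T R (cut_graph X) 4) _.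
  apply: ler_wpM2l; first exact: ler0n.
  apply: hB; [exact: cut_graph_sub | exact: cut_graph_bipartite].
have N0 : 0 < (2 ^ #|{: V}|)%:R :> R by rewrite ltr0n expn_gt0.
rewrite -(ler_pM2l N0).
apply: le_trans (_ : 16 * \sum_(X : {set V}) ncyc R (eX X) 4 <= _); last first.
  have -> : (2 ^ #|{: V}|)%:R * (16 * bound) = 16 * \sum_(X : {set V}) bound.
    have cV : #|{: {set V}}| = (2 ^ #|{: V}|)%N.
      by rewrite -cardsT -powersetT card_powerset cardsT.
    by rewrite sumr_const cV -(mulr_natl bound) mulrCA.
  by apply: ler_wpM2l => //; apply: ler_sum.
rewrite /ncyc -sumseq_sum -!sumseqZ; apply: ler_sumseq => -[|a [|b [|c [|d [|? ?]]]]] // _.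
case: (boolP (uniq [:: a; b; c; d])) => us; last first.
  by rewrite mulr0; apply: mulr_ge0 => //; apply: sumr_ge0 => *; exact: ler0n.
case: (boolP (cycle _ _)) => cs; last first.
  by rewrite mulr0; apply: mulr_ge0 => //; apply: sumr_ge0 => *; exact: ler0n.
rewrite mulr1 -natr_sum -natrM ler_nat; apply: leq_trans (count_cuts us) _.
rewrite leq_mul2l /= -sum1_card big_mkcond; apply: leq_sum => X _; rewrite inE.
case: ifP => // /and4P[aX bX' cX dX]; rewrite lt0b.
move: cs => /= /and5P[ab bc cd da _]; rewrite /eX !andbT.
by apply/and4P; split; apply: cut_graph_adj => //; rewrite ?aX ?cX ?(negbTE bX') ?(negbTE dX).
Qed.

End Bipartite.

(** * The theorem *)

Lemma scale_sqr_ge (R : realType) (n : nat) (p : R) : (0 < n)%N ->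
  n%:R `^ (- 2^-1) <= p -> 0 < p /\ n%:R <= (p * n%:R) ^+ 2.
Proof.
move=> n0 hp; have n0' : 0 < n%:R :> R by rewrite ltr0n.
have p0 : 0 < p by apply: lt_le_trans hp; exact: powR_gt0.
split=> //.
have h : n%:R^-1 <= p ^+ 2.
  have -> : (n%:R : R)^-1 = (n%:R `^ (- 2^-1)) ^+ 2.
    rewrite -powR_mulrn ?powR_ge0 // -powRrM mulNr mulVf ?pnatr_eq0 //.
    by rewrite powRN powRr1 // ltW.
  by rewrite lerXn2r // nnegrE; [exact: powR_ge0 | exact: ltW].
rewrite exprMn expr2 mulrA -[leLHS]mul1r; apply: ler_wpM2r; first exact: ltW.
by rewrite -ler_pdivrMr // div1r.
Qed.
Theorem corollary1p5 (R : realType) (j k l : nat)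
    (hj : (1 <= j)%N) (hk : (2 <= k)%N) (hl : (3 <= l)%N)
    (eps C : R) (heps : 0 < eps) (hC : 0 < C) :
  exists (n0 : nat) (delta : R), [/\ (0 < n0)%N, 0 < delta &
    forall (n : nat) (p : R) (T : finType) (G : graph T),
      (n0 <= n)%N ->
      n%:R `^ (- 2^-1) <= p ->
      #|vertices G| = n ->
      (copies (cycle_graph 4) G)%:R <= C * p ^+ 4 * n%:R ^+ 4 ->
      [/\ (copies (path_graph j) G)%:R <= delta * p ^+ j * n%:R ^+ j.+1 ->
            #|edges G|%:R <= eps * p * n%:R ^+ 2,
          (copies (cycle_graph (2 * l)) G)%:R
              <= delta * p ^+ (2 * l) * n%:R ^+ (2 * l) ->
            #|edges G|%:R <= eps * p * n%:R ^+ 2 &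
          (copies (cycle_graph (2 * k + 1)) G)%:R
              <= delta * p ^+ (2 * k + 1) * n%:R ^+ (2 * k + 1) ->
          (forall B : graph T, subgraph B G -> bipartite B ->
             (copies (cycle_graph 4) B)%:R <= delta * p ^+ 4 * n%:R ^+ 4) ->
          exists F : {set {set T}},
            [/\ F \subset edges G,
                #|F|%:R <= eps * p * n%:R ^+ 2 &
                forall m : nat, (3 <= m <= 2 * k + 1)%N -> odd m ->
                  is_free (cycle_graph m) (remove_edges G F)]]].
Proof.
case: j hj => // j _; case: k hk => [|[|k]] // _; case: l hl => [|[|[|l]]] // _.
have [D1 [c1 [D10 c10 paths]]] := @many_paths R j eps heps.
have CC0 : 0 < (4 ^ 4)%:R * C by apply: mulr_gt0; [rewrite ltr0n expn_gt0 | exact: hC].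
have [D2 [c2 [D20 c20 evens]]] := @many_even_cycles R l eps ((4 ^ 4)%:R * C) heps CC0.
have [D3 [d3 [D30 d30 odds]]] := @odd_cycle_removal R k eps heps.
pose Lj : R := (j.+2 ^ j.+2)%:R; have Lj0 : 0 < Lj by rewrite ltr0n expn_gt0.
pose Ll : R := ((2 * l.+3) ^ (2 * l.+3))%:R; have Ll0 : 0 < Ll by rewrite ltr0n expn_gt0.
pose Lk : R := (k.+2.*2.+1 ^ k.+2.*2.+1)%:R; have Lk0 : 0 < Lk by rewrite ltr0n expn_gt0.
have [L4 L40 L4E] : exists2 L4 : R, 0 < L4 & L4 = (4 ^ 4)%:R.
  by exists (4 ^ 4)%:R => //; rewrite ltr0n expn_gt0.
have [delta [delta0 [h1 h2] h3 h4]] : exists delta : R, [/\ 0 < delta,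
   Lj * delta < c1 /\ Ll * delta < c2, 16 * (L4 * delta) <= d3 & Lk * delta <= d3].
  exists (Num.min (Num.min (c1 / (2 * Lj)) (c2 / (2 * Ll))) (Num.min (d3 / (16 * L4)) (d3 / Lk))).
  set m := Num.min _ _.
  have m1 : m <= c1 / (2 * Lj) by rewrite /m !ge_min lexx.
  have m2 : m <= c2 / (2 * Ll) by rewrite /m !ge_min lexx !orbT.
  have m3 : m <= d3 / (16 * L4) by rewrite /m !ge_min lexx !orbT.
  have m4 : m <= d3 / Lk by rewrite /m !ge_min lexx !orbT.
  have m0 : 0 < m by rewrite /m !lt_min; apply/andP; split; apply/andP; split; pos.
  split => //; first split.
  - apply: le_lt_trans (ler_wpM2l (ltW Lj0) m1) _.
    have -> : Lj * (c1 / (2 * Lj)) = c1 / 2 by field; rewrite gt_eqF.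
    by rewrite ltr_pdivrMr //; move: c10; clear; lra.
  - apply: le_lt_trans (ler_wpM2l (ltW Ll0) m2) _.
    have -> : Ll * (c2 / (2 * Ll)) = c2 / 2 by field; rewrite gt_eqF.
    by rewrite ltr_pdivrMr //; move: c20; clear; lra.
  - by move: m3; rewrite ler_pdivlMr; [rewrite mulrC mulrA | pos].
  - by move: m4; rewrite ler_pdivlMr // mulrC.
pose DD := D1 + D2 + D3; have DD0 : 0 < DD by rewrite /DD; pos.
exists (Num.bound (DD ^+ 2)).+1, delta; split => // n p T G n0n pn vn C4G.
have n0 : (0 < n)%N by apply: leq_trans n0n.
have [p0 nD] := scale_sqr_ge n0 pn; set D := p * n%:R in nD.
have n0' : 0 < n%:R :> R by rewrite ltr0n.
have D0 : 0 < D by rewrite /D; pos.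
have DDD : DD <= D.
  rewrite -(ler_pXn2r (n := 2)) // ?nnegrE ?(ltW D0) ?(ltW DD0) //; apply: le_trans nD.
  apply: ltW; apply: lt_trans (_ : (Num.bound (DD ^+ 2))%:R < _).
    by apply: archi_boundP; pos.
  by rewrite ltr_nat.
have [D1D D2D D3D] : [/\ D1 <= D, D2 <= D & D3 <= D].
  by split; move: DDD D10 D20 D30; rewrite /DD; clear; lra.
pose V := {x : T | x \in vertices G}; pose e : rel V := vadj (G := G).
have es : symmetric e by exact: vadj_sym.
have ei : irreflexive e by exact: vadj_irr.
have cV : #|{: V}| = n by rewrite card_sig -vn; apply: eq_card => x; rewrite inE.
have cV0 : (0 < #|{: V}|)%N by rewrite cV.
have nD' : #|{: V}|%:R <= D ^+ 2 by rewrite cV.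
have DE i : p ^+ i * n%:R ^+ i = D ^+ i by rewrite -exprMn.
have massE : mass R e <= eps * #|{: V}|%:R * D -> #|edges G|%:R <= eps * p * n%:R ^+ 2.
  move=> h; apply: le_trans (edges_mass G R) (le_trans h _).
  by rewrite cV /D le_eqVlt; apply/orP; left; apply/eqP; ring.
split.
- move=> cP; apply: massE; rewrite leNgt; apply/negP => /ltW big.
  have := paths V e D es ei D1D big; rewrite leNgt => /negP; apply.
  apply: le_lt_trans (npath_le_copies R G j.+1) _.
  apply: le_lt_trans (ler_wpM2l (ltW Lj0) cP) _.
  have -> : Lj * (delta * p ^+ j.+1 * n%:R ^+ j.+2) = Lj * delta * (n%:R * D ^+ j.+1).
    by rewrite -DE [n%:R ^+ j.+2]exprS; ring.
  by rewrite cV -[ltRHS]mulrA ltr_pM2r //; pos.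
- move=> cP; apply: massE; rewrite leNgt; apply/negP => /ltW big.
  have c4 : ncyc R e 4 <= (4 ^ 4)%:R * C * D ^+ 4.
    apply: le_trans (ncyc_le_copies R G 4) _; rewrite -[leRHS]mulrA.
    by apply: ler_wpM2l; rewrite ?ler0n // -DE mulrA.
  have := evens V e D es ei D2D cV0 nD' c4 big; rewrite leNgt => /negP; apply.
  apply: le_lt_trans (ncyc_le_copies R G _) _.
  apply: le_lt_trans (ler_wpM2l (ltW Ll0) cP) _.
  by rewrite -mulrA DE mulrA ltr_pM2r //; pos.
move=> cP bip.
have kE : (2 * k.+2 + 1 = k.+2.*2.+1)%N by rewrite mul2n addn1.
rewrite kE in cP *.
have c4 : ncyc R e 4 <= d3 * D ^+ 4.
  apply: le_trans (bipartite_ncyc4 (beta := delta * p ^+ 4 * n%:R ^+ 4) bip) _.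
  rewrite -L4E; have -> : 16 * (L4 * (delta * p ^+ 4 * n%:R ^+ 4)) =
    16 * (L4 * delta) * (p ^+ 4 * n%:R ^+ 4) by ring.
  by rewrite DE; apply: ler_wpM2r => //; pos.
have cL : ncyc R e k.+2.*2.+1 <= d3 * D ^+ k.+2.*2.+1.
  apply: le_trans (ncyc_le_copies R G _) _.
  apply: le_trans (ler_wpM2l (ltW Lk0) cP) _.
  by rewrite -mulrA DE mulrA; apply: ler_wpM2r => //; pos.
have [F Fmass Fcyc] := odds V e D es ei D3D cV0 nD' c4 cL.
exists (pair_edges F); split; first exact: pair_edges_sub.
  apply: le_trans (pair_edges_card R F) (le_trans Fmass _).
  by rewrite cV /D le_eqVlt; apply/orP; left; apply/eqP; ring.
move=> m /andP[m3 mk] om; apply: odd_free => // q cq sq.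
by apply: (Fcyc q cq); rewrite sq // m3 mk.
Qed.
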